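(* Let $\Sigma_1,\Sigma_2$ be signatures, $T_1$ a $\Sigma_1$-theory and $T_2$ a $\Sigma_2$-theory. If $T_1$ and $T_2$ are Morita equivalent, then $T_1$ and $T_2$ are categorically equivalent.
   Context: Framework: first-order many-sorted logic with equality. A signature $\Sigma$ is a set of sort symbols (at least one), predicate symbols $p$ each with an arity $\sigma_1\times\ldots\times\sigma_n$, function symbols $f$ each with an arity $\sigma_1\times\ldots\times\sigma_n\to\sigma$, and constant symbols $c$ each with a sort $\sigma$ (all sorts mentioned being in $\Sigma$). Each variable has a sort. $\Sigma$-terms, atoms, formulas (with quantifiers $\forall_\sigma,\exists_\sigma$) and sentences are as usual; equality is allowed between terms of the same sort. $\exists_{\sigma=1}y\,\phi$ means ''there is exactly one $y$ of sort $\sigma$ such that $\phi$''. $\phi(x_1,\ldots,x_n)$ denotes a formula whose free variables are among $x_1,\ldots,x_n$. A $\Sigma$-structure $A$ assigns to each sort $\sigma\in\Sigma$ a nonempty set $A_\sigma$ (these sets pairwise disjoint) and interprets predicates, functions and constants as relations, functions and elements on the corresponding sets; satisfaction is standard. A $\Sigma$-theory is a set of $\Sigma$-sentences; models and entailment $T\vDash\phi$ are standard. For $\Sigma\subset\Sigma^+$ and a $\Sigma^+$-structure $A$, the reduct $A|_\Sigma$ forgets the interpretations of symbols in $\Sigma^+-\Sigma$. Two theories in the same signature are logically equivalent if they have the same class of models. An elementary embedding $h:A\to B$ of $\Sigma$-structures is a family of maps $h_\sigma:A_\sigma\to B_\sigma$, for each sort $\sigma\in\Sigma$, such that $A\vDash\phi[a_1,\ldots,a_n]$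 if and only if $B\vDash\phi[h_{\sigma_1}(a_1),\ldots,h_{\sigma_n}(a_n)]$ for all $\Sigma$-formulas $\phi$ and elements $a_i$ of the appropriate sorts. Explicit definitions. Let $\Sigma\subset\Sigma^+$ be signatures. An explicit definition in terms of $\Sigma$ is a $\Sigma^+$-sentence of one of the following forms (with $\phi,\psi$ $\Sigma$-formulas and all sorts $\sigma_1,\sigma_2,\ldots$ in $\Sigma$; in the first three cases also $\sigma\in\Sigma$). - Predicate $p\in\Sigma^+-\Sigma$ of arity $\sigma_1\times\ldots\times\sigma_n$: $\forall_{\sigma_1}x_1\ldots\forall_{\sigma_n}x_n(p(x_1,\ldots,x_n)\leftrightarrow\phi(x_1,\ldots,x_n))$. - Function $f\in\Sigma^+-\Sigma$ of arity $\sigma_1\times\ldots\times\sigma_n\to\sigma$: $\forall_{\sigma_1}x_1\ldots\forall_{\sigma_n}x_n\forall_\sigma y(f(x_1,\ldots,x_n)=y\leftrightarrow\phi(x_1,\ldots,x_n,y))$; admissibility condition: $\forall_{\sigma_1}x_1\ldots\forall_{\sigma_n}x_n\exists_{\sigma=1}y\,\phi(x_1,\ldots,x_n,y)$. - Constant $c\in\Sigma^+-\Sigma$ of sort $\sigma$: $\forall_\sigma y(y=c\leftrightarrow\psi(y))$; admissibility condition: $\exists_{\sigma=1}y\,\psi(y)$. - Sort $\sigma\in\Sigma^+-\Sigma$ as a product sort, together with function symbols $\pi_1,\pi_2\in\Sigma^+-\Sigma$ of arities $\sigma\to\sigma_1$, $\sigma\to\sigma_2$: $\forall_{\sigma_1}x\forall_{\sigma_2}y\exists_{\sigma=1}z(\pi_1(z)=x\land\pi_2(z)=y)$.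 - Sort $\sigma\in\Sigma^+-\Sigma$ as a coproduct sort, together with function symbols $\rho_1,\rho_2\in\Sigma^+-\Sigma$ of arities $\sigma_1\to\sigma$, $\sigma_2\to\sigma$: $\forall_\sigma z(\exists_{\sigma_1=1}x(\rho_1(x)=z)\lor\exists_{\sigma_2=1}y(\rho_2(y)=z))\land\forall_{\sigma_1}x\forall_{\sigma_2}y\lnot(\rho_1(x)=\rho_2(y))$. - Sort $\sigma\in\Sigma^+-\Sigma$ as a subsort, together with a function symbol $i\in\Sigma^+-\Sigma$ of arity $\sigma\to\sigma_1$: $\forall_{\sigma_1}x(\phi(x)\leftrightarrow\exists_\sigma z(i(z)=x))\land\forall_\sigma z_1\forall_\sigma z_2(i(z_1)=i(z_2)\to z_1=z_2)$; admissibility condition: $\exists_{\sigma_1}x\,\phi(x)$. - Sort $\sigma\in\Sigma^+-\Sigma$ as a quotient sort, together with a function symbol $\epsilon\in\Sigma^+-\Sigma$ of arity $\sigma_1\to\sigma$: $\forall_{\sigma_1}x_1\forall_{\sigma_1}x_2(\epsilon(x_1)=\epsilon(x_2)\leftrightarrow\phi(x_1,x_2))\land\forall_\sigma z\exists_{\sigma_1}x(\epsilon(x)=z)$; admissibility conditions: the sentences saying that $\phi(x_1,x_2)$ is reflexive, symmetric and transitive. Morita extension. Let $T$ be a $\Sigma$-theory. A Morita extension of $T$ to $\Sigma^+$ is a $\Sigma^+$-theory $T^+=T\cup\{\delta_s:s\in\Sigma^+-\Sigma\}$ such that (1) for each $s\in\Sigma^+-\Sigma$, $\delta_s$ is an explicit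 definition of $s$ in terms of $\Sigma$; (2) if $\sigma\in\Sigma^+-\Sigma$ is a sort symbol and $f\in\Sigma^+-\Sigma$ is a function symbol used in the explicit definition of $\sigma$, then $\delta_f=\delta_\sigma$; (3) if $\alpha_s$ is an admissibility condition for $\delta_s$, then $T\vDash\alpha_s$. Morita equivalence. $T_1$ and $T_2$ are Morita equivalent if there are theories $T_1^1,\ldots,T_1^n$ and $T_2^1,\ldots,T_2^m$ such that, writing $T_1^0=T_1$ and $T_2^0=T_2$, each $T_1^{i+1}$ is a Morita extension of $T_1^i$, each $T_2^{i+1}$ is a Morita extension of $T_2^i$, and $T_1^n$ and $T_2^m$ are logically equivalent $\Sigma$-theories for a signature $\Sigma$ with $\Sigma_1\cup\Sigma_2\subset\Sigma$. Categorical equivalence. $\mathrm{Mod}(T)$ is the category whose objects are the models of $T$ and whose arrows are the elementary embeddings between them. $T_1$ and $T_2$ are categorically equivalent if $\mathrm{Mod}(T_1)$ and $\mathrm{Mod}(T_2)$ are equivalent categories, i.e. there is a full, faithful and essentially surjective functor between them. *)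

(* Defs.v *)
From mathcomp Require Import all_boot.
From mathcomp Require Import boolp classical_sets.

Set Implicit Arguments.
Unset Strict Implicit.
Unset Printing Implicit Defensive.

Local Open Scope classical_set_scope.

(* All signatures draw their symbols from one common pool [Sym], so that
   inclusions of signatures and unions of theories are literal.  An arity
   s1 x ... x sn is a sequence of sorts. *)

Inductive decl (Sym : Type) : Type :=
| Sort
| Pred of seq Sym
| Func of seq Sym & Sym
| Const of Sym.
Arguments Sort {Sym}.

Definition decl_sorts (Sym : Type) (d : decl Sym) : seq Sym :=
  match d with
  | Sort => [::]
  | Pred ar => ar
  | Func ar s => rcons ar s
  | Const s => [:: s]
  end.

Record signature (Sym : eqType) := Signature {
  (* [None] on the symbols that are not in the signature *)
  decl_of :> Sym -> option (decl Sym);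
  decl_sortsP : forall x d, decl_of x = Some d ->
    forall s, s \in decl_sorts d -> decl_of s = Some Sort;
  has_a_sort : exists s, decl_of s = Some Sort
}.

Definition subsig (Sym : eqType) (S S' : signature Sym) : Prop :=
  forall x d, S x = Some d -> S' x = Some d.

Definition new_symbols (Sym : eqType) (S S' : signature Sym) : set Sym :=
  [set x | S' x <> None /\ S x = None].

(* Raw syntax over [Sym]; being a term or a formula of a given signature is a
   predicate, so a formula of S is literally a formula of any larger S'. *)

(* [(s, n)] is the [n]-th variable of sort [s]. *)
Notation var Sym := (Sym * nat)%type.

Inductive term (Sym : eqType) : Type :=
| Var of var Sym
| Cst of Sym
| App of Sym & seq (term Sym).

Inductive formula (Sym : eqType) : Type :=
| Eq of term Sym & term Sym
| Atom of Sym & seq (term Sym)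
| Not of formula Sym
| And of formula Sym & formula Sym
| Or of formula Sym & formula Sym
| Imp of formula Sym & formula Sym
| Iff of formula Sym & formula Sym
| All of var Sym & formula Sym
| Ex of var Sym & formula Sym.

Definition forall2 (T U : Type) (R : T -> U -> Prop) : seq T -> seq U -> Prop :=
  fix loop (xs : seq T) (ys : seq U) {struct xs} : Prop :=
    match xs, ys with
    | [::], [::] => True
    | x :: xs', y :: ys' => R x y /\ loop xs' ys'
    | _, _ => False
    end.

Section Syntax.
Variable Sym : eqType.
Implicit Types (S : signature Sym) (t u : term Sym) (phi : formula Sym).
Implicit Types (x y z : var Sym).

Fixpoint has_sort S t : Sym -> Prop :=
  match t with
  | Var x => fun s => x.1 = s /\ S s = Some Sort
  | Cst c => fun s => S c = Some (Const s)
  | App f ts => fun s =>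
      exists2 ar, S f = Some (Func ar s) & forall2 (has_sort S) ts ar
  end.

Fixpoint is_formula S phi : Prop :=
  match phi with
  | Eq t u => exists2 s, has_sort S t s & has_sort S u s
  | Atom p ts => exists2 ar, S p = Some (Pred ar) & forall2 (has_sort S) ts ar
  | Not a => is_formula S a
  | And a b | Or a b | Imp a b | Iff a b => is_formula S a /\ is_formula S b
  | All x a | Ex x a => S x.1 = Some Sort /\ is_formula S a
  end.

Fixpoint term_vars t : seq (var Sym) :=
  match t with
  | Var x => [:: x]
  | Cst _ => [::]
  | App _ ts => flatten (map term_vars ts)
  end.

Fixpoint free_vars phi : seq (var Sym) :=
  match phi with
  | Eq t u => term_vars t ++ term_vars u
  | Atom _ ts => flatten (map term_vars ts)
  | Not a => free_vars a
  | And a b | Or a b | Imp a b | Iff a b => free_vars a ++ free_vars b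
  | All x a | Ex x a => [seq y <- free_vars a | y != x]
  end.

Definition is_sentence S phi : Prop := is_formula S phi /\ free_vars phi = [::].

(* [phi] is a formula of [S] whose free variables are among [xs]. *)
Definition formula_in S (xs : seq (var Sym)) phi : Prop :=
  is_formula S phi /\ {subset free_vars phi <= xs}.

Definition alls (xs : seq (var Sym)) phi : formula Sym := foldr (@All Sym) phi xs.

Definition fresh_index (xs : seq (var Sym)) : nat := (\max_(x <- xs) x.2).+1.

(* There is exactly one x such that phi, written without substitution as
   "exists z, forall x, (phi <-> x = z)" with z of the sort of x, different
   from x and not free in phi. *)
Definition Ex1 x phi : formula Sym :=
  let z := (x.1, fresh_index (x :: free_vars phi)) in
  Ex z (All x (Iff phi (Eq (Var x) (Var z)))).

(* phi(u, w), for phi = phi(x, y) and variables u, w other than x, y. *)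
Definition inst2 x y phi (u w : var Sym) : formula Sym :=
  Ex x (Ex y (And (And (Eq (Var x) (Var u)) (Eq (Var y) (Var w))) phi)).

(* The sentences saying that phi(x, y), with x and y of the same sort, is
   reflexive, symmetric and transitive. *)
Definition equivalence_conditions x y phi : set (formula Sym) :=
  let n := fresh_index [:: x; y] in
  let u := (x.1, n) in let v := (x.1, n.+1) in let w := (x.1, n.+2) in
  let r := inst2 x y phi in
  [set All u (r u u);
       alls [:: u; v] (Imp (r u v) (r v u));
       alls [:: u; v; w] (Imp (And (r u v) (r v w)) (r u w))].

End Syntax.

Record theory (Sym : eqType) (S : signature Sym) := Theory {
  sentences : set (formula Sym);
  sentencesP : forall phi, sentences phi -> is_sentence S phi
}.

(* The pairwise disjoint sets A_s are presented by their union [dom] together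
   with the map [sort_of] sending an element to its sort, so that A_s is the
   fibre of [sort_of] over s.  Predicates and functions are interpreted by
   sets of tuples and graphs on these fibres; symbols that are not in S have
   empty interpretation. *)

Record structure (Sym : eqType) (S : signature Sym) := Structure {
  dom :> Type;
  sort_of : dom -> Sym;
  sort_ofP : forall a, S (sort_of a) = Some Sort;
  sort_nonempty : forall s, S s = Some Sort -> exists a, sort_of a = s;
  pred_int : Sym -> seq dom -> Prop;
  pred_intP : forall p l, pred_int p l -> S p = Some (Pred (map sort_of l));
  func_int : Sym -> seq dom -> dom -> Prop;
  func_intP : forall f l a, func_int f l a ->
    S f = Some (Func (map sort_of l) (sort_of a));
  func_int_total : forall f l s, S f = Some (Func (map sort_of l) s) ->
    exists! a, func_int f l a;
  const_int : Sym -> dom -> Prop;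
  const_intP : forall c a, const_int c a -> S c = Some (Const (sort_of a));
  const_int_total : forall c s, S c = Some (Const s) -> exists! a, const_int c a
}.

Section Semantics.
Variables (Sym : eqType) (S : signature Sym).
Implicit Types (A B : structure S) (T : theory S).

(* Values at variables whose sort is not in S are irrelevant. *)
Definition assignment A (v : var Sym -> A) : Prop :=
  forall x, S x.1 = Some Sort -> sort_of (v x) = x.1.

(* [eval v t a]: the value of [t] under [v] is [a]. *)
Fixpoint eval A (v : var Sym -> A) (t : term Sym) : A -> Prop :=
  match t with
  | Var x => fun a => v x = a
  | Cst c => const_int c
  | App f ts => fun a => exists2 l, forall2 (eval v) ts l & func_int f l a
  end.

Fixpoint sat A (v : var Sym -> A) (phi : formula Sym) : Prop :=
  match phi with
  | Eq t u => exists2 a, eval v t a & eval v u a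
  | Atom p ts => exists2 l, forall2 (eval v) ts l & pred_int p l
  | Not a => ~ sat v a
  | And a b => sat v a /\ sat v b
  | Or a b => sat v a \/ sat v b
  | Imp a b => sat v a -> sat v b
  | Iff a b => sat v a <-> sat v b
  | All x a => forall m : A, sort_of m = x.1 -> sat [eta v with x |-> m] a
  | Ex x a => exists2 m : A, sort_of m = x.1 & sat [eta v with x |-> m] a
  end.

Definition holds A (phi : formula Sym) : Prop :=
  forall v : var Sym -> A, assignment v -> sat v phi.

Definition is_model T A : Prop := forall phi, sentences T phi -> holds A phi.

Definition entails T (phi : formula Sym) : Prop :=
  forall A, is_model T A -> holds A phi.

Definition logically_equivalent (T T' : theory S) : Prop :=
  forall A, is_model T A <-> is_model T' A.

Definition elementary A B (h : A -> B) : Prop :=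
  (forall a, sort_of (h a) = sort_of a) /\
  (forall phi, is_formula S phi ->
   forall v : var Sym -> A, assignment v -> (sat v phi <-> sat (h \o v) phi)).

End Semantics.

(* [explicit_def S S' defined delta adm]: the S'-sentence [delta] is an
   explicit definition, in terms of S, of the symbols in [defined] (a sort
   symbol coming together with its function symbols), and [adm] is the set of
   its admissibility conditions.  The two projections (injections) of a product
   (coproduct) sort are distinct symbols: with pi1 = pi2 the definition would
   force the sort s1 = s2 to be a singleton. *)

Inductive explicit_def (Sym : eqType) (S S' : signature Sym) :
    seq Sym -> formula Sym -> set (formula Sym) -> Prop :=
| DefPred p ar (xs : seq (var Sym)) phi of
    S p = None & S' p = Some (Pred ar) &
    (forall s, s \in ar -> S s = Some Sort) &
    map fst xs = ar & uniq xs & formula_in S xs phi :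
  explicit_def S S' [:: p]
    (alls xs (Iff (Atom p (map (@Var Sym) xs)) phi))
    set0
| DefFunc f ar s (xs : seq (var Sym)) (y : var Sym) phi of
    S f = None & S' f = Some (Func ar s) &
    (forall s', s' \in ar -> S s' = Some Sort) & S s = Some Sort &
    map fst xs = ar & y.1 = s & uniq (rcons xs y) &
    formula_in S (rcons xs y) phi :
  explicit_def S S' [:: f]
    (alls (rcons xs y) (Iff (Eq (App f (map (@Var Sym) xs)) (Var y)) phi))
    [set alls xs (Ex1 y phi)]
| DefConst c s (y : var Sym) psi of
    S c = None & S' c = Some (Const s) & S s = Some Sort &
    y.1 = s & formula_in S [:: y] psi :
  explicit_def S S' [:: c]
    (All y (Iff (Eq (Var y) (Cst c)) psi))
    [set Ex1 y psi]
| DefProduct s s1 s2 pi1 pi2 (x y z : var Sym) of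
    S s = None & S' s = Some Sort & S s1 = Some Sort & S s2 = Some Sort &
    S pi1 = None & S' pi1 = Some (Func [:: s] s1) &
    S pi2 = None & S' pi2 = Some (Func [:: s] s2) & pi1 != pi2 &
    x.1 = s1 & y.1 = s2 & z.1 = s & x != y :
  explicit_def S S' [:: s; pi1; pi2]
    (All x (All y (Ex1 z (And (Eq (App pi1 [:: Var z]) (Var x))
                              (Eq (App pi2 [:: Var z]) (Var y))))))
    set0
| DefCoproduct s s1 s2 rho1 rho2 (x y z : var Sym) of
    S s = None & S' s = Some Sort & S s1 = Some Sort & S s2 = Some Sort &
    S rho1 = None & S' rho1 = Some (Func [:: s1] s) &
    S rho2 = None & S' rho2 = Some (Func [:: s2] s) & rho1 != rho2 &
    x.1 = s1 & y.1 = s2 & z.1 = s & x != y :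
  explicit_def S S' [:: s; rho1; rho2]
    (And (All z (Or (Ex1 x (Eq (App rho1 [:: Var x]) (Var z)))
                    (Ex1 y (Eq (App rho2 [:: Var y]) (Var z)))))
         (All x (All y (Not (Eq (App rho1 [:: Var x]) (App rho2 [:: Var y]))))))
    set0
| DefSubsort s s1 i (x z z1 z2 : var Sym) phi of
    S s = None & S' s = Some Sort & S s1 = Some Sort &
    S i = None & S' i = Some (Func [:: s] s1) &
    x.1 = s1 & z.1 = s & z1.1 = s & z2.1 = s & z1 != z2 &
    formula_in S [:: x] phi :
  explicit_def S S' [:: s; i]
    (And (All x (Iff phi (Ex z (Eq (App i [:: Var z]) (Var x)))))
         (All z1 (All z2 (Imp (Eq (App i [:: Var z1]) (App i [:: Var z2]))
                              (Eq (Var z1) (Var z2))))))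
    [set Ex x phi]
| DefQuotient s s1 eps (x x1 x2 z : var Sym) phi of
    S s = None & S' s = Some Sort & S s1 = Some Sort &
    S eps = None & S' eps = Some (Func [:: s1] s) &
    x.1 = s1 & x1.1 = s1 & x2.1 = s1 & z.1 = s & x1 != x2 &
    formula_in S [:: x1; x2] phi :
  explicit_def S S' [:: s; eps]
    (And (All x1 (All x2 (Iff (Eq (App eps [:: Var x1]) (App eps [:: Var x2]))
                              phi)))
         (All z (Ex x (Eq (App eps [:: Var x]) (Var z)))))
    (equivalence_conditions x1 x2 phi).

Definition morita_extension (Sym : eqType) (S : signature Sym) (T : theory S)
    (S' : signature Sym) (T' : theory S') : Prop :=
  subsig S S' /\
  exists delta : Sym -> formula Sym,
    sentences T' = sentences T `|` [set delta x | x in new_symbols S S'] /\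
    forall x, new_symbols S S' x ->
      exists defined adm,
        [/\ explicit_def S S' defined (delta x) adm,
            x \in defined,
            (forall y, y \in defined -> delta y = delta x)
          & adm `<=` entails T].

Inductive morita_chain (Sym : eqType) (S : signature Sym) (T : theory S) :
    forall S' : signature Sym, theory S' -> Prop :=
| MoritaChain0 : morita_chain T T
| MoritaChainS (S' : signature Sym) (T' : theory S')
    (S'' : signature Sym) (T'' : theory S'') of
    morita_chain T T' & morita_extension T' T'' : morita_chain T T''.

Definition morita_equivalent (Sym : eqType) (S1 S2 : signature Sym)
    (T1 : theory S1) (T2 : theory S2) : Prop :=
  exists (S : signature Sym) (T1' T2' : theory S),
    [/\ subsig S1 S /\ subsig S2 S, morita_chain T1 T1', morita_chain T2 T2'
      & logically_equivalent T1' T2'].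

(* Composition is in diagrammatic order. *)
Record category := Category {
  ob :> Type;
  hom : ob -> ob -> Type;
  idc : forall a, hom a a;
  compc : forall a b c, hom a b -> hom b c -> hom a c;
  comp_idl : forall a b (f : hom a b), compc (idc a) f = f;
  comp_idr : forall a b (f : hom a b), compc f (idc b) = f;
  comp_assoc : forall a b c d (f : hom a b) (g : hom b c) (h : hom c d),
    compc f (compc g h) = compc (compc f g) h
}.
Arguments idc {_} _.

Record functor (C D : category) := Functor {
  fob :> C -> D;
  fhom : forall a b : C, hom a b -> hom (fob a) (fob b);
  fhom_id : forall a : C, fhom (idc a) = idc (fob a);
  fhom_comp : forall (a b c : C) (f : hom a b) (g : hom b c),
    fhom (compc f g) = compc (fhom f) (fhom g)
}.

Definition isomorphic (C : category) (a b : C) : Prop :=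
  exists (f : hom a b) (g : hom b a), compc f g = idc a /\ compc g f = idc b.

Definition faithful (C D : category) (F : functor C D) : Prop :=
  forall (a b : C) (f g : hom a b), fhom F f = fhom F g -> f = g.

Definition full (C D : category) (F : functor C D) : Prop :=
  forall (a b : C) (g : hom (F a) (F b)), exists f : hom a b, fhom F f = g.

Definition essentially_surjective (C D : category) (F : functor C D) : Prop :=
  forall d : D, exists c : C, isomorphic (F c) d.

Definition equivalent_categories (C D : category) : Prop :=
  exists F : functor C D, [/\ full F, faithful F & essentially_surjective F].

Section Mod.
Variables (Sym : eqType) (S : signature Sym).

Definition elementary_embedding (A B : structure S) : Type :=
  {h : A -> B | elementary h}.

Lemma elementary_id (A : structure S) : elementary (@id A).
Proof. by split. Qed.

Lemma elementary_comp (A B C : structure S) (f : A -> B) (g : B -> C) :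
  elementary f -> elementary g -> elementary (g \o f).
Proof.
move=> [sf ef] [sg eg]; split=> [a|phi wf v vP] /=; first by rewrite sg sf.
rewrite (ef phi wf v vP); apply: (eg phi wf (f \o v)) => x xS /=.
by rewrite sf vP.
Qed.

Definition emb_id (A : structure S) : elementary_embedding A A :=
  exist _ _ (elementary_id A).

Definition emb_comp (A B C : structure S) (f : elementary_embedding A B)
    (g : elementary_embedding B C) : elementary_embedding A C :=
  exist _ _ (elementary_comp (proj2_sig f) (proj2_sig g)).

Variable T : theory S.

Definition Mod : category.
Proof.
refine (@Category {A : structure S | is_model T A}
  (fun A B => elementary_embedding (proj1_sig A) (proj1_sig B))
  (fun A => emb_id (proj1_sig A))
  (fun A B C => @emb_comp (proj1_sig A) (proj1_sig B) (proj1_sig C)) _ _ _).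
- by move=> A B [f fP]; apply: eq_exist.
- by move=> A B [f fP]; apply: eq_exist.
- by move=> A B C D [f fP] [g gP] [h hP]; apply: eq_exist.
Defined.

End Mod.

Definition categorically_equivalent (Sym : eqType) (S1 S2 : signature Sym)
    (T1 : theory S1) (T2 : theory S2) : Prop :=
  equivalent_categories (Mod T1) (Mod T2).

(* Main.v *)
Require Import Defs.
From mathcomp Require Import all_boot.
From mathcomp Require Import boolp classical_sets.

Set Implicit Arguments.
Unset Strict Implicit.
Unset Printing Implicit Defensive.

(** Equivalence of categories is symmetric and transitive, and logically
    equivalent theories have the same models; so it suffices that, for a Morita
    extension [T'] of [T], the reduct functor from the models of [T'] to those
    of [T] is an equivalence.  Two facts carry the proof.

    Every element of a new sort is determined by a code, that is, by a Boolean
    and two elements of old sorts: the projections of an element of a product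
    sort, the preimage of an element of a coproduct sort together with the
    summand that contains it, the image of an element of a subsort, a
    representative of an element of a quotient sort ([codes_exist],
    [codes_unique]).  The relation between elements and codes is given by the
    accompanying functions, so elementary embeddings preserve it, and two of
    them that agree on the old sorts are equal ([reduct_faithful]).

    Every formula of the larger signature, read on codes, is equivalent in all
    models of [T'] to one and the same formula of the smaller signature
    ([translatable_sat]): equality of coded elements and the new symbols are
    expressed by the formulas of the explicit definitions, and a quantifier over
    a new sort becomes a disjunction, over the Boolean of the code, of
    quantifiers over old sorts.  Therefore an elementary embedding between
    reducts, applied to codes, yields a well-defined map, and this map is
    elementary ([elementary_lift]), which makes the reduct functor full.

    Finally, a model of [T] is expanded to a model of [T'] by taking the codes in
    normal form as the elements of the new sorts; the admissibility conditions
    make the new functions total and the subsorts and quotients meaningful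
    ([expansion_model]).  Its reduct is isomorphic to the given model, which
    makes the functor essentially surjective. *)

(** * Equivalences of categories *)

Lemma isomorphic_trans (C : category) (a b c : C) :
  isomorphic a b -> isomorphic b c -> isomorphic a c.
Proof.
move=> [f [f' [ff' f'f]]] [g [g' [gg' g'g]]].
exists (compc f g), (compc g' f'); split.
  by rewrite -comp_assoc (comp_assoc g) gg' comp_idl.
by rewrite -comp_assoc (comp_assoc f') f'f comp_idl.
Qed.

Lemma functor_isomorphic (C D : category) (F : functor C D) (a b : C) :
  isomorphic a b -> isomorphic (F a) (F b).
Proof.
move=> [f [g [fg gf]]]; exists (fhom F f), (fhom F g).
by rewrite -!fhom_comp fg gf !fhom_id.
Qed.

Lemma equivalent_categories_trans (C D E : category) :
  equivalent_categories C D -> equivalent_categories D E ->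
  equivalent_categories C E.
Proof.
move=> [F [Ffull Ffaith Fess]] [G [Gfull Gfaith Gess]].
unshelve eexists (@Functor C E (fun c => G (F c))
  (fun a b f => fhom G (fhom F f)) _ _).
- by move=> a /=; rewrite !fhom_id.
- by move=> a b c f g /=; rewrite !fhom_comp.
split.
- move=> a b g; have [f' <-] := Gfull _ _ g; have [f <-] := Ffull _ _ f'.
  by exists f.
- by move=> a b f g /Gfaith/Ffaith.
- move=> e; have [d de] := Gess e; have [c cd] := Fess d.
  exists c; apply: isomorphic_trans de; exact: (functor_isomorphic G cd).
Qed.

(** A quasi-inverse sends an object to a chosen preimage up to isomorphism; on
    arrows it is the preimage under the fully faithful [F] of the conjugate by
    the chosen isomorphisms, and faithfulness turns the functor laws into laws
    about conjugation. *)
Lemma equivalent_categories_sym (C D : category) :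
  equivalent_categories C D -> equivalent_categories D C.
Proof.
move=> [F [Ffull Ffaith Fess]].
have [G0 G0P] := choice Fess.
have isos : forall d, exists p : hom (F (G0 d)) d * hom d (F (G0 d)),
    compc p.1 p.2 = idc (F (G0 d)) /\ compc p.2 p.1 = idc d.
  by move=> d; have [f [g [fg gf]]] := G0P d; exists (f, g).
pose fwd d := projT1 (cid (isos d)).
have fwdP d := projT2 (cid (isos d)).
pose fd d := (fwd d).1; pose bd d := (fwd d).2.
have fb d : compc (fd d) (bd d) = idc (F (G0 d)) by case: (fwdP d).
have bf d : compc (bd d) (fd d) = idc d by case: (fwdP d).
pose lift d d' (u : hom d d') :=
  cid (Ffull (G0 d) (G0 d') (compc (fd d) (compc u (bd d')))).
pose G1 d d' u := projT1 (lift d d' u).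
have G1P d d' u : fhom F (G1 d d' u) = compc (fd d) (compc u (bd d')).
  exact: (projT2 (lift d d' u)).
unshelve eexists (@Functor D C G0 G1 _ _).
- by move=> d; apply: Ffaith; rewrite G1P comp_idl fhom_id fb.
- move=> a b c f g; apply: Ffaith; rewrite fhom_comp !G1P.
  rewrite -!comp_assoc; congr compc; congr compc.
  by rewrite (comp_assoc (bd b)) bf comp_idl.
split=> /=.
- move=> d d' g; exists (compc (bd d) (compc (fhom F g) (fd d'))).
  apply: (Ffaith _ _ _ _); rewrite G1P -!comp_assoc fb comp_idr.
  by rewrite comp_assoc fb comp_idl.
- move=> d d' u u' /(congr1 (fun g => compc (bd d) (compc (fhom F g) (fd d')))).
  by rewrite !G1P -!comp_assoc !bf !comp_idr !comp_assoc !bf !comp_idl.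
- move=> c; exists (F c) => /=.
  have [f Ff] := Ffull _ _ (fd (F c)); have [g Fg] := Ffull _ _ (bd (F c)).
  exists f, g; split; apply: (Ffaith _ _ _ _) => /=; rewrite fhom_comp fhom_id Ff Fg.
    exact: fb.
  exact: bf.
Qed.

(** * Terms, formulas and assignments *)

Section Basics.
Variable Sym : eqType.
Implicit Types (x y z : var Sym) (t u : term Sym) (phi psi : formula Sym).

Lemma term_nested_ind (P : term Sym -> Prop) :
  (forall x, P (Var x)) -> (forall c, P (Cst c)) ->
  (forall f ts, foldr (fun t Q => P t /\ Q) True ts -> P (App f ts)) ->
  forall t, P t.
Proof.
move=> PV PC PA; fix IH 1 => -[x|c|f ts]; [exact: PV|exact: PC|apply: PA].
by elim: ts => //= t ts IHts; split.
Qed.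

Lemma forall2_map1 (T T' U : Type) (R : T' -> U -> Prop) (f : T -> T') xs ys :
  forall2 R (map f xs) ys <-> forall2 (fun a b => R (f a) b) xs ys.
Proof. by elim: xs ys => [|x xs IH] [|y ys] //=; rewrite IH. Qed.

Lemma forall2_fun (T U : Type) (f : T -> U) xs ys :
  forall2 (fun a b => f a = b) xs ys <-> ys = map f xs.
Proof.
elim: xs ys => [|x xs IH] [|y ys] //=; split=> [[<- /IH->]|[-> /IH]] //.
Qed.

Lemma ltn_fresh_index x (xs : seq (var Sym)) : x \in xs -> x.2 < fresh_index xs.
Proof. by move=> xxs; rewrite ltnS (big_rem _ xxs) /= leq_maxl. Qed.

Lemma fresh_notin (xs : seq (var Sym)) s n :
  fresh_index xs <= n -> (s, n) \notin xs.
Proof. by move=> fn; apply/negP => /ltn_fresh_index /=; rewrite ltnNge fn. Qed.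

Lemma term_vars_sorted (S : signature Sym) t s : has_sort S t s ->
  {in term_vars t, forall x, S x.1 = Some Sort}.
Proof.
elim/term_nested_ind: t s => [x|c|f ts IH] s //=.
  by move=> [<- sS] y; rewrite inE => /eqP->.
move=> [ar _ tsar]; elim: ts ar tsar IH => [|t ts IHts] [|s0 ar] //= [ts0 tsar] [IHt IH].
by move=> x; rewrite mem_cat => /orP[/(IHt _ ts0)//|]; apply: IHts tsar IH x.
Qed.

Lemma free_vars_sorted (S : signature Sym) phi : is_formula S phi ->
  {in free_vars phi, forall x, S x.1 = Some Sort}.
Proof.
elim: phi => [t u|p ts|a IH|a IHa b IHb|a IHa b IHb|a IHa b IHb
    |a IHa b IHb|x a IH|x a IH] //=.
- move=> [s ts us] x; rewrite mem_cat => /orP[/(term_vars_sorted ts)|/(term_vars_sorted us)] //.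
- move=> [ar _ tsar]; elim: ts ar tsar => [|t ts IHts] [|s0 ar] //= [ts0 tsar] x.
  by rewrite mem_cat => /orP[/(term_vars_sorted ts0)//|]; apply: IHts tsar x.
1-4: by move=> [fa fb] x; rewrite mem_cat => /orP[]; [apply: IHa|apply: IHb].
1-2: by move=> [_ fa] y; rewrite mem_filter => /andP[_]; apply: IH.
Qed.

Definition updl (T : Type) (v : var Sym -> T) (vs : seq (var Sym)) (l : seq T) :=
  fun x : var Sym => nth (v x) l (index x vs).

Lemma map_updl (T : Type) (v : var Sym -> T) vs l : uniq vs -> size l = size vs -> map (updl v vs l) vs = l.
Proof.
case: vs => [_|x0 vs uvs sl]; first by case: l.
apply: (@eq_from_nth _ (v x0)); rewrite size_map // => i ivs.
rewrite (nth_map x0) // /updl index_uniq //.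
by apply: set_nth_default; rewrite sl.
Qed.

Section Free.
Variables (S : signature Sym) (A : structure S).
Implicit Types (v : var Sym -> A).

Lemma eval_free v v' t :
  {in term_vars t, v =1 v'} -> eval v t = eval v' t.
Proof.
elim/term_nested_ind: t => [x|c|f ts IH] //= vv'.
  by rewrite vv' // mem_head.
apply: funext => a; suff -> : forall2 (eval v) ts = forall2 (eval v') ts by [].
elim: ts IH vv' => //= t ts IHts [IHt IH] vv'; apply: funext => -[|b l] //.
rewrite IHt => [|y yt]; last by rewrite vv' // mem_cat yt.
by rewrite IHts => // y yts; rewrite vv' // mem_cat yts orbT.
Qed.

Lemma evals_free v v' ts :
  {in flatten (map (@term_vars Sym) ts), v =1 v'} ->
  forall2 (eval v) ts = forall2 (eval v') ts.
Proof.
elim: ts => //= t ts IH vv'; apply: funext => -[|b l] //.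
rewrite (@eval_free v v') => [|y yt]; last by rewrite vv' // mem_cat yt.
by rewrite IH // => y yts; rewrite vv' // mem_cat yts orbT.
Qed.

Lemma sat_free v v' phi :
  {in free_vars phi, v =1 v'} -> sat v phi = sat v' phi.
Proof.
elim: phi v v' => [t u|p ts|a IH|a IHa b IHb|a IHa b IHb|a IHa b IHb
    |a IHa b IHb|x a IH|x a IH] v v' vv' /=.
- by rewrite !(@eval_free v v') // => y yt; rewrite vv' //= mem_cat yt ?orbT.
- by rewrite (@evals_free v v').
- by rewrite (IH v v').
1-4: by rewrite (IHa v v') ?(IHb v v') // => y yt; rewrite vv' //= mem_cat yt ?orbT.
- apply: eq_forall => m; congr (_ -> _); apply: IH => y ya /=.
  by case: (eqVneq y x) => // yx; rewrite vv' //= mem_filter yx.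
- congr ex2; apply: funext => m; apply: IH => y ya /=.
  by case: (eqVneq y x) => // yx; rewrite vv' //= mem_filter yx.
Qed.

Lemma sat_closed v v' phi : free_vars phi = [::] -> sat v phi = sat v' phi.
Proof. by move=> fv; apply: sat_free => y; rewrite fv. Qed.

(** The variables of a sort foreign to [S] need values as well, hence the
    detour through an arbitrary element. *)
Lemma assignment_exists : exists v : var Sym -> A, assignment v.
Proof.
have [s0 /(@sort_nonempty _ _ A)[a0 _]] := has_a_sort S.
have val_ex x : exists a : A, S x.1 = Some Sort -> sort_of a = x.1.
  have [/(@sort_nonempty _ _ A)[a aE]|nS] := pselect (S x.1 = Some Sort).
    by exists a.
  by exists a0.
by have [v vP] := choice val_ex; exists v.
Qed.

Lemma holds_closed phi :
  free_vars phi = [::] -> (holds A phi <-> forall v : var Sym -> A, sat v phi).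
Proof.
move=> fv; split=> [h v|h v _]; last exact: h.
by have [v0 v0P] := assignment_exists; rewrite (@sat_closed v v0) //; apply: h.
Qed.

(** A block of quantifiers over distinct variables quantifies over tuples. *)
Lemma sat_alls v vs phi : uniq vs ->
  sat v (alls vs phi) <->
  forall l, map (@sort_of _ _ A) l = map fst vs -> sat (updl v vs l) phi.
Proof.
elim: vs v => [|x vs IH] v /=.
  move=> _; split=> [h [|//] _|h]; last exact: (h [::]).
  rewrite (_ : updl v [::] [::] = v) //; exact: funext.
case/andP=> xvs uvs.
have updE m l : size l = size vs ->
    updl [eta v with x |-> m] vs l = updl v (x :: vs) (m :: l).
  move=> sl; apply: funext => y; rewrite /updl /= eq_sym.
  case: (eqVneq x y) => [<-|//] /=.
  by rewrite nth_default // sl memNindex.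
split=> [h [//|m l] [mx lvs]|h m mx].
  rewrite -updE; last by rewrite -(size_map fst vs) -lvs size_map.
  by have /(IH _ uvs) := h _ mx; apply.
apply/(IH _ uvs) => l lvs.
rewrite updE; last by rewrite -(size_map fst vs) -lvs size_map.
by apply: h; rewrite /= mx lvs.
Qed.

(** The auxiliary variable of [Ex1] is fresh, so its value does not influence
    [phi]. *)
Lemma sat_Ex1 v x phi :
  sat v (Ex1 x phi) <->
  exists! m : A, sort_of m = x.1 /\ sat [eta v with x |-> m] phi.
Proof.
rewrite /Ex1; set z := (x.1, _).
have zfresh : z \notin x :: free_vars phi by apply: fresh_notin.
have [zx zphi] : z != x /\ z \notin free_vars phi.
  by move: zfresh; rewrite inE negb_or => /andP.
have phiE m m' : sat [eta [eta v with z |-> m] with x |-> m'] phi =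
                 sat [eta v with x |-> m'] phi.
  apply: sat_free => y yphi /=; case: (y == x) => //.
  by case: (eqVneq y z) => // yz; rewrite -yz yphi in zphi.
rewrite /=; split=> [[m mx h]|[m [[mx phim] um]]].
  have h' m' : sort_of m' = x.1 -> sat [eta v with x |-> m'] phi <-> m' = m.
    move=> m'x; rewrite -(phiE m) h //= !eqxx (negbTE zx).
    by split=> [[a -> ->]|->] //; exists m.
  exists m; split; first by split=> //; apply/h'.
  by move=> m' [m'x] /h' ->.
exists m => // m' m'x; rewrite phiE eqxx (negbTE zx) eqxx; split=> [phim'|[a <- <-] //].
by exists m' => //; apply: um.
Qed.

End Free.
End Basics.

(** * Renaming variables *)

Section Renaming.
Variable Sym : eqType.
Implicit Types (x y z : var Sym) (t u : term Sym) (phi psi : formula Sym).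

Fixpoint rename_term (r : var Sym -> var Sym) t : term Sym :=
  match t with
  | Var x => Var (r x)
  | Cst c => Cst c
  | App f ts => App f (map (rename_term r) ts)
  end.

Lemma eval_rename (S : signature Sym) (A : structure S) (v : var Sym -> A) r t :
  eval v (rename_term r t) = eval (v \o r) t.
Proof.
elim/term_nested_ind: t => [x|c|f ts IH] //=; apply: funext => a.
suff -> : forall2 (eval v) (map (rename_term r) ts) = forall2 (eval (v \o r)) ts by [].
elim: ts IH => //= t ts IHts [IHt IH]; apply: funext => -[|b l] //.
by rewrite IHt IHts.
Qed.

Lemma evals_rename (S : signature Sym) (A : structure S) (v : var Sym -> A) r ts :
  forall2 (eval v) (map (rename_term r) ts) = forall2 (eval (v \o r)) ts.
Proof.
elim: ts => //= t ts IH; apply: funext => -[|b l] //.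
by rewrite eval_rename IH.
Qed.

Lemma has_sort_rename (S : signature Sym) r t s :
  {in term_vars t, forall x, (r x).1 = x.1} ->
  has_sort S t s -> has_sort S (rename_term r t) s.
Proof.
elim/term_nested_ind: t s => [x|c|f ts IH] s //= rP.
  by rewrite rP ?mem_head.
move=> [ar fE arP]; exists ar => //.
elim: ts ar {fE} arP IH rP => [|t ts IHts] [|s0 ar] //= [ts0 tsar] [IHt IH] rP.
split; first by apply: IHt => // x xt; rewrite rP // mem_cat xt.
by apply: IHts => // x xts; rewrite rP // mem_cat xts orbT.
Qed.

Lemma has_sorts_rename (S : signature Sym) r ts ar :
  {in flatten (map (@term_vars Sym) ts), forall x, (r x).1 = x.1} ->
  forall2 (has_sort S) ts ar -> forall2 (has_sort S) (map (rename_term r) ts) ar.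
Proof.
elim: ts ar => [|t ts IH] [|s ar] //= rP [ts0 tsar]; split.
  by apply: has_sort_rename => // x xt; rewrite rP // mem_cat xt.
by apply: IH => // x xts; rewrite rP // mem_cat xts orbT.
Qed.

(** Bound variables are renamed to fresh ones, so that no free variable is
    captured even when [r] is not injective. *)
Lemma rename_formula (S : signature Sym) phi (r : var Sym -> var Sym) :
  is_formula S phi -> {in free_vars phi, forall x, (r x).1 = x.1} ->
  exists2 psi, is_formula S psi &
    forall (S' : signature Sym) (A : structure S') (v : var Sym -> A),
      sat v psi = sat (v \o r) phi.
Proof.
elim: phi r => [t u|p ts|a IH|a IHa b IHb|a IHa b IHb|a IHa b IHb
    |a IHa b IHb|x a IH|x a IH] r /=.
- move=> [s ts us] rP; exists (Eq (rename_term r t) (rename_term r u)).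
    by exists s; apply: has_sort_rename => // x xt; rewrite rP // mem_cat xt ?orbT.
  by move=> S' A v /=; rewrite !eval_rename.
- move=> [ar pE tsar] rP; exists (Atom p (map (rename_term r) ts)).
    by exists ar => //; apply: has_sorts_rename.
  by move=> S' A v /=; rewrite evals_rename.
- move=> fa /(IH _ fa)[psi fpsi psiP]; exists (Not psi) => // S' A v /=.
  by rewrite psiP.
- move=> [fa fb] rP.
  have [y yP|psia fpsia psiaP] := IHa r fa; first by rewrite rP // mem_cat yP.
  have [y yP|psib fpsib psibP] := IHb r fb; first by rewrite rP // mem_cat yP orbT.
  by exists (And psia psib) => // S' A v /=; rewrite psiaP psibP.
- move=> [fa fb] rP.
  have [y yP|psia fpsia psiaP] := IHa r fa; first by rewrite rP // mem_cat yP.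
  have [y yP|psib fpsib psibP] := IHb r fb; first by rewrite rP // mem_cat yP orbT.
  by exists (Or psia psib) => // S' A v /=; rewrite psiaP psibP.
- move=> [fa fb] rP.
  have [y yP|psia fpsia psiaP] := IHa r fa; first by rewrite rP // mem_cat yP.
  have [y yP|psib fpsib psibP] := IHb r fb; first by rewrite rP // mem_cat yP orbT.
  by exists (Imp psia psib) => // S' A v /=; rewrite psiaP psibP.
- move=> [fa fb] rP.
  have [y yP|psia fpsia psiaP] := IHa r fa; first by rewrite rP // mem_cat yP.
  have [y yP|psib fpsib psibP] := IHb r fb; first by rewrite rP // mem_cat yP orbT.
  by exists (Iff psia psib) => // S' A v /=; rewrite psiaP psibP.
all: move=> [xS fa] rP.
all: pose z := (x.1, fresh_index (map r (free_vars a))).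
all: have zr y : y \in free_vars a -> (r y == z) = false;
  first by (move=> ya; apply/negbTE/negP => /eqP ryz; have := map_f r ya;
            rewrite ryz (negbTE (fresh_notin _ _))).
all: have [y ya /=|psi fpsi psiP] := IH [eta r with x |-> z] fa;
  first by case: (eqVneq y x) => [->//|yx]; rewrite rP // mem_filter yx.
- exists (All z psi) => // S' A v /=; apply: eq_forall => m.
  congr (_ -> _); rewrite psiP; apply: sat_free => y ya /=.
  by case: (eqVneq y x) => [_|_]; rewrite ?eqxx ?zr.
- exists (Ex z psi) => // S' A v /=; congr ex2; apply: funext => m.
  rewrite psiP; apply: sat_free => y ya /=.
  by case: (eqVneq y x) => [_|_]; rewrite ?eqxx ?zr.
Qed.

End Renaming.

(** * Relations defined by formulas *)

Section TupleSat.
Variable Sym : eqType.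
Implicit Types (x y z : var Sym) (phi psi : formula Sym) (vs zs : seq (var Sym)).

(** The truth of [phi] depends on the values of its free variables only; if these
    are among [vs], it is a property of the tuple [l] of values of [vs], which
    can be compared across structures and formulas. *)
Definition tuple_sat (S : signature Sym) (A : structure S) vs phi (l : seq A) :=
  exists2 v : var Sym -> A, map v vs = l & sat v phi.

Lemma tuple_satE (S : signature Sym) (A : structure S) vs phi (v : var Sym -> A) :
  {subset free_vars phi <= vs} -> tuple_sat vs phi (map v vs) <-> sat v phi.
Proof.
move=> sub; split=> [[v' vv']|]; last by exists v.
rewrite (@sat_free _ _ _ v' v) // => x /sub xvs.
elim: vs xvs vv' {sub} => //= y vs IH.
by rewrite inE => /orP[/eqP-> []//|xvs [_ /(IH xvs)]].
Qed.

(** The relation defined by [phi] is expressible about any other variables of the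
    right sorts, distinct or not. *)
Lemma tuple_sat_at (S : signature Sym) vs phi zs :
  is_formula S phi -> uniq vs -> map fst zs = map fst vs ->
  {subset free_vars phi <= vs} ->
  exists2 psi, is_formula S psi &
    forall (S' : signature Sym) (A : structure S') (v : var Sym -> A),
      sat v psi <-> tuple_sat vs phi (map v zs).
Proof.
move=> fphi uvs zsvs sub; have szs : size zs = size vs.
  by rewrite -(size_map fst vs) -zsvs size_map.
pose r := updl id vs zs.
have rvs : map r vs = zs.
  exact: map_updl.
have rP : {in free_vars phi, forall x, (r x).1 = x.1}.
  move=> x /sub xvs; rewrite /r /updl -(nth_map _ x.1) ?szs ?index_mem // zsvs.
  by rewrite (nth_map x) ?index_mem // nth_index.
have [psi fpsi psiP] := rename_formula fphi rP.
exists psi => // S' A v.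
by rewrite psiP -(tuple_satE _ sub) map_comp rvs.
Qed.

End TupleSat.

(** * Structures with an isomorphic copy of a structure in a smaller signature *)

Section Expansion.
Variables (Sym : eqType) (S S' : signature Sym).
Variables (A : structure S) (M : structure S') (k : A -> M).
Implicit Types (x y z : var Sym) (phi : formula Sym) (v : var Sym -> A).

(** A structure for the larger signature and its reduct are related in this way,
    and so are a structure for the smaller signature and its expansions. *)
Record identifies_reduct : Prop := IdentifiesReduct {
  ir_sort : forall a, sort_of (k a) = sort_of a;
  ir_inj : injective k;
  ir_surj : forall m, S (sort_of m) = Some Sort -> exists a, k a = m;
  ir_pred : forall p l, S p <> None -> pred_int p (map k l) <-> pred_int p l;
  ir_func : forall f l a, S f <> None ->
    func_int f (map k l) (k a) <-> func_int f l a;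
  ir_const : forall c a, S c <> None -> const_int c (k a) <-> const_int c a
}.

Hypothesis kP : identifies_reduct.
Hypothesis subS : subsig S S'.

Lemma eval_expansion v t s : has_sort S t s ->
  forall m, eval (k \o v) t m <-> exists2 a, m = k a & eval v t a.
Proof.
elim/term_nested_ind: t s => [x|c|f ts IH] s /=.
- by move=> _ m; split=> [<-|[a -> ->]] //; exists (v x).
- move=> cE m; split=> [cm|[a -> ca]]; last by apply/(ir_const kP) => //; rewrite cE.
  have sm := const_intP cm; rewrite (subS cE) in sm; case: sm => sm.
  have [|a am] := @ir_surj kP m.
    by rewrite -sm; apply: (decl_sortsP cE); rewrite /= mem_head.
  by exists a => //; apply/(ir_const kP); rewrite ?cE ?am.
move=> [ar fE tsar] m.
have evals l : forall2 (eval (k \o v)) ts l <-> exists2 l0, l = map k l0 & forall2 (eval v) ts l0.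
  elim: ts ar {fE} tsar l IH => [|t ts IHts] [|s0 ar] //= => [_ [|b l]|[ts0 tsar] [|b l] [IHt IH]].
  - by move=> _; split=> // _; exists [::].
  - by move=> _; split=> // -[[]].
  - by split=> // -[[]].
  split.
    move=> [/(IHt _ ts0)[a -> ta] /(IHts _ tsar _ IH)[l0 -> tsl]].
    by exists (a :: l0).
  move=> [[|a l0] // [-> ->] [ta tsl]]; split; first by apply/(IHt _ ts0); exists a.
  by apply/(IHts _ tsar _ IH); exists l0.
split=> [[l /evals[l0 -> tsl] fl]|[a -> [l0 tsl fl]]].
  have sm := func_intP fl; rewrite (subS fE) in sm; case: sm => _ sm.
  have [|a am] := @ir_surj kP m.
    by rewrite -sm; apply: (decl_sortsP fE); rewrite /= mem_rcons mem_head.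
  exists a => //; exists l0 => //; apply/(ir_func kP); rewrite ?fE ?am //.
exists (map k l0); first by apply/evals; exists l0.
by apply/(ir_func kP) => //; rewrite fE.
Qed.

Lemma evals_expansion v ts ar : forall2 (has_sort S) ts ar ->
  forall l, forall2 (eval (k \o v)) ts l <->
    exists2 l0, l = map k l0 & forall2 (eval v) ts l0.
Proof.
elim: ts ar => [|t ts IH] [|s ar] //= => [_ [|b l]|[ts0 tsar] [|b l]].
- by split=> // _; exists [::].
- by split=> // -[[]].
- by split=> // -[[]].
split.
  move=> [/(eval_expansion _ ts0)[a -> ta] /(IH _ tsar)[l0 -> tsl]].
  by exists (a :: l0).
move=> [[|a l0] // [-> ->] [ta tsl]]; split.
  by apply/(eval_expansion _ ts0); exists a.
by apply/(IH _ tsar); exists l0.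
Qed.

(** Terms of [S] only take values in the image of [k], and quantifiers over sorts
    of [S] range over that image. *)
Lemma sat_expansion phi v :
  is_formula S phi -> sat v phi <-> sat (k \o v) phi.
Proof.
have upd v0 x a : k \o [eta v0 with x |-> a] = [eta k \o v0 with x |-> k a].
  by apply: funext => y /=; case: eqP.
elim: phi v => [t u|p ts|a IH|a IHa b IHb|a IHa b IHb|a IHa b IHb
    |a IHa b IHb|x a IH|x a IH] v /=.
- move=> [s ts us]; split=> [[a ta ua]|].
    by exists (k a); [apply/(eval_expansion _ ts)|apply/(eval_expansion _ us)]; exists a.
  move=> [m /(eval_expansion _ ts)[a -> ta] /(eval_expansion _ us)[b /(ir_inj kP) <- ub]].
  by exists a.
- move=> [ar pE tsar]; split=> [[l tsl pl]|].
    exists (map k l); first by apply/(evals_expansion _ tsar); exists l.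
    by apply/(ir_pred kP) => //; rewrite pE.
  move=> [l /(evals_expansion _ tsar)[l0 -> tsl] /(ir_pred kP) pl].
  by exists l0 => //; apply: pl; rewrite pE.
- by move=> fa; rewrite -IH.
1-4: by move=> [fa fb]; rewrite -IHa // -IHb.
- move=> [xS fa]; split=> h m mx.
    have [|a0 am] := @ir_surj kP m; first by rewrite mx.
    by rewrite -am -upd -IH //; apply: h; rewrite -(ir_sort kP) am.
  by rewrite IH // upd; apply: h; rewrite (ir_sort kP).
- move=> [xS fa]; split=> -[m mx h].
    by exists (k m); rewrite ?(ir_sort kP) // -upd -IH.
  have [|a0 am] := @ir_surj kP m; first by rewrite mx.
  by exists a0; rewrite -?(ir_sort kP) ?am // IH // upd am.
Qed.

Lemma tuple_sat_expansion (vs : seq (var Sym)) phi l :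
  formula_in S vs phi -> uniq vs -> size l = size vs ->
  tuple_sat vs phi l <-> tuple_sat vs phi (map k l).
Proof.
move=> [fphi sub] uvs sl.
have [v0 _] := assignment_exists A; have lE := map_updl v0 uvs sl.
rewrite -{1}lE tuple_satE // (sat_expansion _ fphi) -(tuple_satE _ sub).
by rewrite map_comp lE.
Qed.

End Expansion.

(** * The content of an explicit definition *)

Section Shapes.
Variable Sym : eqType.
Implicit Types (x y z : var Sym) (phi psi : formula Sym) (vs : seq (var Sym)).

(** The data of an explicit definition without the accidents of its syntax.
    Predicates, functions and constants are treated alike, as relations: the
    first argument of [ShGraph] is the defined symbol, and the graph of this
    symbol is defined by a formula in the given variables. *)
Inductive defshape : Type :=
| ShGraph of Sym & seq (var Sym) & formula Sym
| ShProduct of Sym & Sym & Sym & Sym & Sym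
| ShCoproduct of Sym & Sym & Sym & Sym & Sym
| ShSubsort of Sym & Sym & Sym & var Sym & formula Sym
| ShQuotient of Sym & Sym & Sym & var Sym & var Sym & formula Sym
| ShNone.

Fixpoint strip_alls phi : seq (var Sym) * formula Sym :=
  match phi with
  | All x a => let (vs, b) := strip_alls a in (x :: vs, b)
  | _ => ([::], phi)
  end.

(** The shape is a function of the sentence alone: the definitions of a sort
    and of its accompanying functions, which share their sentence, therefore
    agree on all the data. *)
Definition shape_of phi : defshape :=
  let (vs, body) := strip_alls phi in
  match vs, body with
  | _, Iff (Atom p _) psi => ShGraph p vs psi
  | _, Iff (Eq (App f _) _) psi => ShGraph f vs psi
  | _, Iff (Eq _ (Cst c)) psi => ShGraph c vs psi
  | [:: x; y], Ex _ (All z (Iff (And (Eq (App pi1 _) _) (Eq (App pi2 _) _)) _))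
    => ShProduct z.1 x.1 y.1 pi1 pi2
  | _, And (All z (Or _ _)) (All x (All y (Not (Eq (App r1 _) (App r2 _)))))
    => ShCoproduct z.1 x.1 y.1 r1 r2
  | _, And (All x (Iff psi (Ex z (Eq (App i _) _)))) _
    => ShSubsort z.1 x.1 i x psi
  | _, And (All x1 (All x2 (Iff (Eq (App eps _) _) psi))) (All z _)
    => ShQuotient z.1 x1.1 eps x1 x2 psi
  | _, _ => ShNone
  end.

Lemma strip_alls_Iff vs phi psi :
  strip_alls (alls vs (Iff phi psi)) = (vs, Iff phi psi).
Proof. by elim: vs => //= x vs ->. Qed.

Definition graph (S : signature Sym) (A : structure S) (p : Sym) (l : seq A) : Prop :=
  match S p with
  | Some (Pred _) => pred_int p l
  | Some (Func _ _) => exists l0 a, l = rcons l0 a /\ func_int p l0 a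
  | Some (Const _) => exists2 a, l = [:: a] & const_int p a
  | _ => False
  end.

Lemma graph_pred (S : signature Sym) (A : structure S) p ar (l : seq A) :
  S p = Some (Pred ar) -> graph p l <-> pred_int p l.
Proof. by rewrite /graph => ->. Qed.

Lemma graph_func (S : signature Sym) (A : structure S) f ar s (l : seq A) a :
  S f = Some (Func ar s) -> graph f (rcons l a) <-> func_int f l a.
Proof.
rewrite /graph => ->; split=> [[l0 [b [/rcons_inj[-> ->]]]]|] //.
by exists l, a.
Qed.

Lemma graph_const (S : signature Sym) (A : structure S) c s (a : A) :
  S c = Some (Const s) -> graph c [:: a] <-> const_int c a.
Proof. by rewrite /graph => ->; split=> [[b [->]]|] //; exists a. Qed.

Section Meaning.
Variables S S' : signature Sym.

Inductive shape_wf : seq Sym -> defshape -> Prop :=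
| WfGraph p d vs phi of
    S p = None & S' p = Some d & d <> Sort & map fst vs = decl_sorts d &
    (forall s, s \in decl_sorts d -> S s = Some Sort) &
    uniq vs & formula_in S vs phi :
  shape_wf [:: p] (ShGraph p vs phi)
| WfProduct s s1 s2 pi1 pi2 of
    S s = None & S' s = Some Sort & S s1 = Some Sort & S s2 = Some Sort &
    S pi1 = None & S' pi1 = Some (Func [:: s] s1) &
    S pi2 = None & S' pi2 = Some (Func [:: s] s2) & pi1 != pi2 :
  shape_wf [:: s; pi1; pi2] (ShProduct s s1 s2 pi1 pi2)
| WfCoproduct s s1 s2 r1 r2 of
    S s = None & S' s = Some Sort & S s1 = Some Sort & S s2 = Some Sort &
    S r1 = None & S' r1 = Some (Func [:: s1] s) &
    S r2 = None & S' r2 = Some (Func [:: s2] s) & r1 != r2 :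
  shape_wf [:: s; r1; r2] (ShCoproduct s s1 s2 r1 r2)
| WfSubsort s s1 i x phi of
    S s = None & S' s = Some Sort & S s1 = Some Sort &
    S i = None & S' i = Some (Func [:: s] s1) &
    x.1 = s1 & formula_in S [:: x] phi :
  shape_wf [:: s; i] (ShSubsort s s1 i x phi)
| WfQuotient s s1 eps x1 x2 phi of
    S s = None & S' s = Some Sort & S s1 = Some Sort &
    S eps = None & S' eps = Some (Func [:: s1] s) &
    x1.1 = s1 & x2.1 = s1 & x1 != x2 & formula_in S [:: x1; x2] phi :
  shape_wf [:: s; eps] (ShQuotient s s1 eps x1 x2 phi).

Definition shape_true (M : structure S') (sh : defshape) : Prop :=
  match sh with
  | ShGraph x vs phi =>
      forall l : seq M, map (@sort_of _ _ M) l = map fst vs ->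
        (graph x l <-> tuple_sat vs phi l)
  | ShProduct s s1 s2 pi1 pi2 =>
      forall a b : M, sort_of a = s1 -> sort_of b = s2 ->
      exists! c : M, sort_of c = s /\ func_int pi1 [:: c] a /\ func_int pi2 [:: c] b
  | ShCoproduct s s1 s2 r1 r2 =>
      (forall c : M, sort_of c = s ->
        (exists! a : M, sort_of a = s1 /\ func_int r1 [:: a] c) \/
        (exists! b : M, sort_of b = s2 /\ func_int r2 [:: b] c)) /\
      (forall a b : M, sort_of a = s1 -> sort_of b = s2 ->
        ~ exists2 c, func_int r1 [:: a] c & func_int r2 [:: b] c)
  | ShSubsort s s1 i x phi =>
      (forall a : M, sort_of a = s1 ->
        (tuple_sat [:: x] phi [:: a] <->
         exists2 c : M, sort_of c = s & func_int i [:: c] a)) /\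
      (forall c d : M, sort_of c = s -> sort_of d = s ->
        (exists2 a, func_int i [:: c] a & func_int i [:: d] a) -> c = d)
  | ShQuotient s s1 eps x1 x2 phi =>
      (forall a b : M, sort_of a = s1 -> sort_of b = s1 ->
        ((exists2 c, func_int eps [:: a] c & func_int eps [:: b] c) <->
         tuple_sat [:: x1; x2] phi [:: a; b])) /\
      (forall c : M, sort_of c = s ->
        exists2 a : M, sort_of a = s1 & func_int eps [:: a] c)
  | ShNone => False
  end.

(** For relations, admissibility says that a formula that is to define a function
    or a constant is functional. *)
Definition shape_admissible (A : structure S) (sh : defshape) : Prop :=
  match sh with
  | ShGraph x vs phi =>
      match S' x with
      | Some (Func ar s) =>
          forall l : seq A, map (@sort_of _ _ A) l = ar ->
          exists! a : A, sort_of a = s /\ tuple_sat vs phi (rcons l a)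
      | Some (Const s) =>
          exists! a : A, sort_of a = s /\ tuple_sat vs phi [:: a]
      | _ => True
      end
  | ShSubsort s s1 i x phi =>
      exists2 a : A, sort_of a = s1 & tuple_sat [:: x] phi [:: a]
  | ShQuotient s s1 eps x1 x2 phi =>
      let R (a b : A) := tuple_sat [:: x1; x2] phi [:: a; b] in
      [/\ forall a : A, sort_of a = s1 -> R a a,
          forall a b : A, sort_of a = s1 -> sort_of b = s1 -> R a b -> R b a
        & forall a b c : A, sort_of a = s1 -> sort_of b = s1 -> sort_of c = s1 ->
            R a b -> R b c -> R a c]
  | _ => True
  end.

Section Sat.
Variables (T : signature Sym) (A : structure T).
Implicit Types v : var Sym -> A.

Lemma evals_vars v vs l : forall2 (eval v) (map (@Var Sym) vs) l <-> l = map v vs.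
Proof. by rewrite forall2_map1 forall2_fun. Qed.

Lemma sat_Eq_App_Var v f vs y :
  sat v (Eq (App f (map (@Var Sym) vs)) (Var y)) <-> func_int f (map v vs) (v y).
Proof.
split=> /= [[a [l /evals_vars -> fa] ->]|fy] //.
by exists (v y) => //; exists (map v vs) => //; apply/evals_vars.
Qed.

Lemma sat_Eq_App_App v f g x y :
  sat v (Eq (App f [:: Var x]) (App g [:: Var y])) <->
  exists2 a, func_int f [:: v x] a & func_int g [:: v y] a.
Proof.
split=> /= [[a [l /(evals_vars _ [:: x])-> fa] [l' /(evals_vars _ [:: y])-> ga]]|[a fa ga]].
  by exists a.
by exists a; [exists [:: v x]|exists [:: v y]].
Qed.

Lemma sat_inst2 v x y phi u w :
  x != y -> u \notin [:: x; y] -> w \notin [:: x; y] ->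
  {subset free_vars phi <= [:: x; y]} ->
  sort_of (v u) = x.1 -> sort_of (v w) = y.1 ->
  sat v (inst2 x y phi u w) <-> tuple_sat [:: x; y] phi [:: v u; v w].
Proof.
rewrite !inE !negb_or => xy /andP[ux uy] /andP[wx wy] sub su sw.
rewrite /= !eqxx (negbTE xy) (negbTE ux) (negbTE uy) (negbTE wx) (negbTE wy).
have satE : sat [eta [eta v with x |-> v u] with y |-> v w] phi <->
    tuple_sat [:: x; y] phi [:: v u; v w].
  by rewrite -(tuple_satE _ sub) /= !eqxx (negbTE xy).
split=> [[a _ [b _ [[[a' -> <-] [b' -> <-]] /satE]]]|/satE h] //.
by exists (v u) => //; exists (v w) => //; split=> //; split; eexists.
Qed.

End Sat.

(** All that the sequel uses of the syntax of a definition: which symbols it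
    concerns, which structures satisfy it, and what its admissibility means. *)
Definition defines defined phi (adm : formula Sym -> Prop) : Prop :=
  [/\ shape_wf defined (shape_of phi),
      forall M : structure S',
        (forall v : var Sym -> M, sat v phi) <-> shape_true M (shape_of phi)
    & forall A : structure S, (forall psi, adm psi -> holds A psi) ->
        shape_admissible A (shape_of phi)].

End Meaning.
End Shapes.

Section ExplicitDefinitions.
Variables (Sym : eqType) (S S' : signature Sym).
Implicit Types (x y z : var Sym) (phi psi : formula Sym) (vs : seq (var Sym)).

Lemma sat_graph_definition (M : structure S') p alpha vs phi :
  uniq vs -> {subset free_vars phi <= vs} ->
  (forall v : var Sym -> M, sat v alpha <-> graph p (map v vs)) ->
  (forall v : var Sym -> M, sat v (alls vs (Iff alpha phi))) <->
  shape_true M (ShGraph p vs phi).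
Proof.
move=> uvs sub alphaP; split=> [h l lvs|h v].
  have [v _] := assignment_exists M; have := h v.
  move/(sat_alls _ _ uvs) => /(_ l lvs) /=.
  rewrite alphaP -(tuple_satE _ sub) map_updl //.
  by rewrite -(size_map fst vs) -lvs size_map.
apply/(sat_alls _ _ uvs) => l lvs /=.
rewrite alphaP -(tuple_satE _ sub) map_updl; [exact: h|done|].
by rewrite -(size_map fst vs) -lvs size_map.
Qed.

Lemma shape_of_graph p vs phi :
  (forall ts, shape_of (alls vs (Iff (Atom p ts) phi)) = ShGraph p vs phi) /\
  (forall ts y, shape_of (alls vs (Iff (Eq (App p ts) (Var y)) phi)) = ShGraph p vs phi) /\
  (forall y, shape_of (alls vs (Iff (Eq (Var y) (Cst p)) phi)) = ShGraph p vs phi).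
Proof.
by rewrite /shape_of; split; [|split] => *; rewrite strip_alls_Iff; case: vs => [|? [|? []]].
Qed.

Lemma explicit_def_pred p ar vs phi :
  S p = None -> S' p = Some (Pred ar) ->
  (forall s, s \in ar -> S s = Some Sort) ->
  map fst vs = ar -> uniq vs -> formula_in S vs phi ->
  defines S S' [:: p] (alls vs (Iff (Atom p (map (@Var Sym) vs)) phi)) set0.
Proof.
move=> Sp S'p arS vsar uvs phivs; have [fphi sub] := phivs.
rewrite /defines (proj1 (shape_of_graph _ _ _)); split.
- by apply: WfGraph S'p _ _ _ _ _.
- move=> M; apply: sat_graph_definition => // v.
  rewrite (graph_pred _ S'p) /=; split=> [[l /evals_vars -> //]|pl].
  by exists (map v vs) => //; apply/evals_vars.
- by move=> A _ /=; rewrite S'p.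
Qed.

Lemma explicit_def_func f ar s vs y phi :
  S f = None -> S' f = Some (Func ar s) ->
  (forall s', s' \in ar -> S s' = Some Sort) -> S s = Some Sort ->
  map fst vs = ar -> y.1 = s -> uniq (rcons vs y) ->
  formula_in S (rcons vs y) phi ->
  defines S S' [:: f]
    (alls (rcons vs y) (Iff (Eq (App f (map (@Var Sym) vs)) (Var y)) phi))
    (fun psi => psi = alls vs (Ex1 y phi)).
Proof.
move=> Sf S'f arS sS vsar ys uvs phivs; have [fphi sub] := phivs.
have [yvs uvs'] : y \notin vs /\ uniq vs by move: uvs; rewrite rcons_uniq => /andP.
rewrite /defines (proj1 (proj2 (shape_of_graph _ _ _))); split.
- apply: WfGraph S'f _ _ _ _ _ => //=; first by rewrite map_rcons vsar ys.
  by move=> s'; rewrite mem_rcons inE => /predU1P[->|/arS].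
- move=> M; apply: sat_graph_definition => // v.
  by rewrite map_rcons (graph_func _ _ S'f) sat_Eq_App_Var.
- move=> A /(_ _ erefl) h /=; rewrite S'f => l lar.
  have [v0 v0P] := assignment_exists A.
  have := h v0 v0P; rewrite sat_alls // => /(_ l).
  rewrite lar vsar => /(_ erefl) /sat_Ex1.
  set v := updl v0 vs l.
  have mapE a : map [eta v with y |-> a] (rcons vs y) = rcons l a.
    rewrite map_rcons /= eqxx -[in RHS](@map_updl _ _ v0 vs l) //.
      congr rcons; apply/eq_in_map => x xvs /=.
      by case: (eqVneq x y) => // xy; rewrite -xy xvs in yvs.
    by rewrite -(size_map fst vs) vsar -lar size_map.
  have satE a : sat [eta v with y |-> a] phi <-> tuple_sat (rcons vs y) phi (rcons l a).
    by rewrite -(tuple_satE _ sub) mapE.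
  move=> [a [[ay /satE ha] ua]]; exists a; split; first by rewrite -ys.
  by move=> b [bs hb]; apply: ua; rewrite ys; split=> //; apply/satE.
Qed.

Lemma explicit_def_const c s y psi :
  S c = None -> S' c = Some (Const s) -> S s = Some Sort ->
  y.1 = s -> formula_in S [:: y] psi ->
  defines S S' [:: c] (All y (Iff (Eq (Var y) (Cst c)) psi))
    (fun chi => chi = Ex1 y psi).
Proof.
move=> Sc S'c sS ys psiy; have [fpsi sub] := psiy.
have dE : All y (Iff (Eq (Var y) (Cst c)) psi) =
          alls [:: y] (Iff (Eq (Var y) (Cst c)) psi) by [].
rewrite /defines dE (proj2 (proj2 (shape_of_graph _ _ _))); split.
- apply: WfGraph S'c _ _ _ _ _ => //=; first by rewrite ys.
  by move=> s'; rewrite inE => /eqP->.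
- move=> M; apply: sat_graph_definition => // v.
  by rewrite (graph_const _ S'c) /=; split=> [[a <-]|cy] //; exists (v y).
- move=> A /(_ _ erefl) h /=; rewrite S'c.
  have [v vP] := assignment_exists A.
  have satE a : sat [eta v with y |-> a] psi <-> tuple_sat [:: y] psi [:: a].
    by rewrite -(tuple_satE _ sub) /= eqxx.
  have /sat_Ex1[a [[ay /satE ha] ua]] := h v vP.
  exists a; split; first by rewrite -ys.
  by move=> b [bs hb]; apply: ua; rewrite ys; split=> //; apply/satE.
Qed.

Lemma explicit_def_product s s1 s2 pi1 pi2 x y z :
  S s = None -> S' s = Some Sort -> S s1 = Some Sort -> S s2 = Some Sort ->
  S pi1 = None -> S' pi1 = Some (Func [:: s] s1) ->
  S pi2 = None -> S' pi2 = Some (Func [:: s] s2) -> pi1 != pi2 ->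
  x.1 = s1 -> y.1 = s2 -> z.1 = s -> x != y ->
  defines S S' [:: s; pi1; pi2]
    (All x (All y (Ex1 z (And (Eq (App pi1 [:: Var z]) (Var x))
                              (Eq (App pi2 [:: Var z]) (Var y))))))
    set0.
Proof.
move=> Ss S's Ss1 Ss2 Sp1 S'p1 Sp2 S'p2 p12 xs1 ys2 zs xy.
rewrite /defines.
have -> : shape_of (All x (All y (Ex1 z (And (Eq (App pi1 [:: Var z]) (Var x))
                              (Eq (App pi2 [:: Var z]) (Var y)))))) =
          ShProduct s s1 s2 pi1 pi2 by rewrite -xs1 -ys2 -zs.
have xz : (x == z) = false by apply/eqP => xz; rewrite -zs -xz xs1 Ss1 in Ss.
have yz : (y == z) = false by apply/eqP => yz; rewrite -zs -yz ys2 Ss2 in Ss.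
split=> //; first exact: WfProduct.
move=> M.
have satE (v : var Sym -> M) a b c :
    let w := [eta [eta [eta v with x |-> a] with y |-> b] with z |-> c] in
    sat w (And (Eq (App pi1 [:: Var z]) (Var x)) (Eq (App pi2 [:: Var z]) (Var y)))
    <-> func_int pi1 [:: c] a /\ func_int pi2 [:: c] b.
  move=> w; have := sat_Eq_App_Var w pi1 [:: z] x.
  have := sat_Eq_App_Var w pi2 [:: z] y.
  by rewrite /= !eqxx xz yz (negbTE xy) => <- <-.
split=> [h a b as1 bs2|h v a as1 b bs2].
  have [v _] := assignment_exists M.
  have /sat_Ex1[c [[cs /satE hc] uc]] := h v a (etrans as1 (esym xs1)) b (etrans bs2 (esym ys2)).
  exists c; split; first by rewrite -zs.
  by move=> d [ds hd]; apply: uc; rewrite zs; split=> //; apply/satE.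
apply/sat_Ex1; rewrite xs1 in as1; rewrite ys2 in bs2.
have [c [[cs hc] uc]] := h a b as1 bs2.
exists c; split; first by rewrite zs; split=> //; apply/satE.
by move=> d [ds /satE hd]; apply: uc; rewrite -zs.
Qed.

Lemma explicit_def_coproduct s s1 s2 r1 r2 x y z :
  S s = None -> S' s = Some Sort -> S s1 = Some Sort -> S s2 = Some Sort ->
  S r1 = None -> S' r1 = Some (Func [:: s1] s) ->
  S r2 = None -> S' r2 = Some (Func [:: s2] s) -> r1 != r2 ->
  x.1 = s1 -> y.1 = s2 -> z.1 = s -> x != y ->
  defines S S' [:: s; r1; r2]
    (And (All z (Or (Ex1 x (Eq (App r1 [:: Var x]) (Var z)))
                    (Ex1 y (Eq (App r2 [:: Var y]) (Var z)))))
         (All x (All y (Not (Eq (App r1 [:: Var x]) (App r2 [:: Var y]))))))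
    set0.
Proof.
move=> Ss S's Ss1 Ss2 Sr1 S'r1 Sr2 S'r2 r12 xs1 ys2 zs xy.
rewrite /defines.
set phi := And _ _.
have -> : shape_of phi = ShCoproduct s s1 s2 r1 r2 by rewrite -xs1 -ys2 -zs.
have zx : (z == x) = false by apply/eqP => zx; rewrite -zs zx xs1 Ss1 in Ss.
have zy : (z == y) = false by apply/eqP => zy; rewrite -zs zy ys2 Ss2 in Ss.
split=> //; first exact: WfCoproduct.
move=> M.
have Ex1E (v : var Sym -> M) c r x0 s0 : x0.1 = s0 -> (z == x0) = false ->
    sat [eta v with z |-> c] (Ex1 x0 (Eq (App r [:: Var x0]) (Var z))) <->
    exists! a : M, sort_of a = s0 /\ func_int r [:: a] c.
  move=> <- zx0; rewrite sat_Ex1.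
  have satE a : sat [eta [eta v with z |-> c] with x0 |-> a]
      (Eq (App r [:: Var x0]) (Var z)) <-> func_int r [:: a] c.
    have := sat_Eq_App_Var [eta [eta v with z |-> c] with x0 |-> a] r [:: x0] z.
    by rewrite /= !eqxx zx0 => <-.
  split=> -[a [[as0 ha] ua]]; exists a; split.
  - by split=> //; apply/satE.
  - by move=> b [bs /satE hb]; apply: ua.
  - by split=> //; apply/satE.
  - by move=> b [bs hb]; apply: ua; split=> //; apply/satE.
have disjE (v : var Sym -> M) a b :
    sat [eta [eta v with x |-> a] with y |-> b] (Eq (App r1 [:: Var x]) (App r2 [:: Var y]))
    <-> exists2 c, func_int r1 [:: a] c & func_int r2 [:: b] c.
  have := sat_Eq_App_App [eta [eta v with x |-> a] with y |-> b] r1 r2 x y.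
  by rewrite /= !eqxx (negbTE xy) => <-.
split=> [h|[h1 h2] v].
  have [v _] := assignment_exists M; have [h1 h2] := h v; split.
    move=> c cs; have := h1 c (etrans cs (esym zs)).
    by case=> [/(Ex1E _ _ _ _ _ xs1 zx)|/(Ex1E _ _ _ _ _ ys2 zy)]; [left|right].
  move=> a b as1 bs2 /(disjE v).
  exact: (h2 a (etrans as1 (esym xs1)) b (etrans bs2 (esym ys2))).
split=> [c cs|a as1 b bs2].
  rewrite zs in cs; case: (h1 c cs) => h; [left|right].
    exact/(Ex1E _ _ _ _ _ xs1 zx).
  exact/(Ex1E _ _ _ _ _ ys2 zy).
rewrite xs1 in as1; rewrite ys2 in bs2.
by move/disjE; apply: h2.
Qed.

Lemma explicit_def_subsort s s1 i x z z1 z2 phi :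
  S s = None -> S' s = Some Sort -> S s1 = Some Sort ->
  S i = None -> S' i = Some (Func [:: s] s1) ->
  x.1 = s1 -> z.1 = s -> z1.1 = s -> z2.1 = s -> z1 != z2 ->
  formula_in S [:: x] phi ->
  defines S S' [:: s; i]
    (And (All x (Iff phi (Ex z (Eq (App i [:: Var z]) (Var x)))))
         (All z1 (All z2 (Imp (Eq (App i [:: Var z1]) (App i [:: Var z2]))
                              (Eq (Var z1) (Var z2))))))
    (fun psi => psi = Ex x phi).
Proof.
move=> Ss S's Ss1 Si S'i xs1 zs z1s z2s z12 phix; have [fphi sub] := phix.
rewrite /defines; set delta := And _ _.
have -> : shape_of delta = ShSubsort s s1 i x phi by rewrite -xs1 -zs.
have xz : (x == z) = false by apply/eqP => xz; rewrite -zs -xz xs1 Ss1 in Ss.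
have phiE (T : signature Sym) (A : structure T) (v : var Sym -> A) a :
    sat [eta v with x |-> a] phi <-> tuple_sat [:: x] phi [:: a].
  by rewrite -(tuple_satE _ sub) /= eqxx.
split=> //; first exact: WfSubsort.
  move=> M.
  have exE (v : var Sym -> M) a c :
      sat [eta [eta v with x |-> a] with z |-> c] (Eq (App i [:: Var z]) (Var x)) <->
      func_int i [:: c] a.
    have := sat_Eq_App_Var [eta [eta v with x |-> a] with z |-> c] i [:: z] x.
    by rewrite /= !eqxx xz => <-.
  have injE (v : var Sym -> M) c d :
      sat [eta [eta v with z1 |-> c] with z2 |-> d]
        (Eq (App i [:: Var z1]) (App i [:: Var z2])) <->
      exists2 a, func_int i [:: c] a & func_int i [:: d] a.
    have := sat_Eq_App_App [eta [eta v with z1 |-> c] with z2 |-> d] i i z1 z2.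
    by rewrite /= !eqxx (negbTE z12) => <-.
  split=> [h|[h1 h2] v].
    have [v _] := assignment_exists M; have [h1 h2] := h v; split.
      move=> a as1; rewrite -(phiE _ _ v).
      apply: (iff_trans (h1 a (etrans as1 (esym xs1)))).
      split=> [[c cs /exE ca]|[c cs ca]]; first by exists c; rewrite // cs.
      by exists c; [rewrite zs|apply/exE].
    move=> c d cs ds /(injE v) e.
    have := h2 c (etrans cs (esym z1s)) d (etrans ds (esym z2s)) e.
    by move=> /= [a]; rewrite !eqxx (negbTE z12) => ->.
  split=> [a as1|c cs d ds].
    rewrite xs1 in as1.
    apply: (iff_trans (phiE _ _ v a)); apply: (iff_trans (h1 a as1)).
    split=> [[c cs ca]|[c cs /exE ca]]; last by exists c; rewrite // cs.
    by exists c; [rewrite zs|apply/exE].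
  rewrite z1s in cs; rewrite z2s in ds.
  by move=> /injE/(h2 c d cs ds) -> /=; rewrite !eqxx (negbTE z12); exists d.
move=> A /(_ _ erefl) h /=; have [v vP] := assignment_exists A.
by have [a as1 /phiE ha] := h v vP; exists a; rewrite -?xs1.
Qed.

Lemma explicit_def_quotient s s1 eps x x1 x2 z phi :
  S s = None -> S' s = Some Sort -> S s1 = Some Sort ->
  S eps = None -> S' eps = Some (Func [:: s1] s) ->
  x.1 = s1 -> x1.1 = s1 -> x2.1 = s1 -> z.1 = s -> x1 != x2 ->
  formula_in S [:: x1; x2] phi ->
  defines S S' [:: s; eps]
    (And (All x1 (All x2 (Iff (Eq (App eps [:: Var x1]) (App eps [:: Var x2]))
                              phi)))
         (All z (Ex x (Eq (App eps [:: Var x]) (Var z)))))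
    (equivalence_conditions x1 x2 phi).
Proof.
move=> Ss S's Ss1 Se S'e xs1 x1s1 x2s1 zs x12 phix; have [fphi sub] := phix.
rewrite /defines; set delta := And _ _.
have -> : shape_of delta = ShQuotient s s1 eps x1 x2 phi by rewrite -x1s1 -zs.
have zx : (z == x) = false by apply/eqP => zx; rewrite -zs zx xs1 Ss1 in Ss.
split=> //; first exact: WfQuotient.
  move=> M.
  have phiE (v : var Sym -> M) a b :
      sat [eta [eta v with x1 |-> a] with x2 |-> b] phi <->
      tuple_sat [:: x1; x2] phi [:: a; b].
    by rewrite -(tuple_satE _ sub) /= !eqxx (negbTE x12).
  have eqE (v : var Sym -> M) a b :
      sat [eta [eta v with x1 |-> a] with x2 |-> b]
        (Eq (App eps [:: Var x1]) (App eps [:: Var x2])) <->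
      exists2 c, func_int eps [:: a] c & func_int eps [:: b] c.
    have := sat_Eq_App_App [eta [eta v with x1 |-> a] with x2 |-> b] eps eps x1 x2.
    by rewrite /= !eqxx (negbTE x12) => <-.
  have surjE (v : var Sym -> M) c a :
      sat [eta [eta v with z |-> c] with x |-> a] (Eq (App eps [:: Var x]) (Var z)) <->
      func_int eps [:: a] c.
    have := sat_Eq_App_Var [eta [eta v with z |-> c] with x |-> a] eps [:: x] z.
    by rewrite /= !eqxx zx => <-.
  split=> [h|[h1 h2] v].
    have [v _] := assignment_exists M; have [h1 h2] := h v; split.
      move=> a b as1 bs1; rewrite -(eqE v) -(phiE v).
      exact: (h1 a (etrans as1 (esym x1s1)) b (etrans bs1 (esym x2s1))).
    move=> c cs; have [a ax /surjE ac] := h2 c (etrans cs (esym zs)).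
    by exists a; rewrite -?xs1.
  split=> [a as1 b bs1|c cs].
    rewrite x1s1 in as1; rewrite x2s1 in bs1.
    change (sat [eta [eta v with x1 |-> a] with x2 |-> b]
      (Eq (App eps [:: Var x1]) (App eps [:: Var x2])) <->
      sat [eta [eta v with x1 |-> a] with x2 |-> b] phi).
    by rewrite eqE phiE; apply: h1.
  rewrite zs in cs; have [a as1 ac] := h2 c cs.
  by exists a; rewrite ?xs1 //; apply/surjE.
move=> A h /=; have [v vP] := assignment_exists A.
pose n := fresh_index [:: x1; x2].
pose u := (x1.1, n); pose w := (x1.1, n.+1); pose t := (x1.1, n.+2).
have uf : u \notin [:: x1; x2] by apply: fresh_notin.
have wf : w \notin [:: x1; x2] by apply: fresh_notin; apply: leqnSn.
have tf : t \notin [:: x1; x2] by apply: fresh_notin; rewrite -addn2 leq_addr.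
have neq m k : m != k -> ((x1.1, m) == (x1.1, k) :> var Sym) = false.
  by move=> mk; rewrite xpair_eqE (negbTE mk) andbF.
have uw : (u == w) = false by apply: neq; rewrite neq_ltn leqnn.
have ut : (u == t) = false by apply: neq; rewrite neq_ltn leqnSn.
have wt : (w == t) = false by apply: neq; rewrite neq_ltn leqnn.
have RE (v' : var Sym -> A) p q a b : p \notin [:: x1; x2] -> q \notin [:: x1; x2] ->
    v' p = a -> v' q = b -> sort_of a = s1 -> sort_of b = s1 ->
    sat v' (inst2 x1 x2 phi p q) <-> tuple_sat [:: x1; x2] phi [:: a; b].
  by move=> pf qf <- <- ps qs; apply: sat_inst2; rewrite // ?x1s1 ?x2s1.
have h1 := h _ (or_introl (or_introl erefl)) v vP.
have h2 := h _ (or_introl (or_intror erefl)) v vP.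
have h3 := h _ (or_intror erefl) v vP.
have to_x1 (a : A) : sort_of a = s1 -> sort_of a = x1.1 by rewrite x1s1.
split=> [a as1|a b as1 bs1|a b c as1 bs1 cs1].
- have vu : [eta v with u |-> a] u = a by rewrite /= eqxx.
  apply/(RE [eta v with u |-> a] u u a a uf uf vu vu as1 as1).
  exact: (h1 a (to_x1 a as1)).
- pose v' := [eta [eta v with u |-> a] with w |-> b].
  have vu : v' u = a by rewrite /= eqxx uw.
  have vw : v' w = b by rewrite /= eqxx.
  move=> /(RE v' u w a b uf wf vu vw as1 bs1) Ruw.
  apply/(RE v' w u b a wf uf vw vu bs1 as1).
  exact: (h2 a (to_x1 a as1) b (to_x1 b bs1) Ruw).
- pose v' := [eta [eta [eta v with u |-> a] with w |-> b] with t |-> c].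
  have vu : v' u = a by rewrite /= eqxx ut uw.
  have vw : v' w = b by rewrite /= eqxx wt.
  have vt : v' t = c by rewrite /= eqxx.
  move=> /(RE v' u w a b uf wf vu vw as1 bs1) Ruw.
  move=> /(RE v' w t b c wf tf vw vt bs1 cs1) Rwt.
  apply/(RE v' u t a c uf tf vu vt as1 cs1).
  exact: (h3 a (to_x1 a as1) b (to_x1 b bs1) c (to_x1 c cs1) (conj Ruw Rwt)).
Qed.

Lemma explicit_def_defines defined phi adm :
  explicit_def S S' defined phi adm -> defines S S' defined phi adm.
Proof.
case.
- by move=> p ar vs psi h1 h2 h3 h4 h5 h6; apply: explicit_def_pred h1 h2 h3 h4 h5 h6.
- move=> f ar s vs y psi h1 h2 h3 h4 h5 h6 h7 h8.
  exact: explicit_def_func h1 h2 h3 h4 h5 h6 h7 h8.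
- by move=> c s y psi h1 h2 h3 h4 h5; apply: explicit_def_const h1 h2 h3 h4 h5.
- move=> s s1 s2 pi1 pi2 x y z h1 h2 h3 h4 h5 h6 h7 h8 h9 h10 h11 h12 h13.
  exact: explicit_def_product h1 h2 h3 h4 h5 h6 h7 h8 h9 h10 h11 h12 h13.
- move=> s s1 s2 r1 r2 x y z h1 h2 h3 h4 h5 h6 h7 h8 h9 h10 h11 h12 h13.
  exact: explicit_def_coproduct h1 h2 h3 h4 h5 h6 h7 h8 h9 h10 h11 h12 h13.
- move=> s s1 i x z z1 z2 psi h1 h2 h3 h4 h5 h6 h7 h8 h9 h10 h11.
  exact: explicit_def_subsort h1 h2 h3 h4 h5 h6 h7 h8 h9 h10 h11.
- move=> s s1 eps x x1 x2 z psi h1 h2 h3 h4 h5 h6 h7 h8 h9 h10 h11.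
  exact: explicit_def_quotient h1 h2 h3 h4 h5 h6 h7 h8 h9 h10 h11.
Qed.

End ExplicitDefinitions.

(** * Coding the elements of the new sorts *)

Section Extension.
Variables (Sym : eqType) (S S' : signature Sym) (T : theory S) (T' : theory S').
Variable def : Sym -> defshape Sym.
Implicit Types (x y z : var Sym) (phi psi : formula Sym) (xs ys zs vs : seq (var Sym)).

(** The possible definitions of a new sort; the accompanying functions have the
    same definition as their sort. *)
Inductive sort_def (s : Sym) : defshape Sym -> Prop :=
| SortProduct s1 s2 pi1 pi2 of
    S s1 = Some Sort & S s2 = Some Sort &
    S pi1 = None & S' pi1 = Some (Func [:: s] s1) &
    S pi2 = None & S' pi2 = Some (Func [:: s] s2) & pi1 != pi2 &
    def pi1 = ShProduct s s1 s2 pi1 pi2 & def pi2 = ShProduct s s1 s2 pi1 pi2 :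
  sort_def s (ShProduct s s1 s2 pi1 pi2)
| SortCoproduct s1 s2 r1 r2 of
    S s1 = Some Sort & S s2 = Some Sort &
    S r1 = None & S' r1 = Some (Func [:: s1] s) &
    S r2 = None & S' r2 = Some (Func [:: s2] s) & r1 != r2 &
    def r1 = ShCoproduct s s1 s2 r1 r2 & def r2 = ShCoproduct s s1 s2 r1 r2 :
  sort_def s (ShCoproduct s s1 s2 r1 r2)
| SortSubsort s1 i x phi of
    S s1 = Some Sort & S i = None & S' i = Some (Func [:: s] s1) &
    x.1 = s1 & formula_in S [:: x] phi & def i = ShSubsort s s1 i x phi :
  sort_def s (ShSubsort s s1 i x phi)
| SortQuotient s1 eps x1 x2 phi of
    S s1 = Some Sort & S eps = None & S' eps = Some (Func [:: s1] s) &
    x1.1 = s1 & x2.1 = s1 & x1 != x2 & formula_in S [:: x1; x2] phi &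
    def eps = ShQuotient s s1 eps x1 x2 phi :
  sort_def s (ShQuotient s s1 eps x1 x2 phi).

(** A new symbol is either defined by a formula, or is one of the functions
    that accompany a new sort. *)
Inductive symbol_def (p : Sym) (d : decl Sym) : defshape Sym -> Prop :=
| SymbolGraph vs phi of
    map fst vs = decl_sorts d & (forall s, s \in decl_sorts d -> S s = Some Sort) &
    uniq vs & formula_in S vs phi :
  symbol_def p d (ShGraph p vs phi)
| SymbolProduct s s1 s2 pi1 pi2 of
    S s = None & S' s = Some Sort & def s = ShProduct s s1 s2 pi1 pi2 &
    d = Func [:: s] (if p == pi1 then s1 else s2) & p = pi1 \/ p = pi2 &
    S s1 = Some Sort & S s2 = Some Sort & pi1 != pi2 :
  symbol_def p d (ShProduct s s1 s2 pi1 pi2)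
| SymbolCoproduct s s1 s2 r1 r2 of
    S s = None & S' s = Some Sort & def s = ShCoproduct s s1 s2 r1 r2 &
    d = Func [:: if p == r1 then s1 else s2] s & p = r1 \/ p = r2 &
    S s1 = Some Sort & S s2 = Some Sort & r1 != r2 &
    S' r1 = Some (Func [:: s1] s) & S' r2 = Some (Func [:: s2] s) :
  symbol_def p d (ShCoproduct s s1 s2 r1 r2)
| SymbolSubsort s s1 x phi of
    S s = None & S' s = Some Sort & def s = ShSubsort s s1 p x phi &
    d = Func [:: s] s1 & S s1 = Some Sort & x.1 = s1 & formula_in S [:: x] phi :
  symbol_def p d (ShSubsort s s1 p x phi)
| SymbolQuotient s s1 x1 x2 phi of
    S s = None & S' s = Some Sort & def s = ShQuotient s s1 p x1 x2 phi &
    d = Func [:: s1] s & S s1 = Some Sort &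
    x1.1 = s1 & x2.1 = s1 & x1 != x2 & formula_in S [:: x1; x2] phi :
  symbol_def p d (ShQuotient s s1 p x1 x2 phi).

Hypothesis subS : subsig S S'.
Hypothesis defP : forall p, S' p <> None -> S p = None ->
  exists2 D, p \in D & shape_wf S S' D (def p) /\ {in D, forall q, def q = def p}.
Hypothesis modelP : forall M : structure S', is_model T' M <->
  (forall phi, sentences T phi -> holds M phi) /\
  (forall p, S' p <> None -> S p = None -> shape_true M (def p)).

Lemma new_sortP s : S' s = Some Sort -> S s = None -> sort_def s (def s).
Proof.
move=> S's Ss; have [|D sD [wf defD]] := defP _ Ss; first by rewrite S's.
move: wf sD defD; move eqsh: (def s) => sh wf.
case: wf eqsh.
- move=> p d vs phi _ S'p dS _ _ _ _ _; rewrite inE => /eqP sp.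
  by move: S's; rewrite sp S'p => -[].
- move=> t s1 s2 pi1 pi2 h1 h2 h3 h4 h5 h6 h7 h8 h9 _.
  rewrite !inE => /or3P[] /eqP st defD; last 2 first.
  + by rewrite st h6 in S's.
  + by rewrite st h8 in S's.
  rewrite -st in h6 h8 defD *.
  by apply: SortProduct => //; apply: defD; rewrite !inE eqxx ?orbT.
- move=> t s1 s2 pi1 pi2 h1 h2 h3 h4 h5 h6 h7 h8 h9 _.
  rewrite !inE => /or3P[] /eqP st defD; last 2 first.
  + by rewrite st h6 in S's.
  + by rewrite st h8 in S's.
  rewrite -st in h6 h8 defD *.
  by apply: SortCoproduct => //; apply: defD; rewrite !inE eqxx ?orbT.
- move=> t s1 i x phi h1 h2 h3 h4 h5 h6 h7 _.
  rewrite !inE => /orP[] /eqP st defD; last by rewrite st h5 in S's.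
  rewrite -st in h5 defD *.
  by apply: SortSubsort => //; apply: defD; rewrite !inE eqxx ?orbT.
- move=> t s1 i x1 x2 phi h1 h2 h3 h4 h5 h6 h7 h8 h9 _.
  rewrite !inE => /orP[] /eqP st defD; last by rewrite st h5 in S's.
  rewrite -st in h5 defD *.
  by apply: SortQuotient => //; apply: defD; rewrite !inE eqxx ?orbT.
Qed.

Lemma new_symbolP p d : S' p = Some d -> d <> Sort -> S p = None ->
  symbol_def p d (def p).
Proof.
move=> S'p dS Sp; have [|D pD [wf defD]] := defP _ Sp; first by rewrite S'p.
move: wf pD defD; move eqsh: (def p) => sh wf.
case: wf eqsh.
- move=> q d' vs phi _ S'q _ h1 h2 h3 h4 _; rewrite inE => /eqP pq _.
  move: S'q; rewrite -pq S'p => -[dd']; rewrite -dd' in h1 h2.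
  exact: SymbolGraph.
- move=> s s1 s2 pi1 pi2 h1 h2 h3 h4 h5 h6 h7 h8 h9 eqsh pD defD.
  have ds : def s = ShProduct s s1 s2 pi1 pi2 by apply: defD; rewrite mem_head.
  move: pD; rewrite !inE => /or3P[] /eqP pE; rewrite pE in S'p *.
  + by move: S'p; rewrite h2 => -[] /esym/dS.
  + apply: SymbolProduct => //; last by left.
    by move: S'p; rewrite eqxx h6 => -[].
  + apply: SymbolProduct => //; last by right.
    by move: S'p; rewrite eq_sym (negbTE h9) h8 => -[].
- move=> s s1 s2 pi1 pi2 h1 h2 h3 h4 h5 h6 h7 h8 h9 eqsh pD defD.
  have ds : def s = ShCoproduct s s1 s2 pi1 pi2 by apply: defD; rewrite mem_head.
  move: pD; rewrite !inE => /or3P[] /eqP pE; rewrite pE in S'p *.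
  + by move: S'p; rewrite h2 => -[] /esym/dS.
  + apply: SymbolCoproduct => //; last by left.
    by move: S'p; rewrite eqxx h6 => -[].
  + apply: SymbolCoproduct => //; last by right.
    by move: S'p; rewrite eq_sym (negbTE h9) h8 => -[].
- move=> s s1 i x phi h1 h2 h3 h4 h5 h6 h7 eqsh pD defD.
  have ds : def s = ShSubsort s s1 i x phi by apply: defD; rewrite mem_head.
  move: pD; rewrite !inE => /orP[] /eqP pE; rewrite pE in S'p *.
    by move: S'p; rewrite h2 => -[] /esym/dS.
  by apply: SymbolSubsort => //; move: S'p; rewrite h5 => -[].
- move=> s s1 i x1 x2 phi h1 h2 h3 h4 h5 h6 h7 h8 h9 eqsh pD defD.
  have ds : def s = ShQuotient s s1 i x1 x2 phi by apply: defD; rewrite mem_head.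
  move: pD; rewrite !inE => /orP[] /eqP pE; rewrite pE in S'p *.
    by move: S'p; rewrite h2 => -[] /esym/dS.
  by apply: SymbolQuotient => //; move: S'p; rewrite h5 => -[].
Qed.

Lemma old_sort s d : S s = Some d -> S' s = Some Sort -> S s = Some Sort.
Proof. by move=> Ss; rewrite (subS Ss) => -[<-]. Qed.

Section Unary.
Variables (M : structure S') (f s s' : Sym).
Hypothesis fE : S' f = Some (Func [:: s] s').

Lemma func1_sort (a b : M) : func_int f [:: a] b -> sort_of a = s /\ sort_of b = s'.
Proof. by move/func_intP; rewrite fE /= => -[-> ->]. Qed.

Lemma func1_total (a : M) : sort_of a = s -> exists b, func_int f [:: a] b.
Proof.
move=> as_; have [|b [fb _]] := @func_int_total _ _ M f [:: a] s'.
  by rewrite fE /= as_.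
by exists b.
Qed.

Lemma func1_unique (a b c : M) : func_int f [:: a] b -> func_int f [:: a] c -> b = c.
Proof.
move=> fb fc; have [as_ _] := func1_sort fb.
have [|d [_ ud]] := @func_int_total _ _ M f [:: a] s'; first by rewrite fE /= as_.
by rewrite -(ud _ fb) -(ud _ fc).
Qed.

End Unary.

(** A code consists of a Boolean and of two elements of sorts of [S].  The same
    format serves all sorts, old ones included, so that variables of all sorts
    can be translated uniformly: the Boolean selects the summand of a coproduct,
    and only for a product is the second component tied to the coded element.
    [source s b] gives the sorts of the two components. *)
Definition source (s : Sym) (b : bool) : Sym * Sym :=
  match S s, def s with
  | None, ShProduct _ s1 s2 _ _ => (s1, s2)
  | None, ShCoproduct _ s1 s2 _ _ => if b then (s2, s2) else (s1, s1)
  | None, ShSubsort _ s1 _ _ _ | None, ShQuotient _ s1 _ _ _ _ => (s1, s1)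
  | _, _ => (s, s)
  end.

Definition codes0 (M : structure S') (s : Sym) (b : bool) (a1 a2 m : M) : Prop :=
  match S s, def s with
  | None, ShProduct _ _ _ pi1 pi2 => func_int pi1 [:: m] a1 /\ func_int pi2 [:: m] a2
  | None, ShCoproduct _ _ _ r1 r2 => func_int (if b then r2 else r1) [:: a1] m
  | None, ShSubsort _ _ i _ _ => func_int i [:: m] a1
  | None, ShQuotient _ _ eps _ _ _ => func_int eps [:: a1] m
  | None, _ => False
  | Some _, _ => a1 = m
  end.

Record codes (M : structure S') (s : Sym) (b : bool) (a1 a2 m : M) : Prop := Codes {
  codes_sort : sort_of m = s;
  codes_sort1 : sort_of a1 = (source s b).1;
  codes_sort2 : sort_of a2 = (source s b).2;
  codes_codes0 : codes0 s b a1 a2 m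
}.

Lemma source_old s b : S s = Some Sort -> source s b = (s, s).
Proof. by rewrite /source => ->. Qed.

Lemma source_sort s b : S' s = Some Sort ->
  S (source s b).1 = Some Sort /\ S (source s b).2 = Some Sort.
Proof.
move=> S's; rewrite /source; case Ss: (S s) => [d|].
  by have := old_sort Ss S's.
by case: (new_sortP S's Ss) => // *; case: b.
Qed.

Lemma codes_old (M : structure S') s b (a1 a2 m : M) :
  S s = Some Sort -> codes s b a1 a2 m -> a1 = m.
Proof. by move=> Ss [_ _ _]; rewrite /codes0 Ss. Qed.

Lemma old_codes (M : structure S') (m : M) b :
  S (sort_of m) = Some Sort -> codes (sort_of m) b m m m.
Proof. by move=> Sm; split; rewrite ?source_old // /codes0 Sm. Qed.

Section CodesModel.
Variable M : structure S'.
Hypothesis MT' : is_model T' M.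

Lemma new_sort_true s : S' s = Some Sort -> S s = None -> shape_true M (def s).
Proof. by move=> S's; apply: ((modelP M).1 MT').2; rewrite S's. Qed.

(** The accompanying functions are total, or surjective in the case of coproducts
    and quotients, so that every element has a code. *)
Lemma codes_exist (m : M) : exists b a1 a2, codes (sort_of m) b a1 a2 m.
Proof.
have S's := sort_ofP m; move sE: (sort_of m) S's => s S's.
case Ss: (S s) => [d|].
  have Ss' := old_sort Ss S's.
  by exists false, m, m; rewrite -sE; apply: old_codes; rewrite sE.
have := new_sort_true S's Ss; have := new_sortP S's Ss.
move dE: (def s) => sh sd; case: sd dE => /=.
- move=> s1 s2 pi1 pi2 h1 h2 h3 h4 h5 h6 h7 h8 h9 dE _.
  have [a1 f1] := func1_total h4 sE; have [a2 f2] := func1_total h6 sE.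
  have [_ a1s] := func1_sort h4 f1; have [_ a2s] := func1_sort h6 f2.
  by exists false, a1, a2; split; rewrite /source /codes0 ?Ss ?dE.
- move=> s1 s2 r1 r2 h1 h2 h3 h4 h5 h6 h7 h8 h9 dE [h _].
  case: (h m sE) => -[a [[as_ fa] _]].
    by exists false, a, a; split; rewrite /source /codes0 ?Ss ?dE.
  by exists true, a, a; split; rewrite /source /codes0 ?Ss ?dE.
- move=> s1 i x phi h1 h2 h3 h4 h5 h6 dE _.
  have [a f] := func1_total h3 sE; have [_ as_] := func1_sort h3 f.
  by exists false, a, a; split; rewrite /source /codes0 ?Ss ?dE.
- move=> s1 i x1 x2 phi h1 h2 h3 h4 h5 h6 h7 h8 dE [_ h].
  have [a as_ fa] := h m sE.
  by exists false, a, a; split; rewrite /source /codes0 ?Ss ?dE.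
Qed.

(** Products have unique pairs, subsort inclusions are injective, and in the other
    two cases a function maps the code to the element. *)
Lemma codes_unique s b (a1 a2 m m' : M) :
  codes s b a1 a2 m -> codes s b a1 a2 m' -> m = m'.
Proof.
move=> [ms a1s a2s c] [m's _ _ c']; have := sort_ofP m; rewrite ms => S's.
move: a1s a2s c c'; rewrite /source /codes0; case Ss: (S s) => [d|].
  by move=> _ _ <- <-.
have := new_sort_true S's Ss; have := new_sortP S's Ss.
case: (def s) / => /=.
- move=> s1 s2 pi1 pi2 h1 h2 h3 h4 h5 h6 h7 h8 h9 h a1s a2s mE m'E.
  by have [c [_ uc]] := h a1 a2 a1s a2s; rewrite -(uc m) // (uc m').
- move=> s1 s2 r1 r2 h1 h2 h3 h4 h5 h6 h7 h8 h9 _ _ _.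
  by case: b => c c'; [apply: (func1_unique h6 c c')|apply: (func1_unique h4 c c')].
- move=> s1 i x phi h1 h2 h3 h4 h5 h6 [_ inj] _ _ mE m'E.
  by apply: inj => //; exists a1.
- move=> s1 i x1 x2 phi h1 h2 h3 h4 h5 h6 h7 h8 _ _ _.
  by move=> c c'; apply: (func1_unique h3 c c').
Qed.

End CodesModel.

(** * Translating formulas of the larger signature *)

(** An environment assigns to each variable of the larger signature a code made
    of variables of [S]. *)
Notation env := (var Sym -> bool * (var Sym * var Sym)).

Definition env_sorted (e : env) xs : Prop :=
  {in xs, forall x, ((e x).2.1.1, (e x).2.2.1) = source x.1 (e x).1}.

Definition old_assignment (M : structure S') (w : var Sym -> M) : Prop :=
  forall x, S x.1 = Some Sort -> sort_of (w x) = x.1.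

Definition code_vars (e : env) xs :=
  map (fun y => (e y).2.1) xs ++ map (fun y => (e y).2.2) xs.

Lemma fresh_code (e : env) xs s k y : y \in xs -> fresh_index (code_vars e xs) <= k ->
  ((e y).2.1 == (s, k)) = false /\ ((e y).2.2 == (s, k)) = false.
Proof.
move=> yxs /(fresh_notin s); rewrite mem_cat negb_or => /andP[k1 k2].
split; apply/negbTE/negP => /eqP eE.
  by move/negP: k1; apply; rewrite -eE; apply: map_f yxs.
by move/negP: k2; apply; rewrite -eE; apply: (map_f (fun y => (e y).2.2)) yxs.
Qed.

Definition coded (M : structure S') (e : env) xs (w v : var Sym -> M) : Prop :=
  {in xs, forall x, codes x.1 (e x).1 (w (e x).2.1) (w (e x).2.2) (v x)}.

(** [P] is expressed by a formula of [S] about codes of the variables [xs].  The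
    formula must not depend on the model, since it serves to compare two models
    along an elementary embedding; it does depend on the environment, which
    fixes the Booleans of the codes. *)
Definition translatable xs (P : forall M : structure S', (var Sym -> M) -> Prop) :=
  forall e : env, env_sorted e xs ->
  exists2 psi, is_formula S psi &
    forall (M : structure S') (w v : var Sym -> M), is_model T' M ->
      old_assignment w -> coded e xs w v -> (P M v <-> sat w psi).

Lemma old_assignment_upd (M : structure S') (w : var Sym -> M) x m :
  old_assignment w -> sort_of m = x.1 -> old_assignment [eta w with x |-> m].
Proof. by move=> wP mx y yS /=; case: eqP => [->|_] //; apply: wP. Qed.

Lemma old_assignment_exists (M : structure S') :
  exists w : var Sym -> M, old_assignment w.
Proof.
have [w wP] := assignment_exists M; exists w => x xS; apply: wP.
exact: subS.
Qed.

Lemma sub_translatable xs ys P :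
  {subset xs <= ys} -> translatable xs P -> translatable ys P.
Proof.
move=> sub trP e eP; have [x /sub/eP//|psi fpsi psiP] := trP e.
exists psi => // M w v MT' wP cP; apply: psiP => // x /sub; exact: cP.
Qed.

Lemma eq_translatable xs (P Q : forall M : structure S', (var Sym -> M) -> Prop) :
  (forall (M : structure S') (v : var Sym -> M), is_model T' M ->
     {in xs, forall x, sort_of (v x) = x.1} -> P M v <-> Q M v) ->
  translatable xs P -> translatable xs Q.
Proof.
move=> PQ trP e eP; have [psi fpsi psiP] := trP e eP.
exists psi => // M w v MT' wP cP; apply: iff_trans (psiP _ _ _ MT' wP cP).
apply: iff_sym; apply: PQ => // x xxs.
by case: (cP x xxs).
Qed.

Lemma translatable_not xs P :
  translatable xs P -> translatable xs (fun M v => ~ P M v).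
Proof.
move=> trP e eP; have [psi fpsi psiP] := trP e eP.
by exists (Not psi) => // M w v MT' wP cP /=; rewrite (psiP M w v).
Qed.

Lemma translatable_binary (c : formula Sym -> formula Sym -> formula Sym)
    (op : Prop -> Prop -> Prop) xs ys P Q :
  (forall phi psi, is_formula S (c phi psi) = (is_formula S phi /\ is_formula S psi)) ->
  (forall (M : structure S') (w : var Sym -> M) phi psi,
     sat w (c phi psi) = op (sat w phi) (sat w psi)) ->
  translatable xs P -> translatable ys Q ->
  translatable (xs ++ ys) (fun M v => op (P M v) (Q M v)).
Proof.
move=> formE satE /(@sub_translatable _ (xs ++ ys))-trP.
move=> /(@sub_translatable _ (xs ++ ys))-trQ e eP.
have [x xP|phi fphi phiP] := trP _ e eP; first by rewrite mem_cat xP.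
have [x xP|psi fpsi psiP] := trQ _ e eP; first by rewrite mem_cat xP orbT.
exists (c phi psi); first by rewrite formE.
by move=> M w v MT' wP cP; rewrite satE (propext (phiP _ _ _ MT' wP cP))
  (propext (psiP _ _ _ MT' wP cP)).
Qed.

(** Which pairs of elements are codes is expressible in [S]; this is where the
    formula of a subsort is needed. *)
Lemma code_domain s b (z1 z2 : var Sym) :
  S' s = Some Sort -> (z1.1, z2.1) = source s b ->
  exists2 psi, is_formula S psi &
    forall (M : structure S') (w : var Sym -> M), is_model T' M ->
      old_assignment w ->
      (sat w psi <-> exists m, codes s b (w z1) (w z2) m).
Proof.
move=> S's zs; have [z1S z2S] : S z1.1 = Some Sort /\ S z2.1 = Some Sort.
  by have := source_sort b S's; rewrite -zs.
have true_ok : is_formula S (Eq (Var z1) (Var z1)) by exists z1.1.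
have true_sat (M : structure S') (w : var Sym -> M) : sat w (Eq (Var z1) (Var z1)).
  by exists (w z1).
case Ss: (S s) => [d|].
  have Ss' := old_sort Ss S's.
  exists (Eq (Var z1) (Var z1)) => // M w MT' wP; split=> // _; exists (w z1).
  move: zs; rewrite source_old // => -[z1s z2s].
  by split; rewrite ?source_old // /codes0 ?Ss // wP.
have sd := new_sortP S's Ss.
have [phi_ex|] := pselect (exists s1 i x phi, def s = ShSubsort s s1 i x phi).
  have [s1 [i [x [phi ds]]]] := phi_ex; move: sd; rewrite ds => sd.
  have [s1S S'i xs1 [fphi sub]] : [/\ S s1 = Some Sort, S' i = Some (Func [:: s] s1),
      x.1 = s1 & formula_in S [:: x] phi] by inversion sd.
  move: (zs); rewrite /source Ss ds => -[z1s z2s].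
  have zx : map fst [:: z1] = map fst [:: x] by rewrite /= xs1 z1s.
  have [psi fpsi psiP] := tuple_sat_at fphi (isT : uniq [:: x]) zx sub.
  exists psi => // M w MT' wP; rewrite psiP //= .
  have := new_sort_true MT' S's Ss; rewrite ds => -[h _].
  rewrite h ?wP //; split=> [[c cs ca]|[m []]]; last first.
    by rewrite /codes0 Ss ds => ms _ _ im; exists m.
  exists c; split; rewrite // ?wP // -?zs //.
  by rewrite /codes0 Ss ds.
move=> nosub.
exists (Eq (Var z1) (Var z1)) => // M w MT' wP; split=> // _.
have := new_sort_true MT' S's Ss.
have w1 : sort_of (w z1) = (source s b).1 by rewrite -zs wP.
have w2 : sort_of (w z2) = (source s b).2 by rewrite -zs wP.
suff : shape_true M (def s) -> exists2 m, sort_of m = s & codes0 s b (w z1) (w z2) m.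
  by move=> H /H[m ms c0]; exists m; split.
move: w1 w2; rewrite /source /codes0 Ss.
case: sd nosub => /=.
- move=> s1 s2 pi1 pi2 h1 h2 h3 h4 h5 h6 h7 h8 h9 _ w1 w2 h.
  by have [c [[cs hc] _]] := h _ _ w1 w2; exists c.
- move=> s1 s2 r1 r2 h1 h2 h3 h4 h5 h6 h7 h8 h9 _ w1 _ _.
  have fE : S' (if b then r2 else r1) = Some (Func [:: if b then s2 else s1] s).
    by case: (b).
  have [|m fm] := @func1_total M _ _ _ fE (w z1); first by rewrite w1; case: (b).
  by exists m => //; have [] := func1_sort fE fm.
- by move=> s1 i x phi _ _ _ _ _ _ []; exists s1, i, x, phi.
- move=> s1 eps x1 x2 phi h1 h2 h3 h4 h5 h6 h7 h8 _ w1 _ _.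
  have [m fm] := func1_total h3 w1.
  by exists m => //; have [] := func1_sort h3 fm.
Qed.

(** Over each of the two possible Booleans, quantify over the components of a
    code, in variables that no other code uses; [code_domain] ensures that the
    components do code an element. *)
Lemma translatable_ex xs ys x P : S' x.1 = Some Sort ->
  {subset xs <= x :: ys} -> translatable xs P ->
  translatable ys (fun M v => exists2 m : M, sort_of m = x.1 & P M [eta v with x |-> m]).
Proof.
move=> xS sub trP e eP.
pose n := fresh_index (code_vars e ys).
pose z1 b : var Sym := ((source x.1 b).1, n).
pose z2 b : var Sym := ((source x.1 b).2, n.+1).
have z12 b : (z1 b == z2 b) = false by apply/eqP => -[_ /eqP]; rewrite ltn_eqF.
have step b : exists2 psi, is_formula S psi & forall (M : structure S') (w v : var Sym -> M),
    is_model T' M -> old_assignment w -> coded e ys w v ->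
    (sat w psi <-> exists2 m, P M [eta v with x |-> m] &
       exists a1 a2, codes x.1 b a1 a2 m).
  have [|chi fchi chiP] := @code_domain x.1 b (z1 b) (z2 b) xS.
    by rewrite -surjective_pairing.
  pose e' : env := [eta e with x |-> (b, (z1 b, z2 b))].
  have e'P : env_sorted e' xs.
    move=> y /sub yP; rewrite /e' /=; case: (eqVneq y x) => [->|yx] /=.
      by rewrite -surjective_pairing.
    by apply: eP; move: yP; rewrite inE (negbTE yx).
  have [psi fpsi psiP] := trP e' e'P.
  exists (Ex (z1 b) (Ex (z2 b) (And chi psi))).
    by have [] := source_sort b xS.
  move=> M w v MT' wP cP.
  pose w' a1 a2 := [eta [eta w with z1 b |-> a1] with z2 b |-> a2].
  have w'P a1 a2 : sort_of a1 = (z1 b).1 -> sort_of a2 = (z2 b).1 -> old_assignment (w' a1 a2).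
    by move=> a1s a2s; apply: old_assignment_upd => //; apply: old_assignment_upd.
  have w'1 a1 a2 : w' a1 a2 (z1 b) = a1 by rewrite /= z12 eqxx.
  have w'2 a1 a2 : w' a1 a2 (z2 b) = a2 by rewrite /= eqxx.
  have coded' a1 a2 m : codes x.1 b a1 a2 m ->
      coded e' xs (w' a1 a2) [eta v with x |-> m].
    move=> c y /sub yP; rewrite /e' [X in codes _ X.1 _ _ _]/=.
    rewrite [X in w' _ _ X.2.1]/= [X in w' _ _ X.2.2]/= [X in codes _ _ _ _ X]/=.
    case: (eqVneq y x) => [->|yx]; first by rewrite w'1 w'2.
    have yys : y \in ys by move: yP; rewrite inE (negbTE yx).
    have [f1 f2] := fresh_code (source x.1 b).1 yys (leqnn n).
    have [f3 f4] := fresh_code (source x.1 b).2 yys (leqnSn n).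
    rewrite /w' /= f1 f2 f3 f4; exact: cP.
  split=> [[a1 a1s [a2 a2s [chi_w psi_w]]]|[m Pm [a1 [a2 c]]]].
    have [m c] := (chiP M _ MT' (w'P a1 a2 a1s a2s)).1 chi_w.
    rewrite w'1 w'2 in c.
    exists m; last by exists a1, a2.
    by apply/(psiP M _ _ MT' (w'P a1 a2 a1s a2s) (coded' _ _ _ c)).
  have a1s : sort_of a1 = (z1 b).1 by case: c.
  have a2s : sort_of a2 = (z2 b).1 by case: c.
  exists a1 => //; exists a2 => //; split.
    by apply/(chiP M _ MT' (w'P a1 a2 a1s a2s)); exists m; rewrite w'1 w'2.
  by apply/(psiP M _ _ MT' (w'P a1 a2 a1s a2s) (coded' _ _ _ c)).
have [psi0 f0 psi0P] := step false; have [psi1 f1 psi1P] := step true.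
exists (Or psi0 psi1) => // M w v MT' wP cP /=.
rewrite (psi0P M w v) // (psi1P M w v) //.
split=> [[m mx Pm]|].
  have [b [a1 [a2 c]]] := codes_exist MT' m; rewrite mx in c.
  by case: b c => c; [right|left]; exists m => //; exists a1, a2.
by case=> -[m Pm [a1 [a2 c]]]; exists m => //; case: c.
Qed.

Lemma sat_Eq_Var (R : signature Sym) (M : structure R) (w : var Sym -> M) x y :
  sat w (Eq (Var x) (Var y)) <-> w x = w y.
Proof. by split=> [[a /= -> ->]|xy] //; exists (w x). Qed.

Lemma is_formula_Eq_Var x y :
  S x.1 = Some Sort -> x.1 = y.1 -> is_formula S (Eq (Var x) (Var y)).
Proof. by move=> xS xy; exists x.1. Qed.

(** The definition of a coproduct demands unique preimages in at least one summand
    and disjoint images; together this makes the injections jointly injective. *)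
Lemma coproduct_inj (M : structure S') s s1 s2 r1 r2 (b b' : bool) (a a' m : M) :
  S' r1 = Some (Func [:: s1] s) -> S' r2 = Some (Func [:: s2] s) ->
  shape_true M (ShCoproduct s s1 s2 r1 r2) ->
  func_int (if b then r2 else r1) [:: a] m ->
  func_int (if b' then r2 else r1) [:: a'] m -> b = b' /\ a = a'.
Proof.
move=> r1E r2E [h disj].
wlog: b b' a a' / b ==> b' => [H|].
  case: (boolP (b ==> b')) => [bb' f f'|nbb' f f']; first exact: H.
  have [|-> ->] := H b' b a' a _ f' f; last by [].
  by case: (b) (b') nbb' => -[].
case: b b' => -[] // _ f f'.
- have [as_ ms] := func1_sort r2E f; have [a's _] := func1_sort r2E f'.
  case: (h m ms) => -[c [[cs fc] uc]]; last by rewrite -(uc a) ?(uc a').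
  by case: (disj c a cs as_); exists m.
- have [as_ ms] := func1_sort r1E f; have [a's _] := func1_sort r2E f'.
  by case: (disj a a' as_ a's); exists m.
- have [as_ ms] := func1_sort r1E f; have [a's _] := func1_sort r1E f'.
  case: (h m ms) => -[c [[cs fc] uc]]; first by rewrite -(uc a) ?(uc a').
  by case: (disj a c as_ cs); exists m.
Qed.

(** Equality of coded elements is componentwise, except in a quotient, where it is
    the defining equivalence relation, and in a coproduct, where codes with
    different Booleans code different elements. *)
Lemma translatable_eq x y : S' x.1 = Some Sort -> x.1 = y.1 ->
  translatable [:: x; y] (fun M v => v x = v y).
Proof.
move=> xS xy e eP.
have := eP y; have := eP x; rewrite !inE !eqxx orbT => /(_ isT) + /(_ isT).
move ex: (e x) => [b [z1 z2]]; move ey: (e y) => [b' [y1 y2]] /=.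
rewrite -xy => zs ys; pose s := x.1; rewrite -/s in zs ys xS.
suff [psi fpsi psiP] : exists2 psi, is_formula S psi &
    forall (M : structure S') (w : var Sym -> M) m m', is_model T' M ->
      old_assignment w -> codes s b (w z1) (w z2) m -> codes s b' (w y1) (w y2) m' ->
      (m = m' <-> sat w psi).
  exists psi => // M w v MT' wP cP.
  have := cP y; have := cP x; rewrite !inE !eqxx orbT => /(_ isT) + /(_ isT).
  by rewrite ex ey -xy; apply: psiP.
have [z1S z2S] := source_sort b xS; have [y1S y2S] := source_sort b' xS.
rewrite -zs /= in z1S z2S; rewrite -ys /= in y1S y2S.
case Ss: (S s) => [d|].
  have Ss' := old_sort Ss xS.
  exists (Eq (Var z1) (Var y1)).
    move: zs ys; rewrite !source_old // => -[z1s _] [y1s _].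
    by apply: is_formula_Eq_Var; rewrite z1s.
  move=> M w m m' MT' wP c c'.
  by rewrite -(codes_old Ss' c) -(codes_old Ss' c') sat_Eq_Var.
have := new_sortP xS Ss; have sT M MT' := @new_sort_true M MT' _ xS Ss.
move dE: (def s) => sh sd; move: zs ys sT; rewrite /source Ss dE; case: sd dE.
- move=> s1 s2 pi1 pi2 h1 h2 h3 h4 h5 h6 h7 h8 h9 dE [z1s z2s] [y1s y2s] sT.
  exists (And (Eq (Var z1) (Var y1)) (Eq (Var z2) (Var y2))).
    by split; apply: is_formula_Eq_Var; rewrite ?z1s ?z2s.
  move=> M w m m' MT' wP [ms _ _ c] [m's _ _ c'].
  move: c c'; rewrite /codes0 Ss dE => -[f1 f2] [f'1 f'2].
  split=> [mm'|[/sat_Eq_Var E1 /sat_Eq_Var E2]].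
    rewrite -mm' in f'1 f'2.
    by split; apply/sat_Eq_Var; [apply: (func1_unique h4 f1 f'1)|apply: (func1_unique h6 f2 f'2)].
  have w1 : sort_of (w z1) = s1 by rewrite wP.
  have w2 : sort_of (w z2) = s2 by rewrite wP.
  have [u [_ uu]] := sT M MT' _ _ w1 w2.
  by rewrite -(uu m) // -(uu m') // E1 E2.
- move=> s1 s2 r1 r2 h1 h2 h3 h4 h5 h6 h7 h8 h9 dE.
  move=> zs ys sT.
  have z1s : z1.1 = if b then s2 else s1 by case: (b) zs => -[].
  have y1s : y1.1 = if b' then s2 else s1 by case: (b') ys => -[].
  have [bb'|bb'] := eqVneq b b'.
    exists (Eq (Var z1) (Var y1)).
      by apply: is_formula_Eq_Var; rewrite // z1s y1s bb'.
    move=> M w m m' MT' wP [ms _ _ c] [m's _ _ c'].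
    move: c c'; rewrite /codes0 Ss dE -bb' sat_Eq_Var => f f'.
    split=> [mm'|E]; first by rewrite -mm' in f'; have [] := coproduct_inj h4 h6 (sT M MT') f f'.
    rewrite -E in f'.
    by case: (b) f f' => f f'; [apply: (func1_unique h6 f f')|apply: (func1_unique h4 f f')].
  exists (Not (Eq (Var z1) (Var z1))); first by exists z1.1.
  move=> M w m m' MT' wP [ms _ _ c] [m's _ _ c'].
  move: c c'; rewrite /codes0 Ss dE => f f'.
  split=> [mm'|[]]; last by apply/sat_Eq_Var.
  rewrite -mm' in f'; have [/eqP] := coproduct_inj h4 h6 (sT M MT') f f'.
  by rewrite (negbTE bb').
- move=> s1 i x0 phi h1 h2 h3 h4 h5 h6 dE [z1s _] [y1s _] sT.
  exists (Eq (Var z1) (Var y1)); first by apply: is_formula_Eq_Var; rewrite z1s.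
  move=> M w m m' MT' wP [ms _ _ c] [m's _ _ c'].
  move: c c'; rewrite /codes0 Ss dE sat_Eq_Var => f f'.
  split=> [mm'|E]; first by rewrite -mm' in f'; apply: (func1_unique h3 f f').
  by have [_ inj] := sT M MT'; apply: inj => //; exists (w z1); rewrite // E.
- move=> s1 eps x1 x2 phi h1 h2 h3 h4 h5 h6 [fphi sub] h8 dE [z1s _] [y1s _] sT.
  have zyx : map fst [:: z1; y1] = map fst [:: x1; x2] by rewrite /= z1s y1s h4 h5.
  have uxx : uniq [:: x1; x2] by rewrite /= inE h6.
  have [psi fpsi psiP] := tuple_sat_at fphi uxx zyx sub.
  exists psi => // M w m m' MT' wP [ms _ _ c] [m's _ _ c'].
  move: c c'; rewrite /codes0 Ss dE psiP /= => f f'.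
  have [h _] := sT M MT'; rewrite -h ?wP //; split=> [mm'|[c fc f'c]].
    by exists m; rewrite // mm'.
  by rewrite (func1_unique h3 f fc) (func1_unique h3 f' f'c).
Qed.

(** The atomic formula that a symbol of [S] forms with the variables [zs]. *)
Lemma graph_formula p d zs : S p = Some d -> d <> Sort ->
  map fst zs = decl_sorts d ->
  exists2 psi, is_formula S psi &
    forall (M : structure S') (w : var Sym -> M), sat w psi <-> graph p (map w zs).
Proof.
move=> Sp dS zsd; have S'p := subS Sp.
have zsS : {in zs, forall z, S z.1 = Some Sort}.
  by move=> z zzs; apply: (decl_sortsP Sp); rewrite -zsd map_f.
have vars_sorts ys : {subset ys <= zs} ->
    forall2 (has_sort S) (map (@Var Sym) ys) (map fst ys).
  elim: ys => //= y ys IH sub; split; first by rewrite zsS // sub // mem_head.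
  by apply: IH => x xys; rewrite sub // inE xys orbT.
case: d Sp S'p dS zsd => // [ar|ar s|s] Sp S'p _ zsd.
- exists (Atom p (map (@Var Sym) zs)).
    exists ar => //; rewrite -[ar]/(decl_sorts (Pred ar)) -zsd; exact: vars_sorts.
  move=> M w; rewrite (graph_pred _ S'p) /=.
  by split=> [[l /evals_vars-> //]|pl]; exists (map w zs) => //; apply/evals_vars.
- case/lastP: zs zsd zsS vars_sorts => [|zs y]; first by case: (ar).
  rewrite /= map_rcons => /rcons_inj[zsar ys] zsS vars_sorts.
  exists (Eq (App p (map (@Var Sym) zs)) (Var y)).
    exists s; last by rewrite /= -ys zsS // mem_rcons mem_head.
    exists ar => //; rewrite -zsar; apply: vars_sorts => z zzs.
    by rewrite mem_rcons inE zzs orbT.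
  by move=> M w; rewrite sat_Eq_App_Var map_rcons (graph_func _ _ S'p).
- case: zs zsd zsS vars_sorts => [|y [|]] //= [ys] zsS _.
  exists (Eq (Var y) (Cst p)).
    by exists s => //=; split=> //; rewrite -ys zsS ?mem_head.
  move=> M w; rewrite (graph_const _ S'p) /=.
  by split=> [[a ->]|cy] //; exists (w y).
Qed.

(** A variable of an old sort is its own code, up to renaming. *)
Definition old_vars (e : env) zs := map (fun z => (e z).2.1) zs.

Lemma map_old_vars e zs : {in zs, forall z, S z.1 = Some Sort} ->
  env_sorted e zs -> map fst (old_vars e zs) = map fst zs.
Proof.
move=> zsS eP; rewrite -map_comp; apply/eq_in_map => z zzs /=.
by have [-> _] : ((e z).2.1.1, (e z).2.2.1) = (z.1, z.1)
  by rewrite eP // source_old // zsS.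
Qed.

Lemma coded_old_vars (M : structure S') e zs (w v : var Sym -> M) :
  {in zs, forall z, S z.1 = Some Sort} ->
  coded e zs w v -> map w (old_vars e zs) = map v zs.
Proof.
move=> zsS cP; rewrite -map_comp; apply/eq_in_map => z zzs /=.
exact: codes_old (zsS _ zzs) (cP z zzs).
Qed.

(** A symbol of [S] stays atomic, an explicitly defined symbol is replaced by its
    definition, and a function accompanying a new sort relates an element to a
    component of its code, so that its graph amounts to an equation between
    components (for a quotient, to the defining equivalence). *)
Lemma translatable_symbol p d zs : S' p = Some d -> d <> Sort ->
  map fst zs = decl_sorts d ->
  translatable zs (fun M v => graph p (map v zs)).
Proof.
move=> S'p dS zsd e eP.
case Sp: (S p) => [d'|].
  have dd' : d' = d by have := subS Sp; rewrite S'p => -[].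
  rewrite dd' in Sp; have zsS : {in zs, forall z, S z.1 = Some Sort}.
    by move=> z zzs; apply: (decl_sortsP Sp); rewrite -zsd map_f.
  have [|psi fpsi psiP] := @graph_formula p d (old_vars e zs) Sp dS.
    by rewrite map_old_vars.
  by exists psi => // M w v MT' wP cP; rewrite psiP (coded_old_vars zsS cP).
have pT (M : structure S') : is_model T' M -> shape_true M (def p).
  by move=> MT'; apply: ((modelP M).1 MT').2; rewrite ?S'p.
case: (new_symbolP S'p dS Sp) pT.
- move=> vs phi vsd dsorts uvs [fphi sub] pT.
  have zsS : {in zs, forall z, S z.1 = Some Sort}.
    by move=> z zzs; apply: dsorts; rewrite -zsd map_f.
  have zsvs : map fst (old_vars e zs) = map fst vs by rewrite map_old_vars // zsd vsd.
  have [psi fpsi psiP] := tuple_sat_at fphi uvs zsvs sub.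
  exists psi => // M w v MT' wP cP; rewrite psiP (coded_old_vars zsS cP).
  apply: pT => //; rewrite -map_comp vsd -zsd; apply/eq_in_map => z zzs /=.
  by case: (cP z zzs).
all: move=> s s1.
- move=> s2 pi1 pi2 Ss S's ds dE ppi s1S s2S p12 pT.
  rewrite dE /= in zsd; case: zs zsd eP => [|x [|y []]] //= [xs ys] eP.
  have yS : S y.1 = Some Sort by rewrite ys; case: ifP.
  have := eP x; have := eP y; rewrite !inE !eqxx orbT => /(_ isT) + /(_ isT).
  move ey: (e y) => [c [y1 y2]]; move ex: (e x) => [b [x1 x2]] /=.
  rewrite source_old // /source xs Ss ds => -[y1s _] [x1s x2s].
  exists (Eq (Var (if p == pi1 then x1 else x2)) (Var y1)).
    by apply: is_formula_Eq_Var; rewrite ?y1s ?ys; case: ifP => _; rewrite ?x1s ?x2s.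
  move=> M w v MT' wP cP; rewrite dE in S'p.
  have [_ _ _ ] : codes s b (w x1) (w x2) (v x).
    by have := cP x; rewrite ex xs; apply; rewrite mem_head.
  have yE : w y1 = v y.
    by have := cP y; rewrite ey !inE eqxx orbT => /(_ isT); apply: codes_old.
  rewrite /codes0 Ss ds sat_Eq_Var yE => -[f1 f2].
  rewrite -[[:: v x; v y]]/(rcons [:: v x] (v y)) (graph_func _ _ S'p).
  have [pE|pE] := eqVneq p pi1.
    by rewrite pE in S'p *; split=> [fy|<- //]; apply: (func1_unique S'p f1 fy).
  have {}pE : p = pi2 by case: ppi pE => // ->; rewrite eqxx.
  by rewrite pE in S'p *; split=> [fy|<- //]; apply: (func1_unique S'p f2 fy).
- move=> s2 r1 r2 Ss S's ds dE pr s1S s2S r12 r1E r2E pT.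
  rewrite dE /= in zsd; case: zs zsd eP => [|x [|y []]] //= [xs ys] eP.
  have xS : S x.1 = Some Sort by rewrite xs; case: ifP.
  have := eP x; have := eP y; rewrite !inE !eqxx orbT => /(_ isT) + /(_ isT).
  move ey: (e y) => [c [y1 y2]]; move ex: (e x) => [b [x1 x2]] /=.
  rewrite [source x.1 _]source_old // /source ys Ss ds => yE [x1s _].
  have y1s : y1.1 = if c then s2 else s1 by case: (c) yE => -[].
  have x1S : S x1.1 = Some Sort by rewrite x1s.
  have pE : p = if p != r1 then r2 else r1.
    by case: pr => ->; rewrite ?eqxx // eq_sym r12.
  have copr (M : structure S') (w v : var Sym -> M) : is_model T' M ->
      coded e [:: x; y] w v ->
      graph p (map v [:: x; y]) <-> (p != r1 = c /\ w x1 = w y1).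
    move=> MT' cP; rewrite dE in S'p.
    have xE : w x1 = v x.
      by have := cP x; rewrite ex mem_head => /(_ isT); apply: codes_old.
    have [_ _ _] : codes s c (w y1) (w y2) (v y).
      by have := cP y; rewrite ey ys; apply; rewrite !inE eqxx orbT.
    rewrite /codes0 Ss ds xE => fy.
    rewrite -[map v _]/(rcons [:: v x] (v y)) (graph_func _ _ S'p).
    split=> [fx|[pc ->]]; last by rewrite pE pc.
    by rewrite pE in fx; apply: (coproduct_inj r1E r2E (pT M MT') fx fy).
  have [bc|bc] := eqVneq (p != r1) c.
    exists (Eq (Var x1) (Var y1)).
      by apply: is_formula_Eq_Var; rewrite // x1s xs y1s -bc; case: (p == r1).
    move=> M w v MT' wP cP; rewrite sat_Eq_Var.
    by apply: iff_trans (copr M w v MT' cP) _; rewrite bc; split=> [[]|].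
  exists (Not (Eq (Var x1) (Var x1))); first exact: is_formula_Eq_Var.
  move=> M w v MT' wP cP; apply: iff_trans (copr M w v MT' cP) _.
  split=> [[pc _]|[]]; first by rewrite pc eqxx in bc.
  by apply/sat_Eq_Var.
- move=> x0 phi Ss S's ds dE s1S x0s [fphi sub] pT.
  rewrite dE /= in zsd S'p; case: zs zsd eP => [|x [|y []]] //= [xs ys] eP.
  have yS : S y.1 = Some Sort by rewrite ys.
  have := eP x; have := eP y; rewrite !inE !eqxx orbT => /(_ isT) + /(_ isT).
  move ey: (e y) => [c [y1 y2]]; move ex: (e x) => [b [x1 x2]] /=.
  rewrite source_old // /source xs Ss ds => -[y1s _] [x1s _].
  exists (Eq (Var x1) (Var y1)).
    by apply: is_formula_Eq_Var; rewrite x1s ?y1s ?ys.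
  move=> M w v MT' wP cP.
  have [_ _ _] : codes s b (w x1) (w x2) (v x).
    by have := cP x; rewrite ex xs; apply; rewrite mem_head.
  have yE : w y1 = v y.
    by have := cP y; rewrite ey !inE eqxx orbT => /(_ isT); apply: codes_old.
  rewrite /codes0 Ss ds sat_Eq_Var yE => f.
  rewrite -[[:: v x; v y]]/(rcons [:: v x] (v y)) (graph_func _ _ S'p).
  by split=> [fy|<- //]; apply: (func1_unique S'p f fy).
- move=> u1 u2 phi Ss S's ds dE s1S u1s u2s u12 [fphi sub] pT.
  rewrite dE /= in zsd S'p; case: zs zsd eP => [|x [|y []]] //= [xs ys] eP.
  have xS : S x.1 = Some Sort by rewrite xs.
  have := eP x; have := eP y; rewrite !inE !eqxx orbT => /(_ isT) + /(_ isT).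
  move ey: (e y) => [c [y1 y2]]; move ex: (e x) => [b [x1 x2]] /=.
  rewrite [source x.1 _]source_old // /source ys Ss ds => -[y1s _] [x1s _].
  have xyu : map fst [:: x1; y1] = map fst [:: u1; u2] by rewrite /= x1s xs y1s u1s u2s.
  have uu : uniq [:: u1; u2] by rewrite /= inE u12.
  have [psi fpsi psiP] := tuple_sat_at fphi uu xyu sub.
  exists psi => // M w v MT' wP cP.
  have [_ y1s1 _] : codes s c (w y1) (w y2) (v y).
    by have := cP y; rewrite ey ys; apply; rewrite !inE eqxx orbT.
  have [xs1 _ _ _] : codes x.1 b (w x1) (w x2) (v x).
    by have := cP x; rewrite ex; apply; rewrite mem_head.
  have xE : w x1 = v x.
    by have := cP x; rewrite ex mem_head => /(_ isT); apply: codes_old.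
  rewrite /codes0 Ss ds psiP /= xE => fy.
  rewrite /source Ss ds /= in y1s1; rewrite xs in xs1.
  have [h _] := pT M MT'; rewrite -h //.
  rewrite -[[:: v x; v y]]/(rcons [:: v x] (v y)) (graph_func _ _ S'p).
  split=> [fx|[m fx fm]]; first by exists (v y).
  by rewrite (func1_unique S'p fy fm).
Qed.

Lemma has_sort_sort t s : has_sort S' t s -> S' s = Some Sort.
Proof.
case: t => [x|c|f ts] /=; first by case.
  by move=> cE; apply: (decl_sortsP cE); rewrite /= mem_head.
by move=> [ar fE _]; apply: (decl_sortsP fE); rewrite /= mem_rcons mem_head.
Qed.

Lemma eval_sort (M : structure S') (v : var Sym -> M) t s a :
  {in term_vars t, forall x, sort_of (v x) = x.1} ->
  has_sort S' t s -> eval v t a -> sort_of a = s.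
Proof.
case: t => [x|c|f ts] /= vP.
- by move=> [<- _] <-; rewrite vP ?mem_head.
- by move=> cE /const_intP; rewrite cE => -[].
- by move=> [ar fE _] [l _ /func_intP]; rewrite fE => -[].
Qed.

(** The values of a list of terms are named one after the other by fresh
    variables; the variables [ys] name the values that have been treated already.
    This reduces nested terms to relations between variables. *)
Lemma translatable_evals ts ar ys (Q : forall M : structure S', seq M -> Prop) :
  foldr (fun t R => (forall s y, has_sort S' t s -> y.1 = s -> y \notin term_vars t ->
    translatable (y :: term_vars t) (fun M v => eval v t (v y))) /\ R) True ts ->
  forall2 (has_sort S') ts ar ->
  (forall zs, map fst zs = map fst ys ++ ar ->
     translatable zs (fun M v => Q M (map v zs))) ->
  translatable (ys ++ flatten (map (@term_vars Sym) ts))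
    (fun M v => exists2 l, forall2 (eval v) ts l & Q M (map v ys ++ l)).
Proof.
elim: ts ar ys => [|t ts IH] [|s ar] ys //=.
  move=> _ _ /(_ ys); rewrite !cats0 => /(_ erefl).
  apply: eq_translatable => M v _ _; split=> [q|[[|//] _]]; last by rewrite cats0.
  by exists [::]; rewrite ?cats0.
move=> [trt trts] [ts_s tsar] trQ.
pose z : var Sym := (s, fresh_index (ys ++ term_vars t ++ flatten (map (@term_vars Sym) ts))).
have : z \notin ys ++ term_vars t ++ flatten (map (@term_vars Sym) ts) by apply: fresh_notin.
rewrite !mem_cat !negb_or => /and3P[zys zt zts].
have {}trt := trt s z ts_s erefl zt.
have {}IH := IH ar (rcons ys z) trts tsar.
have {IH}trts : translatable (rcons ys z ++ flatten (map (@term_vars Sym) ts))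
    (fun M v => exists2 l, forall2 (eval v) ts l & Q M (map v (rcons ys z) ++ l)).
  by apply: IH => zs zsE; apply: trQ; rewrite zsE map_rcons cat_rcons.
have zS : S' z.1 = Some Sort by apply: has_sort_sort ts_s.
have := translatable_binary (c := @And Sym) (op := and) _ _ trt trts.
move=> /(_ (fun _ _ => erefl)) /(_ (fun _ _ _ _ => erefl)).
move=> /(@translatable_ex _ (ys ++ term_vars t ++ flatten (map (@term_vars Sym) ts)) _ _ zS) H.
apply: eq_translatable (H _) => {H} [M v MT' vP|x]; last first.
  rewrite !(inE, mem_cat, mem_rcons); case: (x == z) => //=.
  by case: (x \in term_vars t); case: (x \in ys).
have upd_ys m : map [eta v with z |-> m] ys = map v ys.
  by apply/eq_in_map => x xys /=; case: eqP => // xz; rewrite -xz xys in zys.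
have upd_t m : eval [eta v with z |-> m] t = eval v t.
  by apply: eval_free => x xt /=; case: eqP => // xz; rewrite -xz xt in zt.
have upd_ts m : forall2 (eval [eta v with z |-> m]) ts = forall2 (eval v) ts.
  by apply: evals_free => x xts /=; case: eqP => // xz; rewrite -xz xts in zts.
split=> [[m mz [tm [l tsl q]]]|[[|m l] // [tm tsl] q]].
  move: q; rewrite map_rcons upd_ys cat_rcons; rewrite /= eqxx => q.
  rewrite upd_t /= eqxx in tm; rewrite upd_ts in tsl.
  by exists (m :: l).
exists m; first by apply: eval_sort ts_s tm => x xt; apply: vP; rewrite !mem_cat xt orbT.
split; first by rewrite upd_t /= eqxx.
by exists l; rewrite ?upd_ts // map_rcons upd_ys cat_rcons /= eqxx.
Qed.

(** In the last case the value [y] goes in front of the arguments, because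
    [translatable_evals] accumulates the new variables at the end. *)
Lemma translatable_eval t s y : has_sort S' t s -> y.1 = s -> y \notin term_vars t ->
  translatable (y :: term_vars t) (fun M v => eval v t (v y)).
Proof.
elim/term_nested_ind: t s y => [x|c|f ts IH] s y /=.
- move=> [xs sS] ys _; apply: (@sub_translatable [:: x; y]).
    by move=> z; rewrite !inE orbC.
  by apply: translatable_eq; rewrite xs ?ys.
- move=> cE ys _.
  have := @translatable_symbol c (Const s) [:: y] cE; rewrite /= ys.
  move=> /(_ ltac:(by []) erefl); apply: eq_translatable => M v _ _.
  exact: graph_const cE.
- move=> [ar fE tsar] ys _.
  pose Q (M : structure S') (l : seq M) :=
    if l is a :: l' then func_int f l' a else False.
  apply: eq_translatable (@translatable_evals ts ar [:: y] Q IH tsar _) => //.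
  case=> [//|z zs] [zy zsar].
  have := @translatable_symbol f (Func ar s) (rcons zs z) fE.
  rewrite map_rcons zsar zy ys => /(_ ltac:(by []) erefl) trf.
  apply: eq_translatable (sub_translatable _ trf) => [M v _ _ /=|x].
    by rewrite map_rcons (graph_func _ _ fE).
  by rewrite mem_rcons.
Qed.

Lemma translatable_evals_in ts ar (Q : forall M : structure S', seq M -> Prop) :
  forall2 (has_sort S') ts ar ->
  (forall zs, map fst zs = ar -> translatable zs (fun M v => Q M (map v zs))) ->
  translatable (flatten (map (@term_vars Sym) ts))
    (fun M v => exists2 l, forall2 (eval v) ts l & Q M l).
Proof.
move=> tsar trQ; apply: (@translatable_evals ts ar [::] Q) => //.
elim: ts {tsar} => //= t ts IH; split=> // s y; exact: translatable_eval.
Qed.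

Lemma translatable_sat phi : is_formula S' phi ->
  translatable (free_vars phi) (fun M v => sat v phi).
Proof.
elim: phi => [t u|p ts|a IH|a IHa b IHb|a IHa b IHb|a IHa b IHb
    |a IHa b IHb|x a IH|x a IH] /=.
- move=> [s ts us].
  pose Q (M : structure S') (l : seq M) := if l is [:: a; b] then a = b else False.
  have -> : term_vars t ++ term_vars u = flatten (map (@term_vars Sym) [:: t; u]).
    by rewrite /= cats0.
  apply: eq_translatable (@translatable_evals_in [:: t; u] [:: s; s] Q _ _) => //.
    move=> M v _ _; split=> [[[|a [|b [|]]] //= [ta [ub _]] ab]|[a ta ua]].
      by exists a; rewrite // ab.
    by exists [:: a; a].
  case=> [|x [|y [|]]] //= [xs ys]; apply: translatable_eq; last by rewrite xs.
  by rewrite xs; apply: has_sort_sort ts.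
- move=> [ar pE tsar]; apply: translatable_evals_in tsar _ => zs zsar.
  have := translatable_symbol pE _ zsar => /(_ ltac:(by [])).
  by apply: eq_translatable => M v _ _; apply: graph_pred pE.
- by move=> /IH; apply: translatable_not.
1-4: move=> [/IHa tra /IHb trb].
- exact: (translatable_binary (c := @And Sym) (op := and)).
- exact: (translatable_binary (c := @Or Sym) (op := or)).
- exact: (translatable_binary (c := @Imp Sym) (op := fun P Q => P -> Q)).
- exact: (translatable_binary (c := @Iff Sym) (op := iff)).
- move=> [xS /IH/translatable_not tra].
  have /(translatable_ex xS)/(_ tra)/translatable_not :
      {subset free_vars a <= x :: [seq y <- free_vars a | y != x]}.
    by move=> y ya; rewrite inE mem_filter ya andbT orbN.
  apply: eq_translatable => M v _ _; split=> [h m mx|h [m mx]]; last by apply; apply: h.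
  by apply: contrapT => na; apply: h; exists m.
- move=> [xS /IH tra].
  have /(translatable_ex xS)/(_ tra) :
      {subset free_vars a <= x :: [seq y <- free_vars a | y != x]}.
    by move=> y ya; rewrite inE mem_filter ya andbT orbN.
  by [].
Qed.

(** * The reduct functor *)

Lemma has_sort_sub t s : has_sort S t s -> has_sort S' t s.
Proof.
elim/term_nested_ind: t s => [x|c|f ts IH] s /=.
- by move=> [-> /subS].
- by move/subS.
- move=> [ar /subS fE tsar]; exists ar => //.
  elim: ts ar {fE} tsar IH => [|t ts IHts] [|s0 ar] //= [ts0 tsar] [IHt IH].
  by split; [apply: IHt|apply: IHts].
Qed.

Lemma is_formula_sub phi : is_formula S phi -> is_formula S' phi.
Proof.
elim: phi => [t u|p ts|a IH|a IHa b IHb|a IHa b IHb|a IHa b IHb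
    |a IHa b IHb|x a IH|x a IH] //=.
- by move=> [s /has_sort_sub ts /has_sort_sub us]; exists s.
- move=> [ar /subS pE tsar]; exists ar => //.
  elim: ts ar {pE} tsar => [|t ts IHts] [|s0 ar] //= [ts0 tsar].
  by split; [apply: has_sort_sub|apply: IHts].
1-4: by move=> [/IHa fa /IHb fb].
1-2: by move=> [/subS xS /IH fa].
Qed.

Section Reduct.
Variable M : structure S'.

Definition old_part := {m : M | S (sort_of m) = Some Sort}.
Definition reduct_sort (a : old_part) := sort_of (sval a).
Definition reduct_pred p (l : seq old_part) := S p <> None /\ pred_int p (map sval l).
Definition reduct_func f (l : seq old_part) (a : old_part) :=
  S f <> None /\ func_int f (map sval l) (sval a).
Definition reduct_const c (a : old_part) := S c <> None /\ const_int c (sval a).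

Lemma decl_sub p d : S p <> None -> S' p = Some d -> S p = Some d.
Proof. by case Sp: (S p) => [d'|] // _; rewrite (subS Sp). Qed.

Lemma reduct_sorts (l : seq old_part) :
  map reduct_sort l = map (@sort_of _ _ M) (map sval l).
Proof. by rewrite -map_comp. Qed.

Definition reduct : structure S.
Proof.
refine (@Structure Sym S old_part reduct_sort _ _ reduct_pred _ reduct_func _ _
  reduct_const _ _).
- by case.
- move=> s sS; have [m ms] := @sort_nonempty _ _ M s (subS sS).
  by rewrite -ms in sS; exists (exist _ m sS).
- by move=> p l [Sp /pred_intP]; rewrite reduct_sorts; apply: decl_sub.
- by move=> f l a [Sf /func_intP]; rewrite reduct_sorts; apply: decl_sub.
- move=> f l s fE; have := subS fE; rewrite reduct_sorts => /func_int_total[m [fm um]].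
  have mS : S (sort_of m) = Some Sort.
    have := func_intP fm; rewrite -reduct_sorts (subS fE) => -[<-].
    by apply: (decl_sortsP fE); rewrite /= mem_rcons mem_head.
  exists (exist _ m mS); split; first by split; rewrite // fE.
  by move=> [m' m'S] [_ /= /um mm']; apply: eq_exist.
- by move=> c a [Sc /const_intP]; apply: decl_sub.
- move=> c s cE; have [m [cm um]] := @const_int_total _ _ M c s (subS cE).
  have mS : S (sort_of m) = Some Sort.
    have := const_intP cm; rewrite (subS cE) => -[<-].
    by apply: (decl_sortsP cE); rewrite /= mem_head.
  exists (exist _ m mS); split; first by split; rewrite // cE.
  by move=> [m' m'S] [_ /= /um mm']; apply: eq_exist.
Defined.

Lemma reductP : @identifies_reduct Sym S S' reduct M sval.
Proof.
split=> //.
- by move=> [m mS] [m' m'S] /= mm'; apply: eq_exist.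
- by move=> m mS; exists (exist _ m mS).
- by move=> p l Sp; split=> [pl|[]//]; split.
- by move=> f l a Sf; split=> [fl|[]//]; split.
- by move=> c a Sc; split=> [ca|[]//]; split.
Qed.

Lemma reduct_model : is_model T' M -> is_model T reduct.
Proof.
move=> MT' phi Tphi; have [fphi phi0] := sentencesP Tphi.
apply/(holds_closed _ phi0) => v; apply/(sat_expansion reductP subS v fphi).
by apply: (holds_closed M phi0).1; apply: ((modelP M).1 MT').1.
Qed.

Lemma restrict_old_assignment (w : var Sym -> M) : old_assignment w ->
  exists2 u : var Sym -> reduct, assignment u &
    forall x, S x.1 = Some Sort -> sval (u x) = w x.
Proof.
move=> wP; have [u0 _] := assignment_exists reduct.
have u_ex x : exists a : reduct, S x.1 = Some Sort -> sval a = w x.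
  have [xS|nxS] := pselect (S x.1 = Some Sort); last by exists (u0 x).
  by have wxS := wP x xS; rewrite -wxS in xS; exists (exist _ (w x) xS).
have [u uP] := choice u_ex; exists u => // x xS.
by rewrite -(ir_sort reductP) uP // wP.
Qed.

End Reduct.

(** An assignment that is correct on the sorts of [S] suffices, since a formula of
    [S] has no free variables of other sorts. *)
Lemma elementary_old (M N : structure S') (h : M -> N) : elementary h ->
  forall phi, is_formula S phi -> forall w : var Sym -> M, old_assignment w ->
  (sat w phi <-> sat (h \o w) phi).
Proof.
move=> [hs hsat] phi fphi w wP; have [v0 v0P] := assignment_exists M.
have v_ex x : exists m : M, (S x.1 = Some Sort -> m = w x) /\
    (S' x.1 = Some Sort -> sort_of m = x.1).
  have [xS|nxS] := pselect (S x.1 = Some Sort); first by exists (w x); rewrite wP.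
  by exists (v0 x); split=> // /v0P.
have [v vP] := choice v_ex.
have vw : {in free_vars phi, v =1 w} by move=> x /(free_vars_sorted fphi); apply: (vP x).1.
rewrite -(sat_free vw) (hsat _ (is_formula_sub fphi)); last by move=> x; apply: (vP x).2.
by rewrite (@sat_free _ _ _ (h \o v) (h \o w)) // => x xphi /=; rewrite vw.
Qed.

Lemma reduct_map_proof (M N : structure S') (h : M -> N) : elementary h ->
  forall a : reduct M, S (sort_of (h (sval a))) = Some Sort.
Proof. by move=> [hs _] [m mS]; rewrite hs. Qed.

Definition reduct_map (M N : structure S') (h : M -> N) (hP : elementary h) :
  reduct M -> reduct N := fun a => exist _ (h (sval a)) (reduct_map_proof hP a).

Lemma reduct_map_elementary (M N : structure S') (h : M -> N) (hP : elementary h) :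
  elementary (reduct_map hP).
Proof.
split=> [[m mS]|phi fphi v vP]; first exact: (proj1 hP m).
rewrite (sat_expansion (reductP M) subS v fphi).
rewrite (sat_expansion (reductP N) subS (reduct_map hP \o v) fphi).
by apply: (elementary_old hP fphi) => x xS /=; rewrite -[RHS]vP.
Qed.

Definition reduct_functor : functor (Mod T') (Mod T).
Proof.
refine (@Functor (Mod T') (Mod T)
  (fun M => exist _ (reduct (sval M)) (reduct_model (svalP M)))
  (fun M N h => exist _ (reduct_map (svalP h)) (reduct_map_elementary (svalP h))) _ _).
- by move=> M; apply: eq_exist; apply: funext => -[m mS]; apply: eq_exist.
- by move=> M N P f g; apply: eq_exist; apply: funext => -[m mS]; apply: eq_exist.
Defined.

(** Elementarity, applied to an equation [f(x) = y] between variables. *)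
Lemma elementary_func1 (M N : structure S') (h : M -> N) f s s' (a b : M) :
  elementary h -> S' f = Some (Func [:: s] s') ->
  func_int f [:: a] b -> func_int f [:: h a] (h b).
Proof.
move=> [hs hsat] fE fab; have [as_ bs'] := func1_sort fE fab.
have [v vP] := assignment_exists M.
pose x : var Sym := (s, 0); pose y : var Sym := (s', 1).
have xy : (x == y) = false by rewrite xpair_eqE andbF.
pose v' := [eta [eta v with x |-> a] with y |-> b].
have v'P : assignment v'.
  move=> z zS; rewrite /v' /=; case: eqP => [->//|_]; case: eqP => [->//|_].
  exact: vP.
have fphi : is_formula S' (Eq (App f (map (@Var Sym) [:: x])) (Var y)).
  have S'y : S' s' = Some Sort by rewrite -bs'; apply: sort_ofP.
  have S'x : S' s = Some Sort by rewrite -as_; apply: sort_ofP.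
  by exists s' => //; exists [:: s].
have := hsat _ fphi v' v'P; rewrite !sat_Eq_App_Var /= !eqxx xy => H.
exact/H.
Qed.

Lemma elementary_codes (M N : structure S') (h : M -> N) s b (a1 a2 m : M) :
  elementary h -> codes s b a1 a2 m -> codes s b (h a1) (h a2) (h m).
Proof.
move=> hP [ms a1s a2s c]; have hs := hP.1.
have S's : S' s = Some Sort by rewrite -ms; apply: sort_ofP.
split; rewrite ?hs //; move: c; rewrite /codes0.
case Ss: (S s) => [d|]; first by move=> ->.
case: (new_sortP S's Ss) => /=.
- move=> s1 s2 pi1 pi2 h1 h2 h3 h4 h5 h6 h7 h8 h9 [f1 f2].
  by split; [apply: elementary_func1 hP h4 f1|apply: elementary_func1 hP h6 f2].
- move=> s1 s2 r1 r2 h1 h2 h3 h4 h5 h6 h7 h8 h9.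
  by case: b {a1s a2s} => f; [apply: elementary_func1 hP h6 f|apply: elementary_func1 hP h4 f].
- by move=> s1 i x phi h1 h2 h3 h4 h5 h6; apply: elementary_func1 hP h3.
- by move=> s1 i x1 x2 phi h1 h2 h3 h4 h5 h6 h7 h8; apply: elementary_func1 hP h3.
Qed.

(** An element of a new sort is determined by its code, and the graphs of the
    functions that relate them are preserved by elementary embeddings. *)
Lemma reduct_faithful : faithful reduct_functor.
Proof.
move=> [M MT'] [N NT'] [f fP] [g gP] /= /(congr1 sval) /= fg.
apply: eq_exist; apply: funext => m.
have fg_old (a : M) : S (sort_of a) = Some Sort -> f a = g a.
  move=> aS; have := congr1 (fun k => sval (k (exist _ a aS))) fg.
  by [].
have [b [a1 [a2 c]]] := codes_exist MT' m.
have [aS1 aS2] := source_sort b (sort_ofP m).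
have E1 : f a1 = g a1 by apply: fg_old; rewrite (codes_sort1 c).
have E2 : f a2 = g a2 by apply: fg_old; rewrite (codes_sort2 c).
have := elementary_codes fP c; rewrite E1 E2 => cf.
exact: (codes_unique NT' cf (elementary_codes gP c)).
Qed.

(** Codes exist for the values of finitely many variables at once, since fresh
    variables are available for their components. *)
Lemma coded_exists (M : structure S') xs (v : var Sym -> M) : is_model T' M ->
  {in xs, forall x, sort_of (v x) = x.1} ->
  exists e w, [/\ env_sorted e xs, old_assignment w & coded e xs w v].
Proof.
move=> MT'; elim: xs => [|x xs IH] vP.
  have [w wP] := old_assignment_exists M.
  by exists (fun x => (false, (x, x))), w.
have [|e [w [eP wP cP]]] := IH; first by move=> y yxs; rewrite vP // inE yxs orbT.
have [b [a1 [a2 c]]] := codes_exist MT' (v x).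
rewrite vP ?mem_head // in c.
pose n := fresh_index (code_vars e xs).
pose z1 : var Sym := ((source x.1 b).1, n); pose z2 : var Sym := ((source x.1 b).2, n.+1).
have z12 : (z1 == z2) = false by apply/eqP => -[_ /eqP]; rewrite ltn_eqF.
exists [eta e with x |-> (b, (z1, z2))].
exists [eta [eta w with z1 |-> a1] with z2 |-> a2].
split.
- move=> y; rewrite inE /=; case: (eqVneq y x) => [->|_] //= yxs.
    by rewrite -surjective_pairing.
  exact: eP.
- apply: old_assignment_upd; last exact: codes_sort2 c.
  apply: old_assignment_upd => //; exact: codes_sort1 c.
move=> y; rewrite inE /=; case: (eqVneq y x) => [->|_] /= yxs.
  by rewrite eqxx z12 eqxx.
have [f1 f2] := fresh_code (source x.1 b).1 yxs (leqnn n).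
have [f3 f4] := fresh_code (source x.1 b).2 yxs (leqnSn n).
rewrite f1 f2 f3 f4; exact: cP.
Qed.

Section Full.
Variables (M N : structure S').
Hypotheses (MT' : is_model T' M) (NT' : is_model T' N).
Variable g : reduct M -> reduct N.
Hypothesis gP : elementary g.

(** Formulas of [S] are evaluated in [M] and [N] rather than in the reducts, for
    which [g] is extended arbitrarily to the elements of the new sorts. *)
Lemma total_extension : exists g' : M -> N,
  [/\ forall a, g' (sval a) = sval (g a),
      forall w : var Sym -> M, old_assignment w -> old_assignment (g' \o w)
    & forall phi, is_formula S phi -> forall w : var Sym -> M, old_assignment w ->
      (sat w phi <-> sat (g' \o w) phi)].
Proof.
have g_ex (m : M) : exists n : N, forall a, sval a = m -> n = sval (g a).
  have [mS|nmS] := pselect (S (sort_of m) = Some Sort).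
    exists (sval (g (exist _ m mS))) => -[m' m'S] /= mm'.
    by congr (sval (g _)); apply: eq_exist.
  have [v _] := assignment_exists N.
  have [s _] := has_a_sort S; exists (v (s, 0)) => -[m' m'S] /= mm'.
  by case: nmS; rewrite -mm'.
have [g' g'P] := choice g_ex.
have g'E a : g' (sval a) = sval (g a) by apply: g'P.
exists g'; split=> // [w wP x xS|phi fphi w wP].
  have [u uP uw] := restrict_old_assignment wP.
  rewrite /= -uw // g'E -[LHS]/(sort_of (g (u x))).
  by rewrite gP.1 uP.
have [u uP uw] := restrict_old_assignment wP.
rewrite -(@sat_free _ _ _ (sval \o u)); last first.
  by move=> x /(free_vars_sorted fphi) xS /=; rewrite uw.
rewrite -(sat_expansion (reductP M) subS u fphi) (gP.2 phi fphi u uP).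
rewrite (sat_expansion (reductP N) subS (g \o u) fphi).
rewrite (@sat_free _ _ _ (sval \o (g \o u)) (g' \o w)) // => x.
by move=> /(free_vars_sorted fphi) xS /=; rewrite -uw.
Qed.

(** The image of an element is the element with the image code.  It exists
    because the domain of codes is defined by a formula of [S], it does not
    depend on the chosen code because equality of coded elements is
    translatable, and the resulting map is elementary because all formulas
    are. *)
Lemma elementary_lift : exists2 h : M -> N, elementary h &
  forall a, h (sval a) = sval (g a).
Proof.
have [g' [g'E g'old g'sat]] := total_extension.
have image_exists s b (a1 a2 m : M) : codes s b a1 a2 m ->
    exists n, codes s b (g' a1) (g' a2) n.
  move=> c; have S's : S' s = Some Sort by rewrite -(codes_sort c); apply: sort_ofP.
  pose z1 : var Sym := ((source s b).1, 0); pose z2 : var Sym := ((source s b).2, 1).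
  have z12 : (z1 == z2) = false by rewrite xpair_eqE andbF.
  have [|psi fpsi psiP] := @code_domain s b z1 z2 S's.
    by rewrite -surjective_pairing.
  have [w wP] := old_assignment_exists M.
  pose w' := [eta [eta w with z1 |-> a1] with z2 |-> a2].
  have w'P : old_assignment w'.
    apply: old_assignment_upd; last exact: codes_sort2 c.
    apply: old_assignment_upd => //; exact: codes_sort1 c.
  have [_] := psiP M w' MT' w'P.
  have -> : w' z1 = a1 by rewrite /= z12 eqxx.
  have -> : w' z2 = a2 by rewrite /= eqxx.
  move=> /(_ (ex_intro _ m c)) /(g'sat _ fpsi _ w'P) /(psiP N _ NT' (g'old _ w'P)).
  by rewrite /= z12 !eqxx.
have h_ex (m : M) : exists n : N, exists b a1 a2,
    codes (sort_of m) b a1 a2 m /\ codes (sort_of m) b (g' a1) (g' a2) n.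
  have [b [a1 [a2 c]]] := codes_exist MT' m.
  by have [n cn] := image_exists _ _ _ _ _ c; exists n, b, a1, a2.
have [h hP] := choice h_ex.
have h_codes s b a1 a2 (m : M) : codes s b a1 a2 m -> codes s b (g' a1) (g' a2) (h m).
  move=> c; have [b' [a1' [a2' []]]] := hP m; rewrite (codes_sort c) => c' ch.
  have [n cn] := image_exists _ _ _ _ _ c.
  suff <- : n = h m by [].
  have S's : S' s = Some Sort by rewrite -(codes_sort c); apply: sort_ofP.
  pose x : var Sym := (s, 0); pose y : var Sym := (s, 1).
  have xy : (y == x) = false by rewrite xpair_eqE andbF.
  pose z1 : var Sym := ((source s b).1, 0); pose z2 : var Sym := ((source s b).2, 1).
  pose y1 : var Sym := ((source s b').1, 2); pose y2 : var Sym := ((source s b').2, 3).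
  pose e : env := fun u => if u == x then (b, (z1, z2)) else (b', (y1, y2)).
  have eP : env_sorted e [:: x; y].
    move=> u; rewrite !inE /e => /orP[] /eqP ->; rewrite ?xy ?eqxx /=.
      by rewrite -surjective_pairing.
    by rewrite -surjective_pairing.
  have [psi fpsi psiP] := @translatable_eq x y S's erefl e eP.
  have [w wP] := old_assignment_exists M.
  pose w' := [eta [eta [eta [eta w with z1 |-> a1] with z2 |-> a2]
    with y1 |-> a1'] with y2 |-> a2'].
  have w'P : old_assignment w'.
    apply: old_assignment_upd; last exact: codes_sort2 c'.
    apply: old_assignment_upd; last exact: codes_sort1 c'.
    apply: old_assignment_upd; last exact: codes_sort2 c.
    by apply: old_assignment_upd; last exact: codes_sort1 c.
  have w1 : w' z1 = a1 by rewrite /w' /= !xpair_eqE ?andbF ?eqxx.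
  have w2 : w' z2 = a2 by rewrite /w' /= !xpair_eqE ?andbF ?eqxx.
  have w3 : w' y1 = a1' by rewrite /w' /= !xpair_eqE ?andbF ?eqxx.
  have w4 : w' y2 = a2' by rewrite /w' /= eqxx.
  have cM : coded e [:: x; y] w' (fun=> m).
    move=> u; rewrite !inE /e => /orP[] /eqP ->; rewrite ?xy ?eqxx.
      by rewrite -[codes _ _ _ _ _]/(codes s b (w' z1) (w' z2) m) w1 w2.
    by rewrite -[codes _ _ _ _ _]/(codes s b' (w' y1) (w' y2) m) w3 w4.
  pose v u := if u == x then n else h m.
  have cN : coded e [:: x; y] (g' \o w') v.
    move=> u; rewrite !inE /e /v => /orP[] /eqP ->; rewrite ?xy ?eqxx.
      by rewrite -[codes _ _ _ _ _]/(codes s b (g' (w' z1)) (g' (w' z2)) n) w1 w2.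
    by rewrite -[codes _ _ _ _ _]/(codes s b' (g' (w' y1)) (g' (w' y2)) (h m)) w3 w4.
  have /(g'sat _ fpsi _ w'P) : sat w' psi by apply/(psiP M w' _ MT' w'P cM).
  move=> /(psiP N _ _ NT' (g'old _ w'P) cN).
  by rewrite /v eqxx xy.
have hs (m : M) : sort_of (h m) = sort_of m.
  by have [b [a1 [a2 [c /codes_sort]]]] := hP m.
exists h; last first.
  move=> a; have aS : S (sort_of (sval a)) = Some Sort := svalP a.
  have c := old_codes false aS.
  by rewrite -g'E (codes_old aS (h_codes _ _ _ _ _ c)).
split=> // phi fphi v vP.
have vs : {in free_vars phi, forall x, sort_of (v x) = x.1}.
  by move=> x xphi; apply: vP; apply: free_vars_sorted fphi x xphi.
have [e [w [eP wP cP]]] := coded_exists MT' vs.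
have [psi fpsi psiP] := translatable_sat fphi eP.
rewrite (psiP M w v MT' wP cP) (g'sat _ fpsi _ wP).
apply: iff_sym; apply: psiP NT' (g'old _ wP) _ => x xphi.
exact: h_codes (cP x xphi).
Qed.

End Full.

Lemma reduct_full : full reduct_functor.
Proof.
move=> [M MT'] [N NT'] [g gP].
have [h hP hg] := elementary_lift MT' NT' gP.
exists (exist _ h hP); apply: eq_exist; apply: funext => -[m mS].
case gE: (g _) => [n nS]; apply: eq_exist => /=.
by rewrite (hg (exist _ m mS)) gE.
Qed.

(** * Expanding a structure by the defined symbols *)

Hypothesis defA : forall A : structure S, is_model T A ->
  forall p, S' p <> None -> S p = None -> shape_admissible S' A (def p).

Section Expand.
Variables (A : structure S) (AT : is_model T A).

Definition pick (P : A -> Prop) (a : A) : A :=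
  if pselect (exists b, P b) is left h then sval (cid h) else a.

(** Equivalent elements define the same predicate, which is inhabited by
    reflexivity, and [pick] then depends on the predicate alone; hence they get
    the same representative. *)
Definition repr (s : Sym) (x1 x2 : var Sym) phi (a : A) : A :=
  pick (fun b => sort_of b = s /\ tuple_sat [:: x1; x2] phi [:: a; b]) a.

Lemma pickP (P : A -> Prop) a : (exists b, P b) -> P (pick P a).
Proof. by move=> h; rewrite /pick; case: pselect => // h'; apply: svalP. Qed.

Lemma pick_default (P : A -> Prop) a a' : (exists b, P b) -> pick P a = pick P a'.
Proof. by move=> h; rewrite /pick; case: pselect. Qed.

(** The elements of a new sort are codes in normal form: the components that do
    not matter are fixed, and classes are given by their representatives. *)
Definition normal_code (s : Sym) (b : bool) (a1 a2 : A) : Prop :=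
  match def s with
  | ShProduct _ s1 s2 _ _ => [/\ b = false, sort_of a1 = s1 & sort_of a2 = s2]
  | ShCoproduct _ s1 s2 _ _ => a2 = a1 /\ sort_of a1 = if b then s2 else s1
  | ShSubsort _ s1 _ x phi =>
      [/\ b = false, a2 = a1, sort_of a1 = s1 & tuple_sat [:: x] phi [:: a1]]
  | ShQuotient _ s1 _ x1 x2 phi =>
      [/\ b = false, a2 = a1, sort_of a1 = s1 & repr s1 x1 x2 phi a1 = a1]
  | _ => False
  end.

Record new_element := NewElement {
  ne_sort : Sym;
  ne_bool : bool;
  ne_fst : A;
  ne_snd : A;
  ne_old : S ne_sort = None;
  ne_new : S' ne_sort = Some Sort;
  ne_normal : normal_code ne_sort ne_bool ne_fst ne_snd
}.

Lemma new_element_eq (c d : new_element) : ne_sort c = ne_sort d ->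
  ne_bool c = ne_bool d -> ne_fst c = ne_fst d -> ne_snd c = ne_snd d -> c = d.
Proof.
case: c d => [s b a1 a2 p q r] [s' b' a1' a2' p' q' r'] /= ss bb aa1 aa2.
case: _ / ss in p' q' r' *; case: _ / bb in r' *.
case: _ / aa1 in r' *; case: _ / aa2 in r' *.
by rewrite (Prop_irrelevance p p') (Prop_irrelevance q q') (Prop_irrelevance r r').
Qed.

Definition ex_dom := (A + new_element)%type.

Definition ex_sort (m : ex_dom) : Sym :=
  match m with inl a => sort_of a | inr c => ne_sort c end.

Definition old_graph p (l : seq A) : Prop :=
  match S p, def p with
  | Some _, _ => graph p l
  | None, ShGraph _ vs phi => tuple_sat vs phi l
  | None, _ => False
  end.

(** The accompanying functions on normal codes: components of the code, the tagged
    code, and the code of the representative. *)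
Definition code_graph f (l : seq ex_dom) (m : ex_dom) : Prop :=
  match def f, l, m with
  | ShProduct _ _ _ pi1 _, [:: inr c], inl a =>
      a = if f == pi1 then ne_fst c else ne_snd c
  | ShCoproduct _ _ _ r1 _, [:: inl a], inr c => a = ne_fst c /\ ne_bool c = (f != r1)
  | ShSubsort _ _ _ _ _, [:: inr c], inl a => a = ne_fst c
  | ShQuotient _ s1 _ x1 x2 phi, [:: inl a], inr c => ne_fst c = repr s1 x1 x2 phi a
  | _, _, _ => False
  end.

Definition old_tuples (P : seq A -> Prop) (l : seq ex_dom) : Prop :=
  exists2 l0, l = map inl l0 & P l0.

Definition ex_pred p (l : seq ex_dom) : Prop :=
  S' p = Some (Pred (map ex_sort l)) /\ old_tuples (old_graph p) l.

Definition ex_func f (l : seq ex_dom) (m : ex_dom) : Prop :=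
  S' f = Some (Func (map ex_sort l) (ex_sort m)) /\
  (old_tuples (old_graph f) (rcons l m) \/ S f = None /\ code_graph f l m).

Definition ex_const c (m : ex_dom) : Prop :=
  S' c = Some (Const (ex_sort m)) /\ old_tuples (old_graph c) [:: m].

Lemma ex_sorts (l : seq A) : map ex_sort (map inl l) = map (@sort_of _ _ A) l.
Proof. by rewrite -map_comp. Qed.

Lemma inl_inj (l l' : seq A) :
  map inl l = map inl l' :> seq ex_dom -> l = l'.
Proof. by elim: l l' => [|a l IH] [|a' l'] //= [-> /IH ->]. Qed.

Lemma ex_old (m : ex_dom) : S (ex_sort m) = Some Sort -> exists a, m = inl a.
Proof. by case: m => [a|c] /=; [exists a|rewrite ne_old]. Qed.

Lemma ex_new (m : ex_dom) s : ex_sort m = s -> S s = None ->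
  exists2 c, m = inr c & ne_sort c = s.
Proof. by case: m => [a|c] /= <-; [rewrite sort_ofP|exists c]. Qed.

Lemma ex_olds (l : seq ex_dom) : {in map ex_sort l, forall s, S s = Some Sort} ->
  exists l0, l = map inl l0.
Proof.
elim: l => [|m l IH] lS; first by exists [::].
have [|a ->] := @ex_old m; first by apply: lS; rewrite mem_head.
have [s sl|l0 ->] := IH; first by apply: lS; rewrite inE sl orbT.
by exists (a :: l0).
Qed.

(** The symbols whose interpretation is a relation on the old elements. *)
Definition relation_symbol p : Prop :=
  S p <> None \/ exists vs phi, def p = ShGraph p vs phi.

Lemma relation_symbol_sorts p d : S' p = Some d -> d <> Sort ->
  relation_symbol p -> {in decl_sorts d, forall s, S s = Some Sort}.
Proof.
move=> S'p dS oldp s sd; case Sp: (S p) => [d'|].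
  by have := subS Sp; rewrite S'p => -[dd']; apply: (decl_sortsP Sp); rewrite -dd'.
case: oldp => [|[vs [phi dp]]]; first by rewrite Sp.
have := new_symbolP S'p dS Sp; rewrite dp => sd'.
by inversion sd'; auto.
Qed.

Lemma ex_func_code f l m : S f = None ->
  (forall q vs phi, def f <> ShGraph q vs phi) ->
  ex_func f l m -> code_graph f l m.
Proof.
move=> Sf nog [_ [[l0 _]|[]//]]; rewrite /old_graph Sf.
by case: (def f) nog => // q vs phi /(_ q vs phi).
Qed.

(** For a defined symbol this is its admissibility condition. *)
Lemma old_graph_unique f ar s (l0 : seq A) : S' f = Some (Func ar s) ->
  relation_symbol f ->
  map (@sort_of _ _ A) l0 = ar ->
  exists! a : A, sort_of a = s /\ old_graph f (rcons l0 a).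
Proof.
move=> S'f oldf l0ar; rewrite /old_graph.
case Sf: (S f) oldf => [d|] oldf.
  have Sf' : S f = Some (Func ar s).
    by rewrite Sf; have := subS Sf; rewrite S'f => -[<-].
  have [a [fa ua]] := @func_int_total _ _ A f l0 s ltac:(by rewrite l0ar).
  exists a; split.
    split; last by apply/(graph_func _ _ Sf').
    by have := func_intP fa; rewrite Sf' => -[].
  by move=> b [_ /(graph_func _ _ Sf') /ua].
case: oldf => [//|[vs [phi df]]].
have := defA AT; move=> /(_ f); rewrite S'f df /= S'f; apply => //.
Qed.

Section Representatives.
Variables (s s1 eps : Sym) (x1 x2 : var Sym) (phi : formula Sym).
Hypotheses (Ss : S s = None) (S's : S' s = Some Sort).
Hypothesis sE : def s = ShQuotient s s1 eps x1 x2 phi.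

Let R a b := tuple_sat [:: x1; x2] phi [:: a : A; b : A].

Lemma quotient_equivalence :
  [/\ forall a : A, sort_of a = s1 -> R a a,
      forall a b : A, sort_of a = s1 -> sort_of b = s1 -> R a b -> R b a
    & forall a b c : A, sort_of a = s1 -> sort_of b = s1 -> sort_of c = s1 ->
        R a b -> R b c -> R a c].
Proof. by have := @defA A AT s; rewrite S's sE; apply. Qed.

(** This is where the admissibility of a quotient is used. *)
Lemma repr_eq a b : sort_of a = s1 -> sort_of b = s1 ->
  R a b <-> repr s1 x1 x2 phi a = repr s1 x1 x2 phi b.
Proof.
have [Rrefl Rsym Rtrans] := quotient_equivalence.
have reprP c : sort_of c = s1 ->
    sort_of (repr s1 x1 x2 phi c) = s1 /\ R c (repr s1 x1 x2 phi c).
  move=> cs; apply: (@pickP (fun d => sort_of d = s1 /\ R c d)).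
  by exists c; split=> //; apply: Rrefl.
move=> as_ bs; split=> [Rab|rab].
  have PE : (fun c => sort_of c = s1 /\ R a c) = (fun c => sort_of c = s1 /\ R b c).
    apply: funext => c; apply: propext; split=> -[cs Rc]; split=> //.
      by apply: (Rtrans b a c) => //; apply: Rsym.
    exact: (Rtrans a b c).
  rewrite /repr -/R PE; apply: pick_default.
  by exists b; split=> //; apply: Rrefl.
have [ras Ra] := reprP a as_; have [rbs Rb] := reprP b bs.
apply: (Rtrans _ _ _ as_ ras bs Ra); rewrite rab; exact: Rsym.
Qed.

Lemma repr_props a : sort_of a = s1 ->
  sort_of (repr s1 x1 x2 phi a) = s1 /\
  repr s1 x1 x2 phi (repr s1 x1 x2 phi a) = repr s1 x1 x2 phi a.
Proof.
have [Rrefl Rsym Rtrans] := quotient_equivalence => as_.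
have [ras Ra] : sort_of (repr s1 x1 x2 phi a) = s1 /\ R a (repr s1 x1 x2 phi a).
  apply: (@pickP (fun d => sort_of d = s1 /\ R a d)).
  by exists a; split=> //; apply: Rrefl.
by split=> //; apply/esym; apply/repr_eq.
Qed.

End Representatives.

Lemma old_tuples_rcons (P : seq A -> Prop) (l0 : seq A) (m : ex_dom) :
  old_tuples P (rcons (map inl l0) m) <-> exists2 a, m = inl a & P (rcons l0 a).
Proof.
split=> [[l0' + Pl]|[a -> Pl]]; last by exists (rcons l0 a); rewrite ?map_rcons.
case/lastP: l0' Pl => [|l0' a] Pl; first by case: (l0).
by rewrite map_rcons => /rcons_inj[/inl_inj -> ->]; exists a.
Qed.

Lemma ex_func_relation f ar s l0 m : S' f = Some (Func ar s) -> relation_symbol f ->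
  ex_func f (map inl l0) m <->
  [/\ map (@sort_of _ _ A) l0 = ar, ex_sort m = s
    & exists2 a, m = inl a & old_graph f (rcons l0 a)].
Proof.
move=> S'f relf; rewrite /ex_func old_tuples_rcons ex_sorts S'f.
split=> [[[-> ->] [//|[Sf]]]|[-> -> h]]; last by split=> //; left.
by case: relf => [//|[vs [phi df]]]; rewrite /code_graph df.
Qed.

Lemma ex_func_total f l s : S' f = Some (Func (map ex_sort l) s) ->
  exists! m, ex_func f l m.
Proof.
move=> S'f; case Sf: (S f) => [d|].
  have relf : relation_symbol f by left; rewrite Sf.
  have [t tl|l0 lE] := @ex_olds l.
    by apply: (relation_symbol_sorts S'f _ relf); rewrite //= mem_rcons inE tl orbT.
  rewrite lE ex_sorts in S'f *; have [a [[as_ ga] ua]] := old_graph_unique S'f relf erefl.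
  exists (inl a); split; first by apply/(ex_func_relation _ _ S'f relf); split=> //; exists a.
  move=> m /(ex_func_relation _ _ S'f relf)[_ ms [b mb gb]].
  by rewrite mb in ms *; congr inl; apply: ua.
have := new_symbolP S'f _ Sf => /(_ ltac:(by [])); move dE: (def f) => sh sd.
case: sd dE.
- move=> vs phi h1 h2 h3 h4 dE.
  have relf : relation_symbol f by right; exists vs, phi.
  have [t tl|l0 lE] := @ex_olds l.
    by apply: (relation_symbol_sorts S'f _ relf); rewrite //= mem_rcons inE tl orbT.
  rewrite lE ex_sorts in S'f *; have [a [[as_ ga] ua]] := old_graph_unique S'f relf erefl.
  exists (inl a); split; first by apply/(ex_func_relation _ _ S'f relf); split=> //; exists a.
  move=> m /(ex_func_relation _ _ S'f relf)[_ ms [b mb gb]].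
  by rewrite mb in ms *; congr inl; apply: ua.
- move=> s0 s1 s2 pi1 pi2 h1 h2 h3 [ls ss] h5 h6 h7 h8 dE.
  case: l S'f ls => [|m0 [|]] //= S'f [/ex_new/(_ h1)[c m0c cs]].
  have := ne_normal c; rewrite /normal_code cs h3 => -[cb c1 c2].
  exists (inl (if f == pi1 then ne_fst c else ne_snd c)); split.
    split; first by rewrite S'f ss /=; case: ifP; rewrite ?c1 ?c2.
    by right; split=> //; rewrite /code_graph dE m0c.
  move=> m /(ex_func_code Sf); rewrite dE => /(_ ltac:(by [])).
  by rewrite /code_graph dE m0c; case: m => // a ->.
- move=> s0 s1 s2 r1 r2 h1 h2 h3 [ls ss] h5 h6 h7 h8 h9 h10 dE.
  case: l S'f ls => [|m0 [|]] //= S'f [m0s].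
  have [|a m0a] := @ex_old m0; first by rewrite m0s; case: ifP.
  have ok : normal_code s0 (f != r1) a a.
    rewrite /normal_code h3; split=> //; move: m0s; rewrite m0a /= => ->.
    by case: (f == r1).
  exists (inr (NewElement h1 h2 ok)); split.
    split; first by rewrite S'f ss.
    by right; split=> //; rewrite /code_graph dE m0a.
  move=> m fm; have [S'f' _] := fm.
  move: fm => /(ex_func_code Sf); rewrite dE => /(_ ltac:(by [])).
  rewrite /code_graph dE m0a; case: m S'f' => // c; rewrite S'f ss => -[cs] [ca cb].
  congr inr; have := ne_normal c; rewrite /normal_code -cs h3 => -[c2 _].
  by apply: new_element_eq; rewrite //= c2.
- move=> s0 s1 x phi h1 h2 h3 [ls ss] h5 h6 h7 dE.
  case: l S'f ls => [|m0 [|]] //= S'f [/ex_new/(_ h1)[c m0c cs]].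
  have := ne_normal c; rewrite /normal_code cs h3 => -[cb c1 c2 c3].
  exists (inl (ne_fst c)); split.
    split; first by rewrite S'f ss /= c2.
    by right; split=> //; rewrite /code_graph dE m0c.
  move=> m /(ex_func_code Sf); rewrite dE => /(_ ltac:(by [])).
  by rewrite /code_graph dE m0c; case: m => // a ->.
- move=> s0 s1 x1 x2 phi h1 h2 h3 [ls ss] h5 h6 h7 h8 h9 dE.
  case: l S'f ls => [|m0 [|]] //= S'f [m0s].
  have [|a m0a] := @ex_old m0; first by rewrite m0s.
  have as_ : sort_of a = s1 by rewrite -m0s m0a.
  have [reprs reprK] := repr_props h1 h2 h3 as_.
  have ok : normal_code s0 false (repr s1 x1 x2 phi a) (repr s1 x1 x2 phi a).
    by rewrite /normal_code h3; split.
  exists (inr (NewElement h1 h2 ok)); split.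
    split; first by rewrite S'f ss.
    by right; split=> //; rewrite /code_graph dE m0a.
  move=> m fm; have [S'f' _] := fm.
  move: fm => /(ex_func_code Sf); rewrite dE => /(_ ltac:(by [])).
  rewrite /code_graph dE m0a; case: m S'f' => // c; rewrite S'f ss => -[cs] ca.
  congr inr; have := ne_normal c; rewrite /normal_code -cs h3 => -[c0 c2 _ _].
  by apply: new_element_eq; rewrite //= ?c2.
Qed.

Lemma ex_const_total c s : S' c = Some (Const s) -> exists! m, ex_const c m.
Proof.
move=> S'c.
suff [a [[as_ ga] ua]] : exists! a : A, sort_of a = s /\ old_graph c [:: a].
  exists (inl a); split; first by split; [rewrite S'c /= as_|exists [:: a]].
  move=> m [S'cm [[|b [|]] // [mb] gb]].
  by rewrite mb; congr inl; apply: ua; move: S'cm; rewrite S'c mb => -[].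
rewrite /old_graph; case Sc: (S c) => [d|].
  have Sc' : S c = Some (Const s) by rewrite Sc; have := subS Sc; rewrite S'c => -[<-].
  have [a [ca ua]] := @const_int_total _ _ A c s Sc'.
  exists a; split.
    split; last by apply/(graph_const _ Sc').
    by have := const_intP ca; rewrite Sc' => -[].
  by move=> b [_ /(graph_const _ Sc')/ua].
have := new_symbolP S'c _ Sc => /(_ ltac:(by [])); move dE: (def c) => sh sd.
case: sd dE => // vs phi _ _ _ _ dE.
by have := @defA A AT c; rewrite S'c dE /= S'c; apply.
Qed.

(** Old sorts are nonempty, and the admissibility of a subsort says that some code
    is in normal form. *)
Lemma ex_sort_nonempty s : S' s = Some Sort -> exists m, ex_sort m = s.
Proof.
move=> S's; case Ss: (S s) => [d|].
  have [a as_] := @sort_nonempty _ _ A s (old_sort Ss S's).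
  by exists (inl a).
suff [b [a1 [a2 ok]]] : exists b a1 a2, normal_code s b a1 a2.
  by exists (inr (NewElement Ss S's ok)).
rewrite /normal_code; have := new_sortP S's Ss.
move sE: (def s) => sh sd; case: sd sE.
- move=> s1 s2 pi1 pi2 s1S s2S *.
  have [a as_] := @sort_nonempty _ _ A s1 s1S.
  have [b bs] := @sort_nonempty _ _ A s2 s2S.
  by exists false, a, b.
- move=> s1 s2 pi1 pi2 s1S *.
  have [a as_] := @sort_nonempty _ _ A s1 s1S.
  by exists false, a, a.
- move=> s1 i x phi s1S h2 h3 h4 h5 h6 sE.
  have := @defA A AT s; rewrite S's sE => /(_ ltac:(by []) Ss)[a as_ pa].
  by exists false, a, a.
- move=> s1 i x1 x2 phi s1S h2 h3 h4 h5 h6 h7 h8 sE.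
  have [a as_] := @sort_nonempty _ _ A s1 s1S.
  have [rs rr] := repr_props Ss S's sE as_.
  by exists false, (repr s1 x1 x2 phi a), (repr s1 x1 x2 phi a).
Qed.

Definition expansion : structure S'.
Proof.
refine (@Structure Sym S' ex_dom ex_sort _ ex_sort_nonempty ex_pred _ ex_func _
  ex_func_total ex_const _ ex_const_total).
- by case=> [a|c] /=; [apply/subS/sort_ofP|apply: ne_new].
- by move=> p l [].
- by move=> f l m [].
- by move=> c m [].
Defined.

Lemma expansion_graph p d (l : seq A) : S' p = Some d -> d <> Sort ->
  relation_symbol p -> map (@sort_of _ _ A) l = decl_sorts d ->
  @graph _ S' expansion p (map inl l) <-> old_graph p l.
Proof.
move=> S'p dS relp ld; case: d S'p dS ld => // [ar|ar s|s] S'p _ /= ld.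
- rewrite (graph_pred _ S'p) /= /ex_pred S'p ex_sorts ld.
  by split=> [[_ [l0 /inl_inj <-]]|] //; split=> //; exists l.
- case/lastP: l ld => [|l a] ld; first by case: (ar) ld.
  move: ld; rewrite map_rcons => /rcons_inj[lar as_].
  rewrite map_rcons (graph_func _ _ S'p) /= (ex_func_relation _ _ S'p relp).
  by split=> [[_ _ [b [->]]]|g] //; split=> //; exists a.
- case: l ld => [|a [|]] //= [as_].
  rewrite (graph_const _ S'p) /= /ex_const S'p /= as_.
  by split=> [[_ [l0 + gl]]|g]; [case: l0 gl => [|b [|]] // gb [->]|split=> //; exists [:: a]].
Qed.

Lemma old_graph_old p (l : seq A) : S p <> None -> old_graph p l <-> graph p l.
Proof. by rewrite /old_graph; case: (S p). Qed.

Lemma expansion_identifies : @identifies_reduct Sym S S' A expansion inl.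
Proof.
split=> //.
- by move=> a b [].
- by move=> m /ex_old[a ->]; exists a.
- move=> p l Sp; split=> [[S'p [l0 /inl_inj <-]]|pl].
    rewrite old_graph_old // => gl; apply/(graph_pred _ _) => //.
    by rewrite ex_sorts in S'p; apply: decl_sub S'p.
  have Sp' := pred_intP pl; split; first by rewrite ex_sorts; apply: subS.
  by exists l => //; apply/old_graph_old => //; apply/(graph_pred _ Sp').
- move=> f l a Sf; have relf : relation_symbol f by left.
  split=> [fl|fl].
    have S'f : S' f = Some (Func (map (@sort_of _ _ A) l) (sort_of a)).
      by case: (fl) => + _; rewrite ex_sorts.
    move: fl => /(ex_func_relation _ _ S'f relf)[_ _ [b [->]]].
    by rewrite old_graph_old // => /(graph_func _ _ (decl_sub Sf S'f)).
  have Sf' := func_intP fl; have S'f := subS Sf'.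
  apply/(ex_func_relation _ _ S'f relf); split=> //; exists a => //.
  by apply/old_graph_old => //; apply/(graph_func _ _ Sf').
- move=> c a Sc; split=> [[S'c [[|b [|]] // [->]]]|ca].
    by rewrite old_graph_old // => /(graph_const _ (decl_sub Sc S'c)).
  have Sc' := const_intP ca; split; first exact: subS.
  by exists [:: a] => //; apply/old_graph_old => //; apply/(graph_const _ Sc').
Qed.

(** Normal codes are chosen so that distinct codes stand for distinct elements;
    each definition then holds by computing the accompanying functions. *)
Lemma expansion_sort_true s : S' s = Some Sort -> S s = None ->
  shape_true expansion (def s).
Proof.
move=> S's Ss; have := new_sortP S's Ss; move sE: (def s) => sh sd.
case: sd sE => /=.
- move=> s1 s2 pi1 pi2 s1S s2S Sp1 S'p1 Sp2 S'p2 p12 p1E p2E sE a b as1 bs2.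
  have [a0 aE] : exists a0, a = inl a0 by apply: ex_old; rewrite as1.
  have [b0 bE] : exists b0, b = inl b0 by apply: ex_old; rewrite bs2.
  rewrite {}aE {}bE {a b} /= in as1 bs2 *.
  have ok : normal_code s false a0 b0 by rewrite /normal_code sE.
  exists (inr (NewElement Ss S's ok)); split.
    split=> //; split; split; rewrite /= ?S'p1 ?S'p2 ?as1 ?bs2 //; right; split=> //.
      by rewrite /code_graph p1E /= eqxx.
    by rewrite /code_graph p2E /= eq_sym (negbTE p12).
  move=> m [/ex_new/(_ Ss)[c -> cs] []].
  move=> /(ex_func_code Sp1); rewrite p1E => /(_ ltac:(by [])).
  rewrite /code_graph p1E eqxx => c1.
  move=> /(ex_func_code Sp2); rewrite p2E => /(_ ltac:(by [])).
  rewrite /code_graph p2E eq_sym (negbTE p12) => c2.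
  have := ne_normal c; rewrite /normal_code cs sE => -[cb _ _].
  by congr inr; apply: new_element_eq.
- move=> s1 s2 r1 r2 s1S s2S Sr1 S'r1 Sr2 S'r2 r12 r1E r2E sE; split.
    move=> m /ex_new/(_ Ss)[c -> cs].
    have := ne_normal c; rewrite /normal_code cs sE => -[_].
    case cb: (ne_bool c) => c1; [right|left]; exists (inl (ne_fst c)); split.
    + split=> //; split; first by rewrite S'r2 /= c1 cs.
      by right; split=> //; rewrite /code_graph r2E cb eq_sym r12.
    + move=> [a|d] [as_] /(ex_func_code Sr2); rewrite r2E => /(_ ltac:(by [])).
        by rewrite /code_graph r2E => -[->].
      by rewrite /code_graph r2E.
    + split=> //; split; first by rewrite S'r1 /= c1 cs.
      by right; split=> //; rewrite /code_graph r1E cb eqxx.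
    + move=> [a|d] [as_] /(ex_func_code Sr1); rewrite r1E => /(_ ltac:(by [])).
        by rewrite /code_graph r1E => -[->].
      by rewrite /code_graph r1E.
  move=> a b as1 bs2 [c].
  move=> /(ex_func_code Sr1); rewrite r1E => /(_ ltac:(by [])).
  rewrite /code_graph r1E eqxx => fa.
  move=> /(ex_func_code Sr2); rewrite r2E => /(_ ltac:(by [])).
  rewrite /code_graph r2E [r2 == r1]eq_sym r12 => fb.
  by case: a b c fa fb {as1 bs2} => [a|//] [b|//] [//|c] [_ ->] [].
- move=> s1 i x phi s1S Si S'i xs1 phix iE sE; split.
    move=> m ms; have [a mE] : exists a, m = inl a by apply: ex_old; rewrite ms.
    rewrite {}mE {m} /= in ms *.
    rewrite -[[:: inl a]]/(map (inl : A -> expansion) [:: a]).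
    rewrite -(tuple_sat_expansion expansion_identifies subS phix) //.
    split=> [pa|[m ms']].
      have ok : normal_code s false a a by rewrite /normal_code sE.
      exists (inr (NewElement Ss S's ok)) => //; split; first by rewrite S'i /= ms.
      by right; split=> //; rewrite /code_graph iE.
    have [c -> cs] := ex_new ms' Ss.
    move=> /(ex_func_code Si); rewrite iE => /(_ ltac:(by [])).
    rewrite /code_graph iE => ->.
    by have := ne_normal c; rewrite /normal_code cs sE => -[].
  move=> m m' /ex_new/(_ Ss)[c -> cs] /ex_new/(_ Ss)[d -> ds] [a].
  move=> /(ex_func_code Si); rewrite iE => /(_ ltac:(by [])).
  rewrite /code_graph iE => fc.
  move=> /(ex_func_code Si); rewrite iE => /(_ ltac:(by [])).
  rewrite /code_graph iE => fd.
  have := ne_normal c; have := ne_normal d.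
  rewrite /normal_code cs ds sE => -[db d2 _ _] [cb c2 _ _].
  case: a fc fd => // a fc fd; congr inr.
  by apply: new_element_eq; rewrite ?cs ?ds ?cb ?db // ?c2 ?d2 -?fc -?fd.
- move=> s1 eps x1 x2 phi s1S Se S'e x1s x2s x12 phix epsE sE; split.
    move=> m m' ms m's.
    have [a mE] : exists a, m = inl a by apply: ex_old; rewrite ms.
    have [b m'E] : exists b, m' = inl b by apply: ex_old; rewrite m's.
    rewrite {}mE {}m'E {m m'} /= in ms m's *.
    rewrite -[[:: inl a; inl b]]/(map (inl : A -> expansion) [:: a; b]).
    rewrite -(tuple_sat_expansion expansion_identifies subS phix) //; last first.
      by rewrite /= inE x12.
    rewrite (repr_eq Ss S's sE ms m's).
    split=> [[m]|rab].
      move=> /(ex_func_code Se); rewrite epsE => /(_ ltac:(by [])).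
      rewrite /code_graph epsE => fa.
      move=> /(ex_func_code Se); rewrite epsE => /(_ ltac:(by [])).
      rewrite /code_graph epsE => fb.
      by case: m fa fb => // c <- <-.
    have [rs rr] := repr_props Ss S's sE ms.
    have ok : normal_code s false (repr s1 x1 x2 phi a) (repr s1 x1 x2 phi a).
      by rewrite /normal_code sE.
    exists (inr (NewElement Ss S's ok)); split.
    + by rewrite S'e /= ms.
    + by right; split=> //; rewrite /code_graph epsE.
    + by rewrite S'e /= m's.
    + by right; split=> //; rewrite /code_graph epsE.
  move=> m /ex_new/(_ Ss)[c -> cs].
  have := ne_normal c; rewrite /normal_code cs sE => -[cb c2 c1 cr].
  exists (inl (ne_fst c)) => //; split; first by rewrite S'e /= cs c1.
  by right; split=> //; rewrite /code_graph epsE cr.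
Qed.

Lemma expansion_model : is_model T' expansion.
Proof.
apply/modelP; split=> [phi Tphi|p S'p Sp].
  have [fphi phi0] := sentencesP Tphi.
  apply/(holds_closed _ phi0) => v; have [u uP] := assignment_exists A.
  rewrite (@sat_closed _ _ _ v (inl \o u)) //.
  by apply/(sat_expansion expansion_identifies subS u fphi); apply: AT.
move dE: (S' p) S'p => [d|] // _.
have [dS|dS] := pselect (d = Sort).
  by apply: expansion_sort_true; rewrite // dE dS.
have := new_symbolP dE dS Sp; move pE: (def p) => sh sd.
case: sd pE.
- move=> vs phi vsd dsorts uvs phivs pE l lvs.
  have relp : relation_symbol p by right; exists vs, phi.
  have [s sl|l0 lE] := @ex_olds l; first by apply: dsorts; rewrite -vsd -lvs.
  rewrite lE in lvs *; rewrite (ex_sorts l0) in lvs.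
  rewrite -[map inl l0]/(map (inl : A -> expansion) l0).
  rewrite -(tuple_sat_expansion expansion_identifies subS phivs) //; last first.
    by rewrite -(size_map (@sort_of _ _ A)) lvs size_map.
  rewrite (expansion_graph dE dS relp); last by rewrite lvs.
  by rewrite /old_graph Sp pE.
- by move=> s s1 s2 pi1 pi2 Ss S's <- *; apply: expansion_sort_true.
- by move=> s s1 s2 r1 r2 Ss S's <- *; apply: expansion_sort_true.
- by move=> s s1 x phi Ss S's <- *; apply: expansion_sort_true.
- by move=> s s1 x1 x2 phi Ss S's <- *; apply: expansion_sort_true.
Qed.

Definition to_reduct (a : A) : reduct expansion :=
  exist (fun m : expansion => S (sort_of m) = Some Sort) (inl a) (sort_ofP a).

Definition of_reduct (m : reduct expansion) : A :=
  match sval m with inl a => a | inr c => ne_fst c end.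

Lemma of_reductK m : to_reduct (of_reduct m) = m.
Proof.
apply: (ir_inj (reductP expansion)) => /=; rewrite /of_reduct.
by case: m => -[a //|c] /= cS; move: (cS); rewrite ne_old.
Qed.

Lemma to_reduct_elementary : elementary to_reduct.
Proof.
split=> // phi fphi v _.
rewrite (sat_expansion expansion_identifies subS v fphi).
by rewrite (sat_expansion (reductP expansion) subS (to_reduct \o v) fphi).
Qed.

Lemma of_reduct_elementary : elementary of_reduct.
Proof.
have sE m : sort_of (of_reduct m) = sort_of m.
  by rewrite -[in RHS](of_reductK m).
split=> // phi fphi v vP.
rewrite (to_reduct_elementary.2 phi fphi (of_reduct \o v)).
  by rewrite (_ : to_reduct \o _ = v) //; apply: funext => x; apply: of_reductK.
by move=> x xS /=; rewrite sE vP.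
Qed.

End Expand.

Lemma reduct_essentially_surjective : essentially_surjective reduct_functor.
Proof.
move=> [A AT]; exists (exist _ (expansion AT) (@expansion_model A AT)).
exists (exist _ _ (@of_reduct_elementary A AT)), (exist _ _ (@to_reduct_elementary A AT)).
split; apply: eq_exist; apply: funext => // m; exact: of_reductK.
Qed.

Lemma reduct_equivalence : equivalent_categories (Mod T') (Mod T).
Proof.
exists reduct_functor; split.
- exact: reduct_full.
- exact: reduct_faithful.
- exact: reduct_essentially_surjective.
Qed.

End Extension.

(** * Morita equivalence *)

(** The definitions of the new symbols are read off from the sentences [delta]. *)
Lemma morita_extension_equivalence (Sym : eqType) (S S' : signature Sym)
    (T : theory S) (T' : theory S') :
  morita_extension T T' -> equivalent_categories (Mod T') (Mod T).
Proof.
move=> [subS [delta [T'E deltaP]]].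
pose def p := shape_of (delta p).
apply: (@reduct_equivalence Sym S S' T T' def subS).
- move=> p S'p Sp; have [D [adm [ed pD deltaD _]]] := deltaP p (conj S'p Sp).
  exists D => //; have [wf _ _] := explicit_def_defines ed.
  by split=> // q /deltaD; rewrite /def => ->.
- move=> M.
  have deltaE p : S' p <> None -> S p = None ->
      holds M (delta p) <-> shape_true M (def p).
    move=> S'p Sp; have [D [adm [ed _ _ _]]] := deltaP p (conj S'p Sp).
    have [_ trueP _] := explicit_def_defines ed; rewrite -trueP.
    apply: holds_closed; have [|_ //] := @sentencesP _ _ T' (delta p).
    by rewrite T'E; right; exists p.
  rewrite /is_model T'E; split=> [h|[hT hdef] phi [/hT //|[p [S'p Sp] <-]]].
    split=> [phi Tphi|p S'p Sp]; first by apply: h; left.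
    by apply/deltaE => //; apply: h; right; exists p.
  by apply/deltaE => //; apply: hdef.
- move=> A AT p S'p Sp; have [D [adm [ed _ _ admT]]] := deltaP p (conj S'p Sp).
  by have [_ _ admP] := explicit_def_defines ed; apply: admP => psi /admT; apply.
Qed.

Lemma morita_chain_equivalence (Sym : eqType) (S S' : signature Sym)
    (T : theory S) (T' : theory S') :
  morita_chain T T' -> equivalent_categories (Mod T') (Mod T).
Proof.
elim=> [|S1 T1 S2 T2 _ IH /morita_extension_equivalence ext].
  exists (@Functor (Mod T) (Mod T) id (fun _ _ => id)
    (fun=> erefl) (fun _ _ _ _ _ => erefl)).
  split=> [a b g|a b f g //|a]; first by exists g.
  by exists a, (idc a), (idc a); rewrite comp_idl.
exact: equivalent_categories_trans ext IH.
Qed.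

Lemma logically_equivalent_equivalence (Sym : eqType) (S : signature Sym)
    (T T' : theory S) :
  logically_equivalent T T' -> equivalent_categories (Mod T) (Mod T').
Proof.
move=> TT'.
exists (@Functor (Mod T) (Mod T')
  (fun A => exist _ (sval A) ((TT' (sval A)).1 (svalP A)))
  (fun _ _ => id) (fun=> erefl) (fun _ _ _ _ _ => erefl)).
split=> [a b g|a b f g //|[A AT']]; first by exists g.
exists (exist _ A ((TT' A).2 AT')), (emb_id A), (emb_id A).
by split; apply: eq_exist.
Qed.

Theorem theorem5p1 (Sym : eqType) (S1 S2 : signature Sym)
    (T1 : theory S1) (T2 : theory S2) :
  morita_equivalent T1 T2 -> categorically_equivalent T1 T2.
Proof.
move=> [S [T1' [T2' [_ chain1 chain2 T12]]]].
apply: equivalent_categories_trans (morita_chain_equivalence chain2).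
apply: equivalent_categories_trans (logically_equivalent_equivalence T12).
exact: equivalent_categories_sym (morita_chain_equivalence chain1).
Qed.
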